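(* Let $A$ be a finite dimensional algebra over a field and $U=\bigoplus_{i=1}^mU_i\in2\text{-}\mathsf{psilt}\,A$ with each $U_i$ indecomposable. Then each $F\in\mathsf{Facet}\,D(U)$ satisfies the following properties. (1) The module $L_F$ is a simple object of $\mathcal W_\theta$ for any $\theta\in F^\circ$. (2) The element $\epsilon_F[L_F]\in K_0(\mathsf{mod}\,A)$ is an inner normal vector of the facet $F$ of $D(U)$, with $$F=\{\theta\in D(U)\mid\theta(L_F)=0\}.$$ Therefore $$D(U)=\bigcap_{F\in\mathsf{Facet}\,D(U)}\{\theta\in K_0(\mathsf{proj}\,A)_{\mathbb R}\mid\epsilon_F\cdot\theta(L_F)\ge0\}.$$
   Context: Let $K$ be a field and $A$ a finite dimensional $K$-algebra. $\mathsf{mod}\,A$, $\mathsf{proj}\,A$, $\mathsf{inj}\,A$ are the categories of finitely generated (f.g.), f.g. projective, f.g. injective right $A$-modules; $\mathsf K^{\mathrm b}(\mathsf{proj}\,A)$ is the homotopy category of bounded complexes; $\nu\colon\mathsf K^{\mathrm b}(\mathsf{proj}\,A)\to\mathsf K^{\mathrm b}(\mathsf{inj}\,A)$ is the Nakayama functor. $n:=|A|$ is the number of isoclasses of indecomposable projective $A$-modules. $U\in\mathsf K^{\mathrm b}(\mathsf{proj}\,A)$ is presilting if $\mathrm{Hom}(U,U[\ell])=0$ for all $\ell\ge1$, and 2-term if it is isomorphic to a complex concentrated in degrees $-1,0$. $2\text{-}\mathsf{psilt}\,A$ is the set of isoclasses of basic 2-term presilting complexes. $K_0(\mathsf{proj}\,A)_{\mathbb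 R}:=K_0(\mathsf{proj}\,A)\otimes_{\mathbb Z}\mathbb R\cong\mathbb R^n$. Each $\theta\in K_0(\mathsf{proj}\,A)_{\mathbb R}$ is a linear form on $K_0(\mathsf{mod}\,A)_{\mathbb R}$ via the Euler bilinear form, determined by $\langle[P],[M]\rangle=\dim_K\mathrm{Hom}_A(P,M)$ for $P\in\mathsf{proj}\,A$, $M\in\mathsf{mod}\,A$; write $\theta(M):=\langle\theta,[M]\rangle$. Define the torsion pairs $(\overline{\mathcal T}_\theta,\mathcal F_\theta)$, $(\mathcal T_\theta,\overline{\mathcal F}_\theta)$ in $\mathsf{mod}\,A$: $M\in\overline{\mathcal T}_\theta$ (resp. $\mathcal T_\theta$) iff $\theta(X)\ge0$ (resp. $>0$) for all nonzero factor modules $X$ of $M$; $M\in\overline{\mathcal F}_\theta$ (resp. $\mathcal F_\theta$) iff $\theta(Y)\le0$ (resp. $<0$) for all nonzero submodules $Y$ of $M$. $\mathcal W_\theta:=\overline{\mathcal T}_\theta\cap\overline{\mathcal F}_\theta$ is a wide (abelian, extension closed) subcategory of $\mathsf{mod}\,A$. For $M\in\mathsf{mod}\,A$, $\overline{\mathrm t}_\theta M$ and $\mathrm t_\theta M$ are the largest submodules of $M$ in $\overline{\mathcal T}_\theta$ and $\mathcal T_\theta$, and $\mathrm w_\theta M:=\overline{\mathrm t}_\theta M/\mathrm t_\theta M\in\mathcal W_\theta$. $D(U):=\{\theta\mid H^0(U)\in\overline{\mathcal T}_\theta,\ H^{-1}(\nu U)\in\overline{\mathcal F}_\theta\}$,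 a full-dimensional rational polyhedral cone in $K_0(\mathsf{proj}\,A)_{\mathbb R}$. A facet of $D(U)$ is a face of dimension $n-1$; $\mathsf{Facet}\,D(U)$ is the set of facets. $F^\circ$ is the relative interior of a face $F$. An element $v\in K_0(\mathsf{mod}\,A)$ is an inner normal vector of a facet $F$ if the linear functional $\theta\mapsto\theta(v)$ is nonzero, vanishes on $F$ and is nonnegative on $D(U)$. For $i\in\{1,\ldots,m\}$, with $\mathrm{rad}_A(-,-)$ the radical of the category $\mathsf{mod}\,A$, $$Y_i^+:=H^0(U_i)\Big/\sum_{f\in\mathrm{rad}_A(H^0(U),H^0(U_i))}\mathrm{Im}\,f,\qquad X_i^-:=\bigcap_{f\in\mathrm{rad}_A(H^{-1}(\nu U_i),H^{-1}(\nu U))}\mathrm{Ker}\,f.$$ Put $\partial_i^+:=\{\theta\in D(U)\mid Y_i^+\notin\mathcal T_\theta\}$, $\partial_i^-:=\{\theta\in D(U)\mid X_i^-\notin\mathcal F_\theta\}$. For each facet $F$ of $D(U)$ there is a unique pair $(i_F,\epsilon_F)\in\{1,\ldots,m\}\times\{\pm\}$ with $F\subset\partial_{i_F}^{\epsilon_F}$. Set $L_F:=\mathrm w_\theta Y_{i_F}^+$ if $\epsilon_F=+$ and $L_F:=\mathrm w_\theta X_{i_F}^-$ if $\epsilon_F=-$, where $\theta\in F^\circ$ is arbitrary; this is a nonzero module independent of the choice of $\theta\in F^\circ$. The sign $\epsilon_F$ is also read as $\pm1$. *)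

(* Defs.v *)
From HB Require Import structures.
From mathcomp Require Import all_boot all_order all_algebra all_field.
From mathcomp Require Import all_classical all_reals all_analysis.
Import numFieldNormedType.Exports.

Set Implicit Arguments.
Unset Strict Implicit.
Unset Printing Implicit Defensive.

Import Order.TTheory GRing.Theory Num.Theory.
Local Open Scope classical_set_scope.
Local Open Scope quotient_scope.
Local Open Scope ring_scope.

(** * Linear algebra *)

Section Linear.
Variable K : fieldType.

Lemma linfunE (V W : vectType K) (f : V -> W) : linear f -> linfun f =1 f.
Proof.
move=> fl; pose m := GRing.isLinear.Build K V W _ f fl.
pose f' : {linear V -> W} := HB.pack f m.
exact: (lfunE f').
Qed.

Definition precomp (V1 V2 W : vectType K) (u : 'Hom(V1, V2)) :
  'Hom('Hom(V2, W), 'Hom(V1, W)) := linfun (fun g => (g \o u)%VF).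

Definition postcomp (V1 V2 W : vectType K) (u : 'Hom(V2, W)) :
  'Hom('Hom(V1, V2), 'Hom(V1, W)) := linfun (fun g => (u \o g)%VF).

Lemma precompE (V1 V2 W : vectType K) (u : 'Hom(V1, V2)) (g : 'Hom(V2, W)) :
  precomp W u g = (g \o u)%VF.
Proof.
by rewrite linfunE// => k x y; apply/lfunP => z; do !rewrite lfunE /=.
Qed.

Lemma postcompE (V1 V2 W : vectType K) (u : 'Hom(V2, W)) (g : 'Hom(V1, V2)) :
  postcomp V1 u g = (u \o g)%VF.
Proof.
rewrite linfunE// => k x y; apply/lfunP => z; do !rewrite lfunE /=.
by rewrite linearP.
Qed.

Fact vspan_ex (V : vectType K) (S : set V) :
  exists W : {vspace V}, (forall v, S v -> v \in W) /\
    (forall W' : {vspace V}, (forall v, S v -> v \in W') -> (W <= W')%VS).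
Proof.
pose good k := `[< exists W : {vspace V}, \dim W = k /\ forall v, S v -> v \in W >].
have ex : exists k, good k.
  by exists (\dim {: V}); apply/asboolP; exists fullv; split=> // v _; rewrite memvf.
case: (ex_minnP ex) => k /asboolP[W [dW SW]] kmin; exists W; split=> // W' SW'.
apply/capv_idPl/eqP; rewrite eqEdim capvSl dW; apply: kmin.
apply/asboolP; exists (W :&: W')%VS; split=> // v Sv.
by rewrite memv_cap SW ?SW'.
Qed.

(* The linear span of a possibly infinite set of vectors. *)
Definition vspan (V : vectType K) (S : set V) : {vspace V} := sval (cid (vspan_ex S)).

Lemma vspan_sub (V : vectType K) (S : set V) v : S v -> v \in vspan S.
Proof. by rewrite /vspan; case: cid => W /= [+ _]; apply. Qed.

Lemma vspan_min (V : vectType K) (S : set V) (W : {vspace V}) :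
  (forall v, S v -> v \in W) -> (vspan S <= W)%VS.
Proof. by rewrite /vspan; case: cid => W0 /= [_]; apply. Qed.

Definition lin_closed (V : vectType K) (S : set V) : Prop :=
  S 0 /\ forall k x y, S x -> S y -> S (k *: x + y).

Lemma mem_vspan (V : vectType K) (S : set V) v :
  lin_closed S -> (v \in vspan S) <-> S v.
Proof.
move=> [S0 SD]; split; last exact: vspan_sub.
pose good k := `[< exists W : {vspace V}, \dim W = k /\ forall x, x \in W -> S x >].
have ex : exists k, good k.
  exists 0%N; apply/asboolP; exists 0%VS; rewrite dimv0; split=> // x.
  by rewrite memv0 => /eqP->.
have ub k : good k -> (k <= \dim {: V})%N.
  by move=> /asboolP[W [<- _]]; rewrite dimvS ?subvf.
case: (ex_maxnP ex ub) => k /asboolP[W [dW WS]] kmax.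
suff SW : forall x, S x -> x \in W by move=> /(subvP (vspan_min SW))/WS.
move=> x Sx; have WxS y : y \in (W + <[x]>)%VS -> S y.
  move=> /memv_addP[w wW [_ /vlineP[c ->] ->]]; rewrite addrC.
  by apply: SD => //; exact: WS.
have : W == (W + <[x]>)%VS.
  by rewrite eqEdim addvSl dW; apply: kmax; apply/asboolP; exists (W + <[x]>)%VS.
by move=> /eqP ->; rewrite (subvP (addvSr _ _)) ?memv_line.
Qed.

End Linear.

(** * Finitely generated right modules over a finite dimensional algebra *)

Section Modules.
Variables (K : fieldType) (A : falgType K).

(* Over the finite dimensional algebra A, finitely generated modules are the
   finite dimensional ones.  [ract M a] is the map x |-> x a; note the order of
   the factors in [ractM], which makes this a right action. *)
Record rmod := RMod {
  rcar :> vectType K;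
  ract : A -> 'End(rcar);
  ract_linear : linear ract;
  ract1 : ract 1 = \1%VF;
  ractM : forall a b, ract (a * b) = (ract b \o ract a)%VF }.

Arguments ract M a : rename.

Definition rzero (M : rmod) : Prop := \dim {: M} = 0%N.

Definition is_hom (M N : rmod) (f : 'Hom(M, N)) : Prop :=
  forall a x, f (ract M a x) = ract N a (f x).

Lemma is_hom_closed (M N : rmod) : lin_closed (@is_hom M N).
Proof.
split=> [a x|k f g hf hg a x]; first by rewrite !lfunE /= linear0.
by rewrite !add_lfunE !scale_lfunE hf hg linearP.
Qed.

(* Hom_A(M, N) as a subspace of Hom_K(M, N) *)
Definition HomA (M N : rmod) : {vspace 'Hom(M, N)} := vspan (@is_hom M N).

Lemma mem_HomA (M N : rmod) (f : 'Hom(M, N)) : (f \in HomA M N) <-> is_hom f.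
Proof. exact: mem_vspan (is_hom_closed M N). Qed.

Definition is_iso (M N : rmod) (f : 'Hom(M, N)) : Prop :=
  is_hom f /\ exists g : 'Hom(N, M),
    [/\ is_hom g, (g \o f)%VF = \1%VF & (f \o g)%VF = \1%VF].

Definition risom (M N : rmod) : Prop := exists f : 'Hom(M, N), is_iso f.

(** ** Submodules and factor modules *)

Definition stable (M : rmod) (N : {vspace M}) : Prop :=
  forall a x, x \in N -> ract M a x \in N.

Record submod (M : rmod) := SubMod { svs :> {vspace M}; svs_stable : stable svs }.

Fact gensub_stable (M : rmod) (S : set M) :
  stable (vspan [set y | exists a, exists2 x, S x & y = ract M a x]).
Proof.
set T := [set y | _] => a x.
have : (vspan T <= ract M a @^-1: vspan T)%VS.
  apply: vspan_min => _ [b [z Sz ->]]; rewrite -memv_preim -comp_lfunE -ractM.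
  by apply: vspan_sub; exists (b * a), z.
by move=> /subvP h /h; rewrite -memv_preim.
Qed.

(* The submodule generated by a set *)
Definition gensub (M : rmod) (S : set M) : submod M := SubMod (@gensub_stable M S).

Lemma gensub_sub (M : rmod) (S : set M) x : S x -> x \in svs (gensub S).
Proof.
by move=> Sx; apply: vspan_sub; exists 1, x => //; rewrite ract1 id_lfunE.
Qed.

Lemma gensub_min (M : rmod) (S : set M) (N : submod M) :
  (forall x, S x -> x \in svs N) -> (gensub S <= N)%VS.
Proof.
by move=> SN; apply: vspan_min => _ [a [x /SN xN ->]]; apply: svs_stable.
Qed.

(* [gensub] is also used to package sets which already are submodules *)
Lemma mem_gensub (M : rmod) (S : set M) x : lin_closed S ->
  (forall a y, S y -> S (ract M a y)) -> (x \in svs (gensub S)) <-> S x.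
Proof.
move=> lS aS; split; last exact: gensub_sub.
suff /subvP h : (gensub S <= vspan S)%VS by move=> /h /(mem_vspan _ lS).
by apply: vspan_min => _ [a [y Sy ->]]; apply: vspan_sub; exact: aS.
Qed.

Section SubQuot.
Variables (M : rmod) (N : submod M).

Definition sub_inj : 'Hom(subvs_of N, M) := linfun vsval.
Definition sub_ret : 'Hom(M, subvs_of N) := linfun (vsproj N).
Definition sub_act (a : A) : 'End(subvs_of N) :=
  (sub_ret \o (ract M a \o sub_inj))%VF.

Lemma sub_retK x : x \in svs N -> sub_inj (sub_ret x) = x.
Proof. by move=> xN; rewrite !lfunE /= vsprojK. Qed.

Lemma sub_injE x : sub_inj x = vsval x. Proof. exact: lfunE. Qed.

Lemma sub_inj_inj : injective sub_inj.
Proof. by move=> x y; rewrite !sub_injE => /subvs_inj. Qed.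

Lemma sub_actE a x : sub_inj (sub_act a x) = ract M a (sub_inj x).
Proof.
rewrite !comp_lfunE sub_retK//; apply: svs_stable.
by rewrite sub_injE subvsP.
Qed.

Fact sub_act_linear : linear sub_act.
Proof.
move=> k a b; apply/lfunP => x; apply: sub_inj_inj.
rewrite add_lfunE scale_lfunE linearP/= !sub_actE.
by rewrite ract_linear add_lfunE scale_lfunE.
Qed.

Fact sub_act1 : sub_act 1 = \1%VF.
Proof.
by apply/lfunP => x; apply: sub_inj_inj; rewrite sub_actE ract1 !id_lfunE.
Qed.

Fact sub_actM a b : sub_act (a * b) = (sub_act b \o sub_act a)%VF.
Proof.
apply/lfunP => x; apply: sub_inj_inj.
by rewrite comp_lfunE !sub_actE ractM comp_lfunE.
Qed.

Definition subm : rmod := RMod sub_act_linear sub_act1 sub_actM.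

(* The factor module M / N is realized on a linear complement of N *)
Definition quo_carrier := subvs_of (N^C)%VS.
Definition quo_prj : 'Hom(M, quo_carrier) :=
  (linfun (vsproj (N^C)%VS) \o daddv_pi (N^C)%VS N)%VF.
Definition quo_lift : 'Hom(quo_carrier, M) := linfun vsval.
Definition quo_act (a : A) : 'End(quo_carrier) :=
  (quo_prj \o (ract M a \o quo_lift))%VF.

Lemma quo_liftK x : quo_prj (quo_lift x) = x.
Proof.
rewrite /quo_prj /quo_lift !comp_lfunE !lfunE /=.
by rewrite daddv_pi_id ?subvsP ?vsvalK// capvC capv_compl.
Qed.

Lemma quo_prjK x : x - quo_lift (quo_prj x) \in svs N.
Proof.
rewrite /quo_prj /quo_lift !comp_lfunE !lfunE /= vsprojK ?memv_pi//.
have cap0 : (N^C :&: N = 0)%VS by rewrite capvC capv_compl.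
have xin : x \in (N^C + N)%VS by rewrite addvC addv_complf memvf.
by rewrite -{1}(daddv_pi_add cap0 xin) addrC addKr memv_pi.
Qed.

Lemma quo_ker x : x \in svs N -> quo_prj x = 0.
Proof.
move=> xN; have := quo_prjK x.
rewrite rpredBl// => h.
have h2 : quo_lift (quo_prj x) \in (N^C)%VS by rewrite lfunE /= subvsP.
have : quo_lift (quo_prj x) \in (N :&: N^C)%VS by rewrite memv_cap h h2.
rewrite capv_compl memv0 => /eqP e.
by rewrite -(quo_liftK (quo_prj x)) e linear0.
Qed.

Lemma lker_quo_prj : lker quo_prj = N.
Proof.
apply/vspaceP => x; rewrite memv_ker; apply/eqP/idP => [h|]; last exact: quo_ker.
by have := quo_prjK x; rewrite h linear0 subr0.
Qed.

Lemma limg_quo_prj : limg quo_prj = fullv.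
Proof.
apply/vspaceP => x; rewrite memvf.
by apply/memv_imgP; exists (quo_lift x); rewrite ?memvf ?quo_liftK.
Qed.

Lemma quo_actE a x : quo_act a (quo_prj x) = quo_prj (ract M a x).
Proof.
rewrite /quo_act (comp_lfunE quo_prj) comp_lfunE; apply/eqP.
by rewrite eq_sym -subr_eq0 -!linearB /= (quo_ker (svs_stable a (quo_prjK x))).
Qed.

Lemma quo_prj_surj (P : quo_carrier -> Prop) : (forall x, P (quo_prj x)) -> forall y, P y.
Proof. by move=> h y; rewrite -(quo_liftK y). Qed.

Fact quo_act_linear : linear quo_act.
Proof.
move=> k a b; apply/lfunP; apply: quo_prj_surj => x.
rewrite add_lfunE scale_lfunE !quo_actE ract_linear add_lfunE scale_lfunE.
by rewrite linearP.
Qed.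

Fact quo_act1 : quo_act 1 = \1%VF.
Proof.
by apply/lfunP; apply: quo_prj_surj => x; rewrite quo_actE ract1 !id_lfunE.
Qed.

Fact quo_actM a b : quo_act (a * b) = (quo_act b \o quo_act a)%VF.
Proof.
apply/lfunP; apply: quo_prj_surj => x.
by rewrite comp_lfunE !quo_actE ractM comp_lfunE.
Qed.

Definition quom : rmod := RMod quo_act_linear quo_act1 quo_actM.

End SubQuot.

(* B / C for submodules C <= B of M *)
Definition subquo (M : rmod) (B C : submod M) : rmod :=
  quom (gensub [set x : subm B | vsval x \in svs C]).

(** ** Projective modules *)

Definition projective (P : rmod) : Prop :=
  forall (M N : rmod) (g : 'Hom(M, N)) (f : 'Hom(P, N)),
    is_hom g -> limg g = fullv -> is_hom f ->
    exists2 h : 'Hom(P, M), is_hom h & (g \o h)%VF = f.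

Definition is_dsum (I : finType) (M : rmod) (M_ : I -> rmod) : Prop :=
  exists (inj : forall i, 'Hom(M_ i, M)) (prj : forall i, 'Hom(M, M_ i)),
    [/\ forall i, is_hom (inj i) /\ is_hom (prj i),
        forall i, (prj i \o inj i)%VF = \1%VF,
        forall i j, i != j -> (prj j \o inj i)%VF = 0
      & \sum_i (inj i \o prj i)%VF = \1%VF].

Definition indecomposable (M : rmod) : Prop :=
  ~ rzero M /\
  forall M_ : bool -> rmod, is_dsum M M_ -> exists b, rzero (M_ b).

(* P lists the indecomposable projective modules up to isomorphism, so that
   n = |A|. *)
Definition indproj_list (n : nat) (P : 'I_n -> rmod) : Prop :=
  [/\ forall j, projective (P j) /\ indecomposable (P j),
      forall j k, risom (P j) (P k) -> j = k
    & forall Q, projective Q -> indecomposable Q -> exists j, risom Q (P j)].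

(** ** The radical of mod A *)

Definition in_rad (M N : rmod) (f : 'Hom(M, N)) : Prop :=
  is_hom f /\
  forall g : 'Hom(N, M), is_hom g -> @is_iso M M (\1%VF - (g \o f)%VF).

(** ** The Nakayama functor D Hom_A(-, A) *)

Fact regular_act_linear : linear (@amulr K A).
Proof. exact: amulr_is_linear. Qed.

Fact regular_act1 : @amulr K A 1 = \1%VF.
Proof. by apply/lfunP => x; rewrite lfunE /= id_lfunE mulr1. Qed.

Fact regular_actM (a b : A) : amulr (a * b) = (amulr b \o amulr a)%VF.
Proof. by apply/lfunP => x; rewrite comp_lfunE !lfunE /= mulrA. Qed.

Definition regular : rmod := RMod regular_act_linear regular_act1 regular_actM.

Section Nakayama.
Variable M : rmod.

Definition dualA := subvs_of (HomA M regular).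

Definition dualA_inj : 'Hom(dualA, 'Hom(M, regular)) := linfun vsval.
Definition dualA_ret : 'Hom('Hom(M, regular), dualA) := linfun (vsproj _).

(* The left action of A on Hom_A(M, A): (a g)(x) = a g(x) *)
Definition dualA_act (a : A) : 'End(dualA) :=
  (dualA_ret \o (postcomp M (amull a : 'End(regular)) \o dualA_inj))%VF.

Lemma dualA_injE (g : dualA) : dualA_inj g = vsval g.
Proof. exact: lfunE. Qed.

Lemma dualA_retK g : is_hom g -> dualA_inj (dualA_ret g) = g.
Proof. by move=> /mem_HomA h; rewrite dualA_injE lfunE /= vsprojK. Qed.

Lemma dualA_hom (g : dualA) : is_hom (dualA_inj g).
Proof. by apply/mem_HomA; rewrite dualA_injE subvsP. Qed.

Lemma dualA_inj_inj : injective dualA_inj.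
Proof. by move=> x y; rewrite !dualA_injE => /subvs_inj. Qed.

Lemma dualA_actE a (g : dualA) :
  dualA_inj (dualA_act a g) = ((amull a : 'End(regular)) \o dualA_inj g)%VF.
Proof.
rewrite 2!comp_lfunE postcompE dualA_retK// => b x.
by rewrite !comp_lfunE dualA_hom !lfunE /= mulrA.
Qed.

Definition nu_act (a : A) : 'End('Hom(dualA, K^o)) := precomp K^o (dualA_act a).

Lemma nu_actE a phi g : nu_act a phi g = phi (dualA_act a g).
Proof. by rewrite /nu_act precompE comp_lfunE. Qed.

Fact nu_act_linear : linear nu_act.
Proof.
move=> k a b; apply/lfunP => phi; apply/lfunP => g.
rewrite !add_lfunE !scale_lfunE !nu_actE -linearP; congr (phi _).
apply: dualA_inj_inj; rewrite linearP /= !dualA_actE linearP.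
by apply/lfunP => x; rewrite !(add_lfunE, scale_lfunE, comp_lfunE).
Qed.

Fact nu_act1 : nu_act 1 = \1%VF.
Proof.
apply/lfunP => phi; apply/lfunP => g; rewrite nu_actE id_lfunE; congr (phi _).
by apply: dualA_inj_inj; rewrite dualA_actE amull1 comp_lfun1l.
Qed.

Fact nu_actM a b : nu_act (a * b) = (nu_act b \o nu_act a)%VF.
Proof.
apply/lfunP => phi; apply/lfunP => g; rewrite comp_lfunE !nu_actE; congr (phi _).
apply: dualA_inj_inj; rewrite !dualA_actE; apply/lfunP => x.
by rewrite !lfun_simp /= mulrA.
Qed.

Definition nu : rmod := RMod nu_act_linear nu_act1 nu_actM.

End Nakayama.

Definition dualA_map (M N : rmod) (f : 'Hom(M, N)) : 'Hom(dualA N, dualA M) :=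
  (dualA_ret M \o (precomp _ f \o dualA_inj N))%VF.

Definition nu_map (M N : rmod) (f : 'Hom(M, N)) : 'Hom(nu M, nu N) :=
  precomp K^o (dualA_map f).

Lemma dualA_mapE (M N : rmod) (f : 'Hom(M, N)) g : is_hom f ->
  dualA_inj M (dualA_map f g) = (dualA_inj N g \o f)%VF.
Proof.
move=> hf; rewrite 2!comp_lfunE precompE dualA_retK// => a x.
by rewrite !comp_lfunE hf dualA_hom.
Qed.

Lemma nu_mapE (M N : rmod) (f : 'Hom(M, N)) (phi : nu M) (g : dualA N) :
  nu_map f phi g = phi (dualA_map f g).
Proof. by rewrite /nu_map precompE comp_lfunE. Qed.

Lemma nu_map_hom (M N : rmod) (f : 'Hom(M, N)) : is_hom f -> is_hom (nu_map f).
Proof.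
move=> hf a phi; apply/lfunP => g.
rewrite nu_mapE !nu_actE nu_mapE; congr (phi _).
apply: dualA_inj_inj; rewrite dualA_actE !dualA_mapE// dualA_actE.
exact: comp_lfunA.
Qed.

Lemma nu_map0 (M N : rmod) : nu_map (0 : 'Hom(M, N)) = 0.
Proof.
have h0 : is_hom (0 : 'Hom(M, N)) by case: (is_hom_closed M N).
apply/lfunP => phi; apply/lfunP => g; rewrite nu_mapE !zero_lfunE.
suff -> : dualA_map (0 : 'Hom(M, N)) g = 0 by rewrite linear0.
by apply: dualA_inj_inj; rewrite dualA_mapE// comp_lfun0r linear0.
Qed.

Lemma nu_map_comp (L M N : rmod) (f : 'Hom(M, N)) (g : 'Hom(L, M)) :
  is_hom f -> is_hom g -> nu_map (f \o g)%VF = (nu_map f \o nu_map g)%VF.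
Proof.
move=> hf hg; have hfg : is_hom (f \o g)%VF.
  by move=> a x; rewrite !comp_lfunE hg hf.
apply/lfunP => phi; apply/lfunP => h; rewrite comp_lfunE !nu_mapE.
congr (phi _); apply: dualA_inj_inj; rewrite !dualA_mapE//.
exact: comp_lfunA.
Qed.

(** * Complexes *)

(* The differential is given between all pairs of degrees, and vanishes off the
   pairs (i, i + 1); this avoids transporting along equalities of degrees. *)
Record cpx := Cpx {
  cob :> int -> rmod;
  cd : forall i j, 'Hom(cob i, cob j);
  cd_hom : forall i j, is_hom (cd i j);
  cd_shape : forall i j, j != i + 1 -> cd i j = 0;
  cd_cd : forall i j k, (cd j k \o cd i j)%VF = 0 }.

Arguments cd C i j : rename.

Definition is_cmap (C D : cpx) (f : forall i, 'Hom(C i, D i)) : Prop :=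
  (forall i, is_hom (f i)) /\
  forall i j, (cd D i j \o f i)%VF = (f j \o cd C i j)%VF.

Definition homotopic (C D : cpx) (f g : forall i, 'Hom(C i, D i)) : Prop :=
  exists2 h : forall i j, 'Hom(C i, D j), (forall i j, is_hom (h i j)) &
    forall i, f i - g i =
      (cd D (i - 1) i \o h i (i - 1))%VF + (h (i + 1) i \o cd C i (i + 1))%VF.

Definition cident (C : cpx) (i : int) : 'End(C i) := \1%VF.
Definition czero (C D : cpx) (i : int) : 'Hom(C i, D i) := 0.

(* Objects of K^b(proj A) *)
Definition in_Kbproj (C : cpx) : Prop :=
  (forall i, projective (C i)) /\
  exists N : nat, forall i : int, (N < `|i|)%N -> rzero (C i).

(* The following notions are those of the homotopy category *)
Definition kisom (C D : cpx) : Prop :=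
  exists (f : forall i, 'Hom(C i, D i)) (g : forall i, 'Hom(D i, C i)),
    [/\ is_cmap f, is_cmap g,
        homotopic (fun i => (g i \o f i)%VF) (cident C)
      & homotopic (fun i => (f i \o g i)%VF) (cident D)].

Definition kzero (C : cpx) : Prop := homotopic (cident C) (czero C C).

Definition is_kdsum (I : finType) (C : cpx) (C_ : I -> cpx) : Prop :=
  exists (inj : forall i k, 'Hom(C_ i k, C k)) (prj : forall i k, 'Hom(C k, C_ i k)),
    [/\ forall i, is_cmap (inj i) /\ is_cmap (prj i),
        forall i, homotopic (fun k => (prj i k \o inj i k)%VF) (cident (C_ i)),
        forall i j, i != j ->
          homotopic (fun k => (prj j k \o inj i k)%VF) (czero (C_ i) (C_ j))
      & homotopic (fun k => \sum_i (inj i k \o prj i k)%VF) (cident C)].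

Definition kindecomposable (C : cpx) : Prop :=
  ~ kzero C /\
  forall C_ : bool -> cpx, (forall b, in_Kbproj (C_ b)) -> is_kdsum C C_ ->
    exists b, kzero (C_ b).

Section Shift.
Variables (C : cpx) (l : nat).

Definition shift_d (i j : int) : 'Hom(C (i + l%:Z), C (j + l%:Z)) :=
  (-1) ^+ l *: cd C (i + l%:Z) (j + l%:Z).

Fact shift_hom i j : is_hom (shift_d i j).
Proof. by move=> a x; rewrite !scale_lfunE cd_hom linearZ. Qed.

Fact shift_shape i j : j != i + 1 -> shift_d i j = 0.
Proof.
move=> ij; rewrite /shift_d cd_shape ?scaler0//.
by rewrite addrAC (inj_eq (addIr _)).
Qed.

Fact shift_dd i j k : (shift_d j k \o shift_d i j)%VF = 0.
Proof. by rewrite -comp_lfunZl -comp_lfunZr cd_cd !scaler0. Qed.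

Definition shift : cpx := Cpx shift_hom shift_shape shift_dd.
End Shift.

(* Hom(C, C[l]) = 0 for all l >= 1 *)
Definition presilting (C : cpx) : Prop :=
  forall l : nat, (1 <= l)%N -> forall f : forall i, 'Hom(C i, shift C l i),
    is_cmap f -> homotopic f (czero C (shift C l)).

Definition two_term (C : cpx) : Prop :=
  exists D : cpx, [/\ in_Kbproj D,
    forall i : int, i != -1 -> i != 0 -> rzero (D i) & kisom C D].

(* U is a basic 2-term presilting complex and U = \bigoplus_i U_ i is its
   decomposition into indecomposables in K^b(proj A). *)
Definition basic_2psilt (m : nat) (U : cpx) (U_ : 'I_m -> cpx) : Prop :=
  [/\ in_Kbproj U, two_term U & presilting U] /\
  [/\ forall i, in_Kbproj (U_ i) /\ kindecomposable (U_ i), is_kdsum U U_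
    & forall i j, kisom (U_ i) (U_ j) -> i = j].

Definition cohomology (C : cpx) (i : int) : rmod :=
  subquo (gensub [set x : C i | cd C i (i + 1) x = 0])
         (gensub [set cd C (i - 1) i y | y in [set: C (i - 1)]]).

Section NuCpx.
Variable C : cpx.

Fact nu_hom i j : is_hom (nu_map (cd C i j)).
Proof. exact/nu_map_hom/cd_hom. Qed.

Fact nu_shape i j : j != i + 1 -> nu_map (cd C i j) = 0.
Proof. by move=> ij; rewrite cd_shape// nu_map0. Qed.

Fact nu_dd i j k : (nu_map (cd C j k) \o nu_map (cd C i j))%VF = 0.
Proof. by rewrite -nu_map_comp ?cd_cd ?nu_map0//; exact: cd_hom. Qed.

Definition nu_cpx : cpx := @Cpx (fun i => nu (C i)) _ nu_hom nu_shape nu_dd.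
End NuCpx.

End Modules.

Arguments ract {K A} M a : rename.
Arguments cd {K A} C i j : rename.

(** * The Grothendieck group of mod A *)

Section SmallModules.
Variables (K : fieldType) (A : falgType K).

(* [rmod A] is too large a type for the quotient construction below, so the
   Grothendieck group is generated by the modules with underlying space K^d,
   every module being isomorphic to one of these. *)
Record smod := SMod {
  sdim : nat;
  sact : A -> 'End('rV[K]_sdim);
  sact_linear : linear sact;
  sact1 : sact 1 = \1%VF;
  sactM : forall a b, sact (a * b) = (sact b \o sact a)%VF }.

Definition rmod_of_smod (M : smod) : rmod A :=
  RMod (@sact_linear M) (@sact1 M) (@sactM M).

Variable M : rmod A.

Definition scoord : 'Hom(M, 'rV[K]_(\dim {: M})) := linfun (passmx.rVof (vbasis {: M})).
Definition svec : 'Hom('rV[K]_(\dim {: M}), M) := linfun (passmx.vecof (vbasis {: M})).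

Lemma scoordE x : scoord x = passmx.rVof (vbasis {: M}) x.
Proof. exact: linfunE (passmx.rVof_linear _) _. Qed.

Lemma svecE x : svec x = passmx.vecof (vbasis {: M}) x.
Proof. exact: linfunE (passmx.vecof_linear _) _. Qed.

Lemma scoordK x : svec (scoord x) = x.
Proof. by rewrite svecE scoordE passmx.rVofK// vbasisP. Qed.

Lemma svecK x : scoord (svec x) = x.
Proof. by rewrite svecE scoordE passmx.vecofK// vbasisP. Qed.

Definition smod_act a : 'End('rV[K]_(\dim {: M})) := (scoord \o (ract M a \o svec))%VF.

Fact smod_act_linear : linear smod_act.
Proof.
move=> k a b; apply/lfunP => x.
by rewrite !(add_lfunE, scale_lfunE, comp_lfunE) ract_linear !lfun_simp linearP.
Qed.

Fact smod_act1 : smod_act 1 = \1%VF.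
Proof. by apply/lfunP => x; rewrite !comp_lfunE ract1 !id_lfunE svecK. Qed.

Fact smod_actM a b : smod_act (a * b) = (smod_act b \o smod_act a)%VF.
Proof. by apply/lfunP => x; rewrite !comp_lfunE scoordK ractM comp_lfunE. Qed.

Definition smod_of : smod := SMod smod_act_linear smod_act1 smod_actM.

Lemma risom_smod_of : risom (rmod_of_smod smod_of) M.
Proof.
exists svec; split=> [a x|]; first by rewrite /= !comp_lfunE scoordK.
exists scoord; split=> [a x||]; first by rewrite /= !comp_lfunE scoordK.
- by apply/lfunP => x; rewrite comp_lfunE svecK id_lfunE.
- by apply/lfunP => x; rewrite comp_lfunE scoordK id_lfunE.
Qed.

End SmallModules.

Coercion rmod_of_smod : smod >-> rmod.

HB.instance Definition _ (K : fieldType) (A : falgType K) := gen_eqMixin (smod A).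
HB.instance Definition _ (K : fieldType) (A : falgType K) := gen_choiceMixin (smod A).

Section GrothendieckGroup.
Variables (K : fieldType) (A : falgType K).

Definition is_ses (L M N : rmod A) (f : 'Hom(L, M)) (g : 'Hom(M, N)) : Prop :=
  [/\ is_hom f, is_hom g, lker f = 0%VS, limg f = lker g & limg g = fullv].

Definition ses_additive (G : zmodType) (phi : smod A -> G) : Prop :=
  forall (L M N : smod A) (f : 'Hom(rmod_of_smod L, rmod_of_smod M))
    (g : 'Hom(rmod_of_smod M, rmod_of_smod N)),
    is_ses f g -> phi M = phi L + phi N.

(* Formal integral combinations of modules *)
Definition fsum := seq (int * smod A).
HB.instance Definition _ := Choice.on fsum.

Definition fsum_eval (G : zmodType) (phi : smod A -> G) (s : fsum) : G :=
  \sum_(p <- s) phi p.2 *~ p.1.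

(* By the universal property of K_0(mod A), two formal combinations have the
   same class if and only if no additive function separates them. *)
Definition K0_rel (s t : fsum) : bool :=
  `[< forall (G : zmodType) (phi : smod A -> G), ses_additive phi ->
      fsum_eval phi s = fsum_eval phi t >].

Fact K0_refl : reflexive K0_rel. Proof. by move=> s; apply/asboolP. Qed.

Fact K0_sym : symmetric K0_rel.
Proof. by move=> s t; apply/asboolP/asboolP => h G phi hphi; rewrite h. Qed.

Fact K0_trans : transitive K0_rel.
Proof.
move=> t s u /asboolP st /asboolP tu.
by apply/asboolP => G phi hphi; rewrite st ?tu.
Qed.

Canonical K0_equiv := EquivRel K0_rel K0_refl K0_sym K0_trans.

Definition K0mod := {eq_quot K0_equiv}.
HB.instance Definition _ : EqQuotient _ K0_rel K0mod := EqQuotient.on K0mod.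
HB.instance Definition _ := Choice.on K0mod.

Definition fsum_opp (s : fsum) : fsum := [seq (- p.1, p.2) | p <- s].

Lemma fsum_eval_cat (G : zmodType) (phi : smod A -> G) s t :
  fsum_eval phi (s ++ t) = fsum_eval phi s + fsum_eval phi t.
Proof. exact: big_cat. Qed.

Lemma fsum_eval_opp (G : zmodType) (phi : smod A -> G) s :
  fsum_eval phi (fsum_opp s) = - fsum_eval phi s.
Proof.
by rewrite /fsum_eval big_map -sumrN; apply: eq_bigr => p _; rewrite mulrNz.
Qed.

Lemma K0P (s t : fsum) : (\pi_K0mod s = \pi_K0mod t) <->
  forall (G : zmodType) (phi : smod A -> G), ses_additive phi ->
    fsum_eval phi s = fsum_eval phi t.
Proof. by split=> [/eqmodP/asboolP|h]; last exact/eqmodP/asboolP. Qed.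

Definition K0_zero : K0mod := \pi_K0mod [::].
Definition K0_add (x y : K0mod) : K0mod := \pi_K0mod (repr x ++ repr y).
Definition K0_opp (x : K0mod) : K0mod := \pi_K0mod (fsum_opp (repr x)).

Lemma eval_repr (G : zmodType) (phi : smod A -> G) s : ses_additive phi ->
  fsum_eval phi (repr (\pi_K0mod s)) = fsum_eval phi s.
Proof. by move=> hphi; apply: (K0P _ _).1 => //; rewrite reprK. Qed.

Fact K0_addA : associative K0_add.
Proof.
move=> x y z; apply/K0P => G phi hphi.
by rewrite !fsum_eval_cat !eval_repr// !fsum_eval_cat addrA.
Qed.

Fact K0_addC : commutative K0_add.
Proof. by move=> x y; apply/K0P => G phi hphi; rewrite !fsum_eval_cat addrC. Qed.

Fact K0_add0 : left_id K0_zero K0_add.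
Proof.
move=> x; rewrite -[RHS]reprK; apply/K0P => G phi hphi.
by rewrite fsum_eval_cat eval_repr// /fsum_eval big_nil add0r.
Qed.

Fact K0_addN : left_inverse K0_zero K0_opp K0_add.
Proof.
move=> x; apply/K0P => G phi hphi.
by rewrite fsum_eval_cat eval_repr// fsum_eval_opp addNr /fsum_eval big_nil.
Qed.

HB.instance Definition _ := GRing.isZmodule.Build K0mod K0_addA K0_addC K0_add0 K0_addN.

Definition K0_class (M : rmod A) : K0mod := \pi_K0mod [:: (1, smod_of M)].

End GrothendieckGroup.

(** * The Euler form and stability *)

(* For [P] a list of the indecomposable projectives, the classes [P j] form a
   basis of K_0(proj A)_R, and a row vector theta stands for the element
   \sum_j theta_j [P j]. *)
Section Stability.
Variables (R : realType) (K : fieldType) (A : falgType K).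
Variables (n : nat) (P : 'I_n -> rmod A).
Implicit Types (theta : 'rV[R]_n) (M : rmod A).

Definition euler theta M : R := \sum_j theta 0 j * (\dim (HomA (P j) M))%:R.

(* The induced pairing with K_0(mod A), see [euler_K0_class] *)
Definition euler_K0 theta (v : K0mod A) : R :=
  fsum_eval (fun M : smod A => euler theta M) (repr v).

Definition Tbar theta M : Prop :=
  forall N : submod M, ~ rzero (quom N) -> 0 <= euler theta (quom N).
Definition Tcat theta M : Prop :=
  forall N : submod M, ~ rzero (quom N) -> 0 < euler theta (quom N).
Definition Fbar theta M : Prop :=
  forall N : submod M, ~ rzero (subm N) -> euler theta (subm N) <= 0.
Definition Fcat theta M : Prop :=
  forall N : submod M, ~ rzero (subm N) -> euler theta (subm N) < 0.
Definition Wcat theta M : Prop := Tbar theta M /\ Fbar theta M.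

(* The sum of the submodules of M lying in C; for a torsion class C this is the
   largest such submodule. *)
Definition trace_sub (C : rmod A -> Prop) M : submod M :=
  gensub [set x | exists2 N : submod M, C (subm N) & x \in svs N].

Definition wmod theta M : rmod A :=
  subquo (trace_sub (Tbar theta) M) (trace_sub (Tcat theta) M).

End Stability.

Section EulerWellDefined.
Variables (K : fieldType) (A : falgType K).

Lemma dim_HomA_ses (P L M N : rmod A) (f : 'Hom(L, M)) (g : 'Hom(M, N)) :
  projective P -> is_ses f g ->
  \dim (HomA P M) = (\dim (HomA P L) + \dim (HomA P N))%N.
Proof.
move=> projP [hf hg kf fg sg].
have finj : injective f by apply/lker0P; rewrite kf.
have gf0 x : g (f x) = 0.
  by apply/eqP; rewrite -memv_ker -fg memv_img ?memvf.
rewrite -(limg_ker_dim (postcomp P g) (HomA P M)); congr addn.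
  rewrite -(@limg_dim_eq _ _ _ (postcomp P f) (HomA P L)); last first.
    apply/eqP; rewrite -subv0; apply/subvP => h; rewrite memv_cap memv_ker memv0.
    rewrite postcompE => /andP[_ /eqP fh0]; apply/eqP/lfunP => x.
    by apply: finj; rewrite zero_lfunE linear0 -comp_lfunE fh0 zero_lfunE.
  congr (\dim _); apply/vspaceP => h; rewrite memv_cap memv_ker postcompE.
  apply/andP/memv_imgP => [[/mem_HomA hh /eqP gh0]|[h' /mem_HomA hh' ->]].
    have hx x : f ((f^-1)%VF (h x)) = h x.
      by apply: limg_lfunVK; rewrite fg memv_ker -comp_lfunE gh0 zero_lfunE.
    exists (f^-1 \o h)%VF.
      apply/mem_HomA => a x; apply: finj.
      by rewrite !comp_lfunE hx hh hf hx.
    by apply/lfunP => x; rewrite postcompE !comp_lfunE hx.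
  rewrite postcompE; split.
    by apply/mem_HomA => a x; rewrite !comp_lfunE hh' hf.
  by apply/eqP/lfunP => x; rewrite !comp_lfunE gf0 zero_lfunE.
congr (\dim _); apply/vspaceP => h; apply/memv_imgP/idP => [[h' /mem_HomA hh' ->]|].
  by rewrite postcompE; apply/mem_HomA => a x; rewrite !comp_lfunE hh' hg.
move=> /mem_HomA hh; have [h' hh' <-] := projP _ _ _ _ hg sg hh.
by exists h'; [exact/mem_HomA | rewrite postcompE].
Qed.

Lemma dim_HomA_iso (P M N : rmod A) : risom M N ->
  \dim (HomA P M) = \dim (HomA P N).
Proof.
suff le (X Y : rmod A) (f : 'Hom(X, Y)) (g : 'Hom(Y, X)) :
    is_hom f -> (g \o f)%VF = \1%VF -> (\dim (HomA P X) <= \dim (HomA P Y))%N.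
  move=> [f [hf [g [hg gf fg]]]]; apply/eqP.
  by rewrite eqn_leq (le _ _ f g)// (le _ _ g f).
move=> hf gf; rewrite -(@limg_dim_eq _ _ _ (postcomp P f) (HomA P X)).
  apply/dimvS/subvP => _ /memv_imgP[h /mem_HomA hh ->].
  by rewrite postcompE; apply/mem_HomA => a x; rewrite !comp_lfunE hh hf.
apply/eqP; rewrite -subv0; apply/subvP => h; rewrite memv_cap memv_ker memv0.
rewrite postcompE => /andP[_ /eqP fh0]; apply/eqP.
by rewrite -(comp_lfun1l h) -gf -comp_lfunA fh0 comp_lfun0r.
Qed.

Variables (R : realType) (n : nat) (P : 'I_n -> rmod A).

Lemma euler_ses_additive (theta : 'rV[R]_n) : (forall j, projective (P j)) ->
  ses_additive (fun M : smod A => euler P theta M).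
Proof.
move=> projP L M N f g ses; rewrite /euler -big_split /=.
by apply: eq_bigr => j _; rewrite (dim_HomA_ses (projP j) ses) natrD mulrDr.
Qed.

Lemma euler_K0_class (theta : 'rV[R]_n) M : (forall j, projective (P j)) ->
  euler_K0 P theta (K0_class M) = euler P theta M.
Proof.
move=> projP; rewrite /euler_K0 eval_repr; last exact: euler_ses_additive.
rewrite /fsum_eval big_seq1 /= mulr1z; apply: eq_bigr => j _.
by rewrite (dim_HomA_iso (P j) (risom_smod_of M)).
Qed.

Lemma euler_K0D (theta : 'rV[R]_n) x y : (forall j, projective (P j)) ->
  euler_K0 P theta (x + y) = euler_K0 P theta x + euler_K0 P theta y.
Proof.
move=> projP; rewrite /euler_K0 eval_repr ?fsum_eval_cat//.
exact: euler_ses_additive.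
Qed.

End EulerWellDefined.

(* Simple objects of the full subcategory of mod A given by C: nonzero objects
   for which every monomorphism into them is zero or an isomorphism.
   Monomorphisms are those of C. *)
Definition simple_in (K : fieldType) (A : falgType K) (C : rmod A -> Prop)
    (L : rmod A) : Prop :=
  [/\ C L, ~ rzero L
    & forall (X : rmod A) (f : 'Hom(X, L)), C X -> is_hom f ->
        (forall (Z : rmod A) (g h : 'Hom(Z, X)), C Z -> is_hom g -> is_hom h ->
           (f \o g)%VF = (f \o h)%VF -> g = h) ->
        rzero X \/ is_iso f].

(** * Cones *)

Section Cones.
Variables (R : realType) (n : nat).
Implicit Types D F : set 'rV[R]_n.

Definition is_face D F : Prop :=
  exists2 l : 'Hom('rV[R]_n, R^o), (forall theta, D theta -> 0 <= l theta) &
    F = [set theta | D theta /\ l theta = 0].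

(* All sets considered are cones containing 0, so that the affine hull is the
   linear span. *)
Definition is_facet D F : Prop := is_face D F /\ (\dim (vspan F)).+1 = n.

Definition relint F : set 'rV[R]_n :=
  [set theta | F theta /\ \forall eta \near theta, eta \in vspan F -> F eta].

End Cones.

Definition is_inner_normal (R : realType) (K : fieldType) (A : falgType K)
    (n : nat) (P : 'I_n -> rmod A) (D F : set 'rV[R]_n) (v : K0mod A) : Prop :=
  [/\ exists theta : 'rV[R]_n, euler_K0 P theta v <> 0,
      forall theta, F theta -> euler_K0 P theta v = 0
    & forall theta, D theta -> 0 <= euler_K0 P theta v].

(** * The cone D(U) and the modules attached to its facets *)

Section ConeDU.
Variables (R : realType) (K : fieldType) (A : falgType K).
Variables (n : nat) (P : 'I_n -> rmod A).
Variables (m : nat) (U : cpx A) (U_ : 'I_m -> cpx A).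

Definition coneD : set 'rV[R]_n :=
  [set theta | Tbar P theta (cohomology U 0) /\
               Fbar P theta (cohomology (nu_cpx U) (-1))].

Definition Yplus (i : 'I_m) : rmod A :=
  quom (gensub [set y : cohomology (U_ i) 0 |
    exists2 f : 'Hom(cohomology U 0, cohomology (U_ i) 0),
      in_rad f & y \in limg f]).

Definition Xminus (i : 'I_m) : rmod A :=
  subm (gensub [set x : cohomology (nu_cpx (U_ i)) (-1) |
    forall f : 'Hom(cohomology (nu_cpx (U_ i)) (-1), cohomology (nu_cpx U) (-1)),
      in_rad f -> f x = 0]).

(* The sign + is [true] and the sign - is [false]. *)
Definition boundary (i : 'I_m) (e : bool) : set 'rV[R]_n :=
  if e then [set theta | coneD theta /\ ~ Tcat P theta (Yplus i)]
  else [set theta | coneD theta /\ ~ Fcat P theta (Xminus i)].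

(* The pair (i_F, epsilon_F), which exists and is unique for facets of D(U) *)
Definition facet_label (F : set 'rV[R]_n) : option ('I_m * bool) :=
  [pick p : 'I_m * bool | `[< F `<=` boundary p.1 p.2 >]].

Definition facet_sign (F : set 'rV[R]_n) : int :=
  if facet_label F is Some (_, false) then -1 else 1.

(* The module L_F, computed at theta; the last case does not occur for facets
   of D(U). *)
Definition facet_module (F : set 'rV[R]_n) (theta : 'rV[R]_n) : rmod A :=
  match facet_label F with
  | Some (i, true) => wmod P theta (Yplus i)
  | Some (i, false) => wmod P theta (Xminus i)
  | None => @subm K A (regular A) (gensub set0)
  end.

End ConeDU.

(* Main.v *)
Require Import Defs.
From mathcomp Require Import all_boot all_order all_algebra all_field.
From mathcomp Require Import all_classical all_reals all_analysis.
From mathcomp Require Import ring lra.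
Import numFieldNormedType.Exports.
Import Order.TTheory GRing.Theory Num.Theory.
Set Implicit Arguments.
Unset Strict Implicit.
Unset Printing Implicit Defensive.
Local Open Scope classical_set_scope.
Local Open Scope ring_scope.

(** Put M = H^0(U) and N = H^{-1}(nu U).  Replacing U by a 2-term complex
    P1 -> P0, one gets presentations P1 -> P0 -> M -> 0 and 0 -> N -> nu P1 -> nu P0.
    The duality between Hom(P, X) and Hom(X, nu P) for P projective ([psi]) shows
    that the class of U in K_0(proj A) has the value dim Hom(M, X) - dim Hom(X, N) on
    each module X, that homomorphisms from M lift along Y -> Y/L if Hom(L, N) = 0, and
    that homomorphisms to N extend from X to Y if Hom(M, Y/X) = 0.  The presilting
    condition gives Hom(M, N) = 0.  This is the content of [rigid_pair] and
    [presilting_pair].  Moreover each endomorphism f of H^0(U_i) is induced by a chain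
    map of U_i, so that f or 1 - f is invertible by Fitting's lemma for complexes
    ([indecomposable_endo]); the same holds for H^{-1}(nu U_i).

    It follows that a homomorphism M -> Y_i^+ is zero or surjective ([hom_M_Y]): it
    lifts to M -> H^0(U_i), and this lift is radical or a split epimorphism.  Dually a
    homomorphism X_i^- -> N is zero or injective ([hom_X_N]).

    The cone D(U) is cut out by the finitely many dimension vectors of factor modules
    of M and submodules of N, and the class of U satisfies all these inequalities
    strictly ([cone_polyhedral]).  So D(U) is a full dimensional polyhedral cone, and
    it is the intersection of the half-spaces of its facets ([hcone_facets]).  At a
    relative interior point theta of a facet F some Y_i^+ is not in T_theta or some
    X_i^- is not in F_theta ([facet_labelled]).  In the first case L_F is a nonzero
    factor module of M with theta(L_F) = 0.  The linear form of L_F is nonnegative on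
    D(U) and vanishes at a relative interior point of F, hence on all of F
    ([relint_vanish]); having a nonzero dimension vector, it defines the facet.

    For the simplicity of L = L_F let X be a nonzero subobject of L in W_theta.  Both L
    and L/X are factor modules of M whose linear forms vanish on the hyperplane spanned
    by F, so that the classes of L and L/X, and hence those of L and X, are
    proportional.  As dimension vectors are nonnegative, the class of X is a positive
    multiple of the one of L.  The class of U is positive on L, hence on X, and so there
    is a nonzero homomorphism M -> X.  It lifts to M -> Y_i^+, because the kernel of
    Y_i^+ -> L is in T_theta while N is in the torsion-free class of nonpositive
    values.  The lift is nonzero, hence surjective, and therefore X = L
    ([simple_plus]).  The case of a negative sign is dual ([simple_minus]). *)

(** * Homomorphisms, submodules and factor modules *)

Section Homs.
Variables (K : fieldType) (A : falgType K).
Implicit Types (L M N X Y Z : rmod A).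

Lemma hom_id M : is_hom (\1%VF : 'Hom(M, M)).
Proof. by move=> a x; rewrite !id_lfunE. Qed.

Lemma hom_comp L M N (f : 'Hom(M, N)) (g : 'Hom(L, M)) :
  is_hom f -> is_hom g -> is_hom (f \o g)%VF.
Proof. by move=> hf hg a x; rewrite !comp_lfunE hg hf. Qed.

Lemma hom_0 M N : is_hom (0 : 'Hom(M, N)).
Proof. by case: (is_hom_closed M N). Qed.

Lemma hom_add M N (f g : 'Hom(M, N)) : is_hom f -> is_hom g -> is_hom (f + g).
Proof. by move=> hf hg a x; rewrite !add_lfunE hf hg linearD. Qed.

Lemma hom_opp M N (f : 'Hom(M, N)) : is_hom f -> is_hom (- f).
Proof. by move=> hf a x; rewrite !opp_lfunE hf linearN. Qed.

Lemma hom_sub M N (f g : 'Hom(M, N)) : is_hom f -> is_hom g -> is_hom (f - g).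
Proof. by move=> hf hg; apply: hom_add => //; exact: hom_opp. Qed.

Lemma hom_sum M N (I : finType) (f : I -> 'Hom(M, N)) :
  (forall i, is_hom (f i)) -> is_hom (\sum_i f i).
Proof.
by move=> hf; elim/big_ind: _ => // [|g h]; [exact: hom_0 | exact: hom_add].
Qed.

Definition epi M N (f : 'Hom(M, N)) : Prop := is_hom f /\ limg f = fullv.
Definition mono M N (f : 'Hom(M, N)) : Prop := is_hom f /\ lker f = 0%VS.

Lemma epi_surj M N (f : 'Hom(M, N)) : epi f -> forall y, exists x, f x = y.
Proof.
move=> [_ sf] y; have : y \in limg f by rewrite sf memvf.
by move=> /memv_imgP[x _ ->]; exists x.
Qed.

Lemma epiI M N (f : 'Hom(M, N)) :
  is_hom f -> (forall y, exists x, f x = y) -> epi f.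
Proof.
move=> hf sf; split=> //; apply/vspaceP => y; rewrite memvf.
by have [x <-] := sf y; rewrite memv_img ?memvf.
Qed.

Lemma mono_inj M N (f : 'Hom(M, N)) : mono f -> injective f.
Proof. by move=> [_ kf]; apply/lker0P; rewrite kf. Qed.

Lemma monoI M N (f : 'Hom(M, N)) :
  is_hom f -> (forall x, f x = 0 -> x = 0) -> mono f.
Proof.
move=> hf kf; split=> //; apply/eqP; rewrite -subv0; apply/subvP => x.
by rewrite memv_ker memv0 => /eqP/kf->.
Qed.

Lemma mono_eq0 M N (f : 'Hom(M, N)) x : mono f -> f x = 0 -> x = 0.
Proof. by move=> mf f0; apply: (mono_inj mf); rewrite f0 linear0. Qed.

Lemma epi_comp L M N (f : 'Hom(M, N)) (g : 'Hom(L, M)) :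
  epi f -> epi g -> epi (f \o g)%VF.
Proof.
move=> ef eg; apply: epiI; first by apply: hom_comp; [case: ef | case: eg].
move=> z; have [y <-] := epi_surj ef z; have [x <-] := epi_surj eg y.
by exists x; rewrite comp_lfunE.
Qed.

Lemma mono_comp L M N (f : 'Hom(M, N)) (g : 'Hom(L, M)) :
  mono f -> mono g -> mono (f \o g)%VF.
Proof.
move=> mf mg; apply: monoI; first by apply: hom_comp; [case: mf | case: mg].
by move=> x; rewrite comp_lfunE => /(mono_eq0 mf)/(mono_eq0 mg).
Qed.

Lemma epi_id M : epi (\1%VF : 'Hom(M, M)).
Proof. by apply: epiI => [|y]; [exact: hom_id | exists y; rewrite id_lfunE]. Qed.

Lemma mono_id M : mono (\1%VF : 'Hom(M, M)).
Proof. by apply: monoI => [|y]; [exact: hom_id | rewrite id_lfunE]. Qed.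

Lemma epi_cancel L M N (f g : 'Hom(M, N)) (e : 'Hom(L, M)) :
  epi e -> (f \o e)%VF = (g \o e)%VF -> f = g.
Proof.
move=> ee fg; apply/lfunP => y; have [x <-] := epi_surj ee y.
by rewrite -!comp_lfunE fg.
Qed.

Lemma mono_cancel L M N (f g : 'Hom(L, M)) (j : 'Hom(M, N)) :
  mono j -> (j \o f)%VF = (j \o g)%VF -> f = g.
Proof.
move=> mj fg; apply/lfunP => x; apply: (mono_inj mj).
by rewrite -!comp_lfunE fg.
Qed.

Lemma factor_epi M X Z (q : 'Hom(M, X)) (f : 'Hom(M, Z)) :
  epi q -> is_hom f -> (forall x, q x = 0 -> f x = 0) ->
  exists2 g : 'Hom(X, Z), is_hom g & (g \o q)%VF = f.
Proof.
move=> eq_ hf kqf.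
have gq x : (f \o q^-1)%VF (q x) = f x.
  rewrite comp_lfunE; apply/eqP; rewrite -subr_eq0 -linearB; apply/eqP/kqf.
  by rewrite linearB /= limg_lfunVK ?subrr ?memv_img ?memvf.
exists (f \o q^-1)%VF; last by apply/lfunP => x; rewrite comp_lfunE gq.
move=> a y; have [x <-] := epi_surj eq_ y.
by case: (eq_) => hq _; rewrite -hq !gq hf.
Qed.

Lemma factor_mono X M Z (j : 'Hom(X, M)) (f : 'Hom(Z, M)) :
  mono j -> is_hom f -> (forall z, exists x, j x = f z) ->
  exists2 g : 'Hom(Z, X), is_hom g & (j \o g)%VF = f.
Proof.
move=> mj hf fj.
have jg z : j ((j^-1 \o f)%VF z) = f z.
  by rewrite comp_lfunE limg_lfunVK//; have [x <-] := fj z; rewrite memv_img ?memvf.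
exists (j^-1 \o f)%VF; last by apply/lfunP => z; rewrite comp_lfunE jg.
by move=> a z; apply: (mono_inj mj); case: (mj) => hj _; rewrite hj !jg hf.
Qed.

Lemma iso_mono_epi M N (f : 'Hom(M, N)) : is_iso f <-> mono f /\ epi f.
Proof.
split=> [[hf [g [hg gf fg]]]|[mf ef]].
  split; first apply: monoI => // x fx.
    by rewrite -(id_lfunE x) -gf comp_lfunE fx linear0.
  by apply: epiI => // y; exists (g y); rewrite -comp_lfunE fg id_lfunE.
have hf := mf.1; split=> //.
have [|g hg fg] := factor_mono mf (@hom_id N).
  by move=> z; have [x <-] := epi_surj ef z; exists x; rewrite id_lfunE.
exists g; split=> //; apply: (mono_cancel mf).
by rewrite comp_lfunA fg comp_lfun1l comp_lfun1r.
Qed.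

Lemma mono_dim M N (f : 'Hom(M, N)) : mono f -> \dim (limg f) = \dim {: M}.
Proof.
by case=> _ kf; have := limg_ker_dim f fullv; rewrite kf capv0 dimv0 add0n.
Qed.

Lemma mono_endo_iso M (f : 'Hom(M, M)) : mono f -> is_iso f.
Proof.
move=> mf; apply/iso_mono_epi; split=> //; split; first by case: mf.
by apply/eqP; rewrite eqEdim subvf (mono_dim mf) leqnn.
Qed.

Lemma rzeroP M : rzero M <-> forall x : M, x = 0.
Proof.
split=> [/eqP|M0].
  by rewrite /rzero dimv_eq0 => /eqP M0 x; apply/eqP; rewrite -memv0 -M0 memvf.
apply/eqP; rewrite dimv_eq0 -subv0; apply/subvP => x _.
by rewrite (M0 x) mem0v.
Qed.

Lemma rzero_epi M N (f : 'Hom(M, N)) : epi f -> rzero M -> rzero N.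
Proof.
move=> ef /rzeroP M0; apply/rzeroP => y; have [x <-] := epi_surj ef y.
by rewrite (M0 x) linear0.
Qed.

Lemma rzero_mono M N (f : 'Hom(M, N)) : mono f -> rzero N -> rzero M.
Proof. by move=> mf /rzeroP N0; apply/rzeroP => x; apply: (mono_eq0 mf). Qed.

Lemma hom_to0 M N (f : 'Hom(M, N)) : rzero N -> f = 0.
Proof. by move=> /rzeroP N0; apply/lfunP => x; rewrite (N0 (f x)) zero_lfunE. Qed.

Lemma hom_from0 M N (f : 'Hom(M, N)) : rzero M -> f = 0.
Proof.
by move=> /rzeroP M0; apply/lfunP => x; rewrite (M0 x) linear0 zero_lfunE.
Qed.

Lemma iso_sym M N (f : 'Hom(M, N)) : is_iso f ->
  exists g : 'Hom(N, M), [/\ is_iso g, (g \o f)%VF = \1%VF & (f \o g)%VF = \1%VF].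
Proof.
by move=> [hf [g [hg gf fg]]]; exists g; split=> //; split=> //; exists f.
Qed.

(** ** Kernels, images and cokernels *)

Fact ker_stable M N (f : 'Hom(M, N)) : is_hom f -> stable (lker f).
Proof. by move=> hf a x; rewrite !memv_ker hf => /eqP->; rewrite linear0. Qed.

Fact img_stable M N (f : 'Hom(M, N)) : is_hom f -> stable (limg f).
Proof.
by move=> hf a _ /memv_imgP[x _ ->]; rewrite -hf memv_img ?memvf.
Qed.

Fact preim_stable M N (f : 'Hom(M, N)) (W : submod N) :
  is_hom f -> stable (f @^-1: W)%VS.
Proof. by move=> hf a x; rewrite -!memv_preim hf; exact: svs_stable. Qed.

Lemma quo_epi M (W : submod M) : epi (quo_prj W : 'Hom(M, quom W)).
Proof. by split; [move=> a x; rewrite -quo_actE | exact: limg_quo_prj]. Qed.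

Lemma quo_eq0 M (W : submod M) x : (quo_prj W x = 0) <-> (x \in svs W).
Proof.
split=> [qx|/quo_ker//].
by have := memv_ker (quo_prj W) x; rewrite qx eqxx lker_quo_prj.
Qed.

Lemma sub_mono M (W : submod M) : mono (sub_inj W : 'Hom(subm W, M)).
Proof.
apply: monoI => [a x|x]; first exact: sub_actE.
by move=> e; apply: (@sub_inj_inj _ _ _ W); rewrite e linear0.
Qed.

Lemma sub_inj_in M (W : submod M) x : sub_inj W x \in svs W.
Proof. by rewrite sub_injE subvsP. Qed.

Lemma sub_lift M (W : submod M) x :
  x \in svs W -> exists y : subm W, sub_inj W y = x.
Proof. by move=> xW; exists (sub_ret W x); rewrite sub_retK. Qed.

Lemma ex_kernel M N (f : 'Hom(M, N)) : is_hom f ->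
  exists X (k : 'Hom(X, M)), mono k /\ forall x, f x = 0 <-> exists z, k z = x.
Proof.
move=> hf; pose W := SubMod (ker_stable hf).
exists (subm W), (sub_inj W); split=> [|x]; first exact: sub_mono.
split=> [fx|[z <-]]; first by apply: sub_lift; rewrite /= memv_ker fx.
by have := sub_inj_in z; rewrite /= memv_ker => /eqP.
Qed.

Lemma ex_image M N (f : 'Hom(M, N)) : is_hom f ->
  exists X (e : 'Hom(M, X)) (j : 'Hom(X, N)), [/\ epi e, mono j & (j \o e)%VF = f].
Proof.
move=> hf; pose W := SubMod (img_stable hf).
have [|e he je] := factor_mono (sub_mono W) hf.
  by move=> z; apply: sub_lift; rewrite /= memv_img ?memvf.
exists (subm W), e, (sub_inj W); split=> //; last exact: sub_mono.
apply: epiI => // y; have /= /memv_imgP[x _ yx] := sub_inj_in y.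
by exists x; apply: (mono_inj (sub_mono W)); rewrite yx -comp_lfunE je.
Qed.

Lemma ex_coker M N (f : 'Hom(M, N)) : is_hom f ->
  exists X (c : 'Hom(N, X)), epi c /\ forall y, c y = 0 <-> exists x, f x = y.
Proof.
move=> hf; pose W := SubMod (img_stable hf).
exists (quom W), (quo_prj W); split=> [|y]; first exact: quo_epi.
rewrite quo_eq0 /=; split=> [/memv_imgP[x _ ->]|[x <-]]; first by exists x.
by rewrite memv_img ?memvf.
Qed.

Lemma is_sesP L M N (f : 'Hom(L, M)) (g : 'Hom(M, N)) :
  mono f -> epi g -> (forall y, g y = 0 <-> exists x, f x = y) -> is_ses f g.
Proof.
move=> [hf kf] [hg sg] e; split=> //; apply/vspaceP => y; rewrite memv_ker.
apply/memv_imgP/eqP => [[x _ ->]|/e[x <-]]; first by apply/e; exists x.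
by exists x => //; exact: memvf.
Qed.

Lemma is_ses_epi M N (g : 'Hom(M, N)) : epi g ->
  exists L (f : 'Hom(L, M)), mono f /\ is_ses f g.
Proof.
move=> eg; have [L [f [mf e]]] := ex_kernel eg.1; exists L, f; split=> //.
exact: is_sesP.
Qed.

Lemma is_ses_mono L M (f : 'Hom(L, M)) : mono f ->
  exists N (g : 'Hom(M, N)), epi g /\ is_ses f g.
Proof.
move=> mf; have [N [g [eg e]]] := ex_coker mf.1; exists N, g; split=> //.
exact: is_sesP.
Qed.

Lemma ses_eq0 L M N (f : 'Hom(L, M)) (g : 'Hom(M, N)) y :
  is_ses f g -> g y = 0 <-> exists x, f x = y.
Proof.
move=> [_ _ _ fg _]; split=> [gy|[x <-]].
  have : y \in lker g by rewrite memv_ker gy.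
  by rewrite -fg => /memv_imgP[x _ ->]; exists x.
by apply/eqP; rewrite -memv_ker -fg memv_img ?memvf.
Qed.

End Homs.
(** * Polyhedral cones *)

Section ConvexGeometry.
Variables (R : realType) (n : nat).
Implicit Types (b c th v : 'rV[R]_n) (s : seq 'rV[R]_n) (D F : set 'rV[R]_n).

Definition dot c th : R := \sum_j th 0 j * c 0 j.

Lemma dotDr c x y : dot c (x + y) = dot c x + dot c y.
Proof. by rewrite -big_split; apply: eq_bigr => j _; rewrite mxE mulrDl. Qed.

Lemma dotZr c k x : dot c (k *: x) = k * dot c x.
Proof. by rewrite mulr_sumr; apply: eq_bigr => j _; rewrite mxE mulrA. Qed.

Lemma dotBr c x y : dot c (x - y) = dot c x - dot c y.
Proof. by rewrite -scaleN1r dotDr dotZr mulN1r. Qed.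

Lemma dotC c x : dot c x = dot x c.
Proof. by apply: eq_bigr => j _; rewrite mulrC. Qed.

Lemma dotDl c d x : dot (c + d) x = dot c x + dot d x.
Proof. by rewrite dotC dotDr !(dotC x). Qed.

Lemma dotZl k c x : dot (k *: c) x = k * dot c x.
Proof. by rewrite dotC dotZr dotC. Qed.

Lemma dotNl c x : dot (- c) x = - dot c x.
Proof. by rewrite -scaleN1r dotZl mulN1r. Qed.

Lemma dotBl c d x : dot (c - d) x = dot c x - dot d x.
Proof. by rewrite dotDl dotNl. Qed.

Lemma dot0r c : dot c 0 = 0.
Proof. by rewrite -(scale0r (0 : 'rV[R]_n)) dotZr mul0r. Qed.

Lemma dot0l x : dot 0 x = 0.
Proof. by rewrite dotC dot0r. Qed.

Lemma dot_eq0 c : dot c c = 0 -> c = 0.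
Proof.
move=> /psumr_eq0P c0; apply/rowP => j; rewrite mxE.
have /eqP : c 0 j * c 0 j = 0 by apply: c0 => // i _; rewrite -expr2 sqr_ge0.
by rewrite mulf_eq0 orbb => /eqP.
Qed.

Fact dot_linear c : linear (dot c : 'rV[R]_n -> R^o).
Proof. by move=> k x y; rewrite dotDr dotZr. Qed.

Definition dotf c : 'Hom('rV[R]_n, R^o) := linfun (dot c : 'rV[R]_n -> R^o).

Lemma dotfE c x : dotf c x = dot c x.
Proof. by rewrite /dotf linfunE//; exact: dot_linear. Qed.

Lemma form_dot (l : 'Hom('rV[R]_n, R^o)) : exists c, forall x, l x = dot c x.
Proof.
exists (\row_j l (delta_mx 0 j)) => x.
rewrite {1}[x]row_sum_delta linear_sum; apply: eq_bigr => j _ /=.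
by rewrite linearZ mxE.
Qed.

Lemma dim_rV : \dim {: 'rV[R]_n} = n.
Proof. by rewrite dimvf /dim /= mul1n. Qed.

Lemma dim_ker_dot c : c != 0 -> (\dim (lker (dotf c))).+1 = n.
Proof.
move=> c0; rewrite -[RHS]dim_rV -(limg_ker_dim (dotf c) fullv) capfv -addn1.
congr addn; apply/esym; apply/eqP; rewrite eqn_leq; apply/andP; split.
  by rewrite (leq_trans (dimvS (subvf _)))// dimvf.
rewrite lt0n dimv_eq0; apply: contra_neq c0 => l0; apply: dot_eq0.
have : dotf c c \in limg (dotf c) by rewrite memv_img ?memvf.
by rewrite l0 memv0 dotfE => /eqP.
Qed.

Lemma sub_ker_dot D c :
  (forall x, D x -> dot c x = 0) -> (vspan D <= lker (dotf c))%VS.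
Proof. by move=> Dc; apply: vspan_min => x /Dc cx; rewrite memv_ker dotfE cx. Qed.

(** The span of D is the hyperplane orthogonal to b, and the component of c
    orthogonal to b lies in it; since c vanishes there, this component is zero. *)
Lemma proportional D b c : (\dim (vspan D)).+1 = n ->
  (forall x, D x -> dot b x = 0) -> (forall x, D x -> dot c x = 0) -> b != 0 ->
  exists k, c = k *: b.
Proof.
move=> dD Db Dc b0.
have bb0 : dot b b != 0 by apply: contra_neq b0; exact: dot_eq0.
have kD : vspan D = lker (dotf b).
  apply/eqP; rewrite eqEdim sub_ker_dot//= -ltnS dim_ker_dot//.
  by rewrite dD.
pose k := dot c b / dot b b; exists k.
apply/eqP; rewrite -subr_eq0; apply/eqP; apply: dot_eq0.
set d := c - _; have db : dot d b = 0 by rewrite dotBl dotZl divfK ?subrr.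
suff : d \in vspan D.
  move=> /(subvP (sub_ker_dot Dc)); rewrite memv_ker dotfE => /eqP cd.
  by rewrite {1}/d dotBl dotZl cd (dotC b) db mulr0 subrr.
by rewrite kD memv_ker dotfE dotC db.
Qed.

Definition hcone s : set 'rV[R]_n :=
  [set th | forall c, c \in s -> 0 <= dot c th].

Definition strict s th : Prop := forall c, c \in s -> 0 < dot c th.

Lemma strict_perturb s th v : strict s th ->
  exists2 t : R, 0 < t & forall c, c \in s -> 0 < dot c (th + t *: v).
Proof.
elim: s => [|c s IH] st; first by exists 1.
have [|t t0 st1] := IH; first by move=> d ds; apply: st; rewrite inE ds orbT.
have c0 : 0 < dot c th by apply: st; rewrite inE eqxx.
have a0 : 0 < `|dot c v| + 1 by rewrite ltr_wpDl.
pose u := Num.min t (dot c th / (`|dot c v| + 1)); exists u.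
  by rewrite lt_min t0 divr_gt0.
have u0 : 0 < u by rewrite lt_min t0 divr_gt0.
move=> d; rewrite inE => /orP[/eqP->|ds]; rewrite dotDr dotZr.
  have : u * (`|dot c v| + 1) <= dot c th.
    by rewrite -ler_pdivlMr// ge_min lexx orbT.
  have : u * - `|dot c v| <= u * dot c v.
    by rewrite ler_pM2l// lerNl -normrN ler_norm.
  rewrite mulrDr mulr1 mulrN; move: u0; set p := u * _; set q := u * dot c v.
  by move=> *; rewrite -subr_gt0; lra.
have d0 : 0 < dot d th by apply: st; rewrite inE ds orbT.
have := st1 d ds; rewrite dotDr dotZr => dt.
have ut : u <= t by rewrite ge_min lexx.
have [dv|dv] := leP 0 (dot d v); first by rewrite ltr_wpDr// mulr_ge0// ltW.
by rewrite (lt_le_trans dt)// lerD2l ler_nM2r.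
Qed.

Lemma strict_hcone s th : strict s th -> hcone s th.
Proof. by move=> st c /st/ltW. Qed.

Lemma strict_span s p : strict s p -> vspan (hcone s) = fullv.
Proof.
move=> st; apply/eqP; rewrite eqEsubv subvf; apply/subvP => v _.
have [t t0 /strict_hcone sv] := strict_perturb v st.
have -> : v = t^-1 *: ((p + t *: v) - p).
  by rewrite addrC addKr scalerA mulVf ?scale1r// gt_eqF.
rewrite rpredZ// rpredB//; first by apply: vspan_sub; exact: sv.
by apply: vspan_sub; exact: strict_hcone.
Qed.

(** The face of a full dimensional cone cut out by one of its inequalities is a
    facet as soon as some point of it satisfies the others strictly: the points
    of the hyperplane near that one stay in the cone. *)
Lemma hyperplane_facet s c y : c != 0 -> dot c y = 0 ->
  (forall d, d \in s -> d != c -> 0 < dot d y) -> c \in s ->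
  is_facet (hcone s) [set th | hcone s th /\ dot c th = 0].
Proof.
move=> c0 cy dy cs; split.
  exists (dotf c) => [th|]; first by rewrite dotfE; exact.
  by apply/seteqP; split=> th /=; rewrite dotfE.
have st : strict [seq d <- s | d != c] y.
  by move=> d; rewrite mem_filter => /andP[dc ds]; exact: dy.
set F := [set th | _].
suff -> : vspan F = lker (dotf c) by exact: dim_ker_dot.
apply/eqP; rewrite eqEsubv sub_ker_dot/=; last by move=> x [].
have inF z : dot c z = 0 -> strict [seq d <- s | d != c] z -> F z.
  move=> cz sz; split=> // d ds; have [->|dc] := eqVneq d c; first by rewrite cz.
  by apply/ltW/sz; rewrite mem_filter dc.
apply/subvP => v; rewrite memv_ker dotfE => /eqP cv.
have [t t0 sv] := strict_perturb v st.
have -> : v = t^-1 *: ((y + t *: v) - y).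
  by rewrite addrC addKr scalerA mulVf ?scale1r// gt_eqF.
rewrite rpredZ// rpredB//; apply: vspan_sub; apply: inF => //.
by rewrite dotDr dotZr cy cv mulr0 addr0.
Qed.

(** A shortest list of inequalities has no redundant member. *)
Lemma ex_irredundant s : exists s', [/\ {subset s' <= s}, hcone s' = hcone s
  & forall c, c \in s' -> exists2 x, dot c x < 0 &
      forall d, d \in s' -> d != c -> 0 <= dot d x].
Proof.
pose good k := `[< exists s', [/\ size s' = k, {subset s' <= s} & hcone s' = hcone s] >].
have ex : exists k, good k by exists (size s); apply/asboolP; exists s; split.
case: (ex_minnP ex) => k /asboolP[s' [sk ss' hs']] kmin.
exists s'; split=> [//|//|c cs'].
pose s1 := [seq d <- s' | d != c].
have ltk : (size s1 < k)%N.
  rewrite -sk size_filter -(count_predC (predC1 c) s') -addn1 leq_add2l -has_count.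
  by apply/hasP; exists c => //=; rewrite negbK.
have ne : hcone s1 <> hcone s.
  move=> e; suff : (k <= size s1)%N by rewrite leqNgt ltk.
  apply: kmin; apply/asboolP; exists s1; split=> // d.
  by rewrite mem_filter => /andP[_ /ss'].
apply: contrapT => no; apply: ne; rewrite -hs'; apply/seteqP; split=> th h d; last first.
  by rewrite mem_filter => /andP[_ ds']; exact: h.
move=> ds'; have [->|dc] := eqVneq d c; last by apply: h; rewrite mem_filter dc.
rewrite leNgt; apply/negP => cth; apply: no; exists th => // e es' ec.
by apply: h; rewrite mem_filter ec.
Qed.

Lemma facet_proper s p F (l : 'Hom('rV[R]_n, R^o)) : strict s p ->
  (\dim (vspan F)).+1 = n -> F = [set th | hcone s th /\ l th = 0] -> l <> 0.
Proof.
move=> st dF eF l0; have : F = hcone s.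
  rewrite eF; apply/seteqP; split=> [th []|th hth] //=; split=> //.
  by rewrite l0 zero_lfunE.
move=> eFs; move: dF; rewrite eFs (strict_span st) dim_rV => /eqP.
by rewrite eqn_leq ltnn.
Qed.

Lemma facet_not_strict s F th : is_facet (hcone s) F -> F th -> ~ strict s th.
Proof.
move=> [[l Dl eF] dF] Fth st; apply: (facet_proper st dF eF).
have lth : l th = 0 by move: Fth; rewrite eF => -[].
have ge0 v : 0 <= l v.
  have [t t0 /strict_hcone/Dl] := strict_perturb v st.
  by rewrite linearD linearZ /= lth add0r pmulr_rge0.
apply/lfunP => v; apply/eqP; rewrite zero_lfunE eq_le ge0 andbT.
by rewrite -oppr_ge0 -linearN ge0.
Qed.

(** A nonzero linear form that vanishes on a facet F is a multiple of the one
    defining F, so that it cuts out F as well. *)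
Lemma facet_eq s p F b : strict s p -> is_facet (hcone s) F -> b != 0 ->
  (forall th, F th -> dot b th = 0) -> F = [set th | hcone s th /\ dot b th = 0].
Proof.
move=> st [[l _ eF] dF] b0 Fb; have l0 := facet_proper st dF eF.
have [c lc] := form_dot l.
have c0 : c != 0.
  by apply/eqP => c0; apply: l0; apply/lfunP => x; rewrite lc c0 dot0l zero_lfunE.
have Fc x : F x -> dot c x = 0 by rewrite eF => -[_]; rewrite lc.
have [k bk] := proportional dF Fc Fb c0.
have k0 : k != 0 by apply: contra_neq b0 => k0; rewrite bk k0 scale0r.
rewrite eF; apply/seteqP; split=> th [Dth e]; split=> //.
  by rewrite bk dotZl -lc e mulr0.
by move/eqP: e; rewrite bk dotZl mulf_eq0 (negbTE k0) -lc => /eqP.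
Qed.

(** The members of an irredundant list of inequalities define facets, as is seen at
    the point where the segment from an interior point to a point violating just one
    inequality leaves the cone. *)
Lemma hcone_facets s p (b : set 'rV[R]_n -> 'rV[R]_n) : strict s p ->
  (forall F, is_facet (hcone s) F -> [/\ b F != 0,
     forall th, F th -> dot (b F) th = 0 &
     forall th, hcone s th -> 0 <= dot (b F) th]) ->
  forall th, (forall F, is_facet (hcone s) F -> 0 <= dot (b F) th) -> hcone s th.
Proof.
move=> st hb th hth.
have [s' [ss' hs' irr]] := ex_irredundant s; rewrite -hs' => c cs'.
have [x cx dx] := irr c cs'.
have st' d : d \in s' -> 0 < dot d p by move=> /ss'; exact: st.
have cp := st' c cs'.
have c0 : c != 0 by apply/eqP => c0; move: cp; rewrite c0 dot0l ltxx.
have cpx : 0 < dot c p - dot c x by rewrite subr_gt0 (lt_trans cx).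
pose t := dot c p / (dot c p - dot c x).
have t0 : 0 < t by rewrite divr_gt0.
have t1 : 0 < 1 - t.
  by rewrite subr_gt0 ltr_pdivrMr// mul1r ltrDl oppr_gt0.
pose y := (1 - t) *: p + t *: x.
have cy : dot c y = 0.
  have e : t * (dot c p - dot c x) = dot c p by rewrite divfK ?gt_eqF.
  have -> : dot c y = dot c p - t * (dot c p - dot c x).
    by rewrite dotDr !dotZr; ring.
  by rewrite e subrr.
have dy d : d \in s' -> d != c -> 0 < dot d y.
  move=> ds' dc; rewrite dotDr !dotZr ltr_wpDr ?mulr_gt0 ?st'//.
  by rewrite mulr_ge0 ?dx// ltW.
have fF := hyperplane_facet c0 cy dy cs'; rewrite hs' in fF.
set F := [set _ | _] in fF; have [b0 Fb Db] := hb F fF.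
have Fc z : F z -> dot c z = 0 by case.
have [k bk] := proportional fF.2 Fc Fb c0.
have k0 : 0 <= k.
  by have := Db p (strict_hcone st); rewrite bk dotZl pmulr_lge0.
have := hth F fF; rewrite bk dotZl pmulr_rge0// lt_neqAle k0 andbT eq_sym.
by apply: contra_neq b0 => k00; rewrite bk k00 scale0r.
Qed.

(** Otherwise the form would change sign along a segment through the relative
    interior point. *)
Lemma relint_vanish F th b : relint F th ->
  (forall x, F x -> 0 <= dot b x) -> dot b th = 0 ->
  forall x, F x -> dot b x = 0.
Proof.
move=> [Fth nF] bF bth x Fx; apply/eqP; rewrite eq_le bF// andbT.
pose g (t : R) : 'rV[R]_n := th + t *: (th - x).
have gc : g t @[t --> (0 : R)] --> th.
  rewrite -[X in _ --> X]addr0 -(scale0r (th - x)).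
  by apply: cvgD; [exact: cvg_cst | apply: cvgZr_tmp; exact: cvg_id].
have : \forall t \near (0 : R), g t \in vspan F -> F (g t) by exact: gc nF.
move=> /nbhs_ballP[e /= e0 he].
have Fg : F (g (e / 2)).
  apply: he; rewrite /ball /= ?sub0r ?normrN.
    by rewrite gtr0_norm ?divr_gt0// ltr_pdivrMr// ltr_pMr// ltr1n.
  by rewrite rpredD ?rpredZ ?rpredB//; apply: vspan_sub.
have := bF _ Fg; rewrite dotDr dotZr dotBr bth add0r sub0r mulrN oppr_ge0.
by rewrite pmulr_rle0// divr_gt0.
Qed.

End ConvexGeometry.
(** * The Euler form and the torsion pairs of a linear form *)

Section Subquotients.
Variables (K : fieldType) (A : falgType K).
Implicit Types (L M N X Y Z : rmod A).

Lemma subquo_prj M (B C : submod M) :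
  exists p : 'Hom(subm B, subquo B C), epi p /\
    forall x, p x = 0 <-> sub_inj B x \in svs C.
Proof.
exists (quo_prj _); split=> [|x]; first exact: quo_epi.
rewrite quo_eq0 mem_gensub /=; first by rewrite sub_injE.
  by split=> /= [|k y z yC zC]; rewrite ?mem0v// rpredD ?rpredZ.
by move=> a y /=; rewrite -!sub_injE sub_actE => yC; exact: svs_stable.
Qed.

Lemma epi_quo M X (q : 'Hom(M, X)) : epi q ->
  exists W : submod M, risom (quom W) X.
Proof.
move=> eq_; pose W := SubMod (ker_stable eq_.1); exists W.
have kW x : quo_prj W x = 0 <-> q x = 0.
  by rewrite quo_eq0 /= memv_ker; split=> /eqP.
have [|f hf fq] := factor_epi (quo_epi W) eq_.1; first by move=> x /kW.
exists f; apply/iso_mono_epi; split.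
  apply: monoI => // y; have [x <-] := epi_surj (quo_epi W) y.
  by rewrite -comp_lfunE fq => /kW.
apply: epiI => // y; have [x <-] := epi_surj eq_ y.
by exists (quo_prj W x); rewrite -comp_lfunE fq.
Qed.

Lemma mono_sub M X (j : 'Hom(X, M)) : mono j ->
  exists W : submod M, risom (subm W) X /\
    forall y, y \in svs W <-> exists x, j x = y.
Proof.
move=> mj; pose W := SubMod (img_stable mj.1); exists W.
have memW y : y \in svs W <-> exists x, j x = y.
  split=> [/memv_imgP[x _ ->]|[x <-]]; first by exists x.
  by rewrite memv_img ?memvf.
split=> //; have [|f hf jf] := factor_mono mj (sub_mono W).1.
  by move=> z; apply/memW; exact: sub_inj_in.
exists f; apply/iso_mono_epi; split.
  apply: monoI => // x fx; apply: (mono_eq0 (sub_mono W)).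
  by rewrite -jf comp_lfunE fx linear0.
apply: epiI => // x; have /sub_lift[y yx] : j x \in svs W by apply/memW; exists x.
by exists y; apply: (mono_inj mj); rewrite -yx -comp_lfunE jf.
Qed.

Lemma rzero_iso M N : risom M N -> rzero M <-> rzero N.
Proof.
by move=> [f /iso_mono_epi[mf ef]]; split; [exact: rzero_epi ef | exact: rzero_mono mf].
Qed.

End Subquotients.

Section Stability.
Variables (R : realType) (K : fieldType) (A : falgType K).
Variables (n : nat) (P : 'I_n -> rmod A).
Hypothesis projP : forall j, projective (P j).
Implicit Types (th : 'rV[R]_n) (L M N X Y Z : rmod A).

Definition dimv M : 'rV[R]_n := \row_j (\dim (HomA (P j) M))%:R.

Lemma euler_dot th M : euler P th M = dot (dimv M) th.
Proof. by apply: eq_bigr => j _; rewrite mxE. Qed.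

Lemma dimv_ses L M N (f : 'Hom(L, M)) (g : 'Hom(M, N)) :
  is_ses f g -> dimv M = dimv L + dimv N.
Proof.
by move=> s; apply/rowP => j; rewrite !mxE (dim_HomA_ses (@projP j) s) natrD.
Qed.

Lemma euler_ses th L M N (f : 'Hom(L, M)) (g : 'Hom(M, N)) :
  is_ses f g -> euler P th M = euler P th L + euler P th N.
Proof. by move=> s; rewrite !euler_dot (dimv_ses s) dotDl. Qed.

Lemma euler_iso th M N : risom M N -> euler P th M = euler P th N.
Proof. by move=> i; apply: eq_bigr => j _; rewrite (dim_HomA_iso (P j) i). Qed.

Lemma dim_HomA_eq0 X M : \dim (HomA X M) = 0%N <->
  forall f : 'Hom(X, M), is_hom f -> f = 0.
Proof.
split=> [/eqP|f0].
  rewrite dimv_eq0 => /eqP H0 f /mem_HomA; rewrite H0 memv0 => /eqP //.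
apply/eqP; rewrite dimv_eq0 -subv0; apply/subvP => f /mem_HomA/f0->.
exact: mem0v.
Qed.

Lemma dimv_rzero M : rzero M -> dimv M = 0.
Proof.
move=> M0; apply/rowP => j; rewrite !mxE.
by rewrite (dim_HomA_eq0 _ _).2// => f _; exact: hom_to0.
Qed.

Lemma euler_rzero th M : rzero M -> euler P th M = 0.
Proof. by move=> M0; rewrite euler_dot dimv_rzero ?dot0l. Qed.

Lemma Tbar_epi th M : Tbar P th M <->
  forall X (q : 'Hom(M, X)), epi q -> 0 <= euler P th X.
Proof.
split=> [T X q /epi_quo[W i]|T W _]; last exact: (T _ _ (quo_epi W)).
rewrite -(euler_iso th i); have [z|/T//] := pselect (rzero (quom W)).
by rewrite euler_rzero.
Qed.

Lemma Fbar_mono th M : Fbar P th M <->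
  forall X (j : 'Hom(X, M)), mono j -> euler P th X <= 0.
Proof.
split=> [T X q /mono_sub[W [i _]]|T W _]; last exact: (T _ _ (sub_mono W)).
rewrite -(euler_iso th i); have [z|/T//] := pselect (rzero (subm W)).
by rewrite euler_rzero.
Qed.

Lemma Tcat_epi th M : Tcat P th M <->
  forall X (q : 'Hom(M, X)), epi q -> ~ rzero X -> 0 < euler P th X.
Proof.
split=> [T X q /epi_quo[W i] nX|T W]; last exact: (T _ _ (quo_epi W)).
by rewrite -(euler_iso th i); apply: T => /(rzero_iso i).
Qed.

Lemma Fcat_mono th M : Fcat P th M <->
  forall X (j : 'Hom(X, M)), mono j -> ~ rzero X -> euler P th X < 0.
Proof.
split=> [T X q /mono_sub[W [i _]] nX|T W]; last exact: (T _ _ (sub_mono W)).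
by rewrite -(euler_iso th i); apply: T => /(rzero_iso i).
Qed.

Lemma Tbar_quo th M X (q : 'Hom(M, X)) : epi q -> Tbar P th M -> Tbar P th X.
Proof.
move=> eq_ /Tbar_epi T; apply/Tbar_epi => Y f ef.
exact: T _ _ (epi_comp ef eq_).
Qed.

Lemma Fbar_sub th M X (j : 'Hom(X, M)) : mono j -> Fbar P th M -> Fbar P th X.
Proof.
move=> mj /Fbar_mono T; apply/Fbar_mono => Y f mf.
exact: T _ _ (mono_comp mj mf).
Qed.

Lemma Tbar_ge0 th M : Tbar P th M -> 0 <= euler P th M.
Proof. by move=> /Tbar_epi T; exact: T _ _ (@epi_id _ _ M). Qed.

Lemma Fbar_le0 th M : Fbar P th M -> euler P th M <= 0.
Proof. by move=> /Fbar_mono T; exact: T _ _ (@mono_id _ _ M). Qed.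

Lemma hom_Tcat_Fbar th M N (f : 'Hom(M, N)) :
  is_hom f -> Tcat P th M -> Fbar P th N -> f = 0.
Proof.
move=> hf /Tcat_epi T /Fbar_mono F.
have [X [e [j [ee mj <-]]]] := ex_image hf.
have [X0|X0] := pselect (rzero X); first by rewrite (hom_to0 e X0) comp_lfun0r.
by have := lt_le_trans (T _ _ ee X0) (F _ _ mj); rewrite ltxx.
Qed.

Lemma hom_Tbar_Fcat th M N (f : 'Hom(M, N)) :
  is_hom f -> Tbar P th M -> Fcat P th N -> f = 0.
Proof.
move=> hf /Tbar_epi T /Fcat_mono F.
have [X [e [j [ee mj <-]]]] := ex_image hf.
have [X0|X0] := pselect (rzero X); first by rewrite (hom_to0 e X0) comp_lfun0r.
by have := le_lt_trans (T _ _ ee) (F _ _ mj X0); rewrite ltxx.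
Qed.

Lemma ex_min_submod M (Q : submod M -> Prop) : (exists W, Q W) ->
  exists2 W, Q W & forall W', Q W' -> (\dim W <= \dim W')%N.
Proof.
move=> [W0 QW0]; pose good k := `[< exists W, \dim (svs W) = k /\ Q W >].
have ex : exists k, good k by exists (\dim W0); apply/asboolP; exists W0.
case: (ex_minnP ex) => k /asboolP[W [dW QW]] kmin; exists W => // W' QW'.
by rewrite dW; apply: kmin; apply/asboolP; exists W'.
Qed.

Lemma ex_max_submod M (Q : submod M -> Prop) : (exists W, Q W) ->
  exists2 W, Q W & forall W', Q W' -> (\dim W' <= \dim W)%N.
Proof.
move=> [W0 QW0]; pose good k := `[< exists W, \dim (svs W) = k /\ Q W >].
have ex : exists k, good k by exists (\dim W0); apply/asboolP; exists W0.
have ub k : good k -> (k <= \dim {: M})%N.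
  by move=> /asboolP[W [<- _]]; rewrite dimvS ?subvf.
case: (ex_maxnP ex ub) => k /asboolP[W [dW QW]] kmax; exists W => // W' QW'.
by rewrite dW; apply: kmax; apply/asboolP; exists W'.
Qed.

Lemma sub_ses M (W : submod M) :
  is_ses (sub_inj W : 'Hom(subm W, M)) (quo_prj W : 'Hom(M, quom W)).
Proof.
apply: is_sesP; [exact: sub_mono | exact: quo_epi|] => y.
rewrite quo_eq0; split=> [/sub_lift//|[x <-]]; exact: sub_inj_in.
Qed.

(** For Y with all factor modules of nonnegative value, the largest submodule in
    the strict torsion class is the smallest submodule having the same value as
    Y; this makes the value of [wmod] zero. *)
Lemma wmod_Tbar th Y : Tbar P th Y -> ~ Tcat P th Y ->
  exists Z (k : 'Hom(Z, Y)) (q : 'Hom(Y, wmod P th Y)),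
    [/\ epi q, is_ses k q, Tcat P th Z, euler P th (wmod P th Y) = 0
      & ~ rzero (wmod P th Y)].
Proof.
move=> TY nTY; have TYe := (Tbar_epi th Y).1 TY.
have [|Z eZ minZ] := @ex_min_submod Y
    (fun W => euler P th (subm W) = euler P th Y).
  have [W [i _]] := mono_sub (@mono_id _ _ Y); exists W.
  exact: euler_iso.
have TZ : Tcat P th (subm Z).
  apply/Tcat_epi => X q eqq nX; have [L [f [mf s]]] := is_ses_epi eqq.
  have mL := mono_comp (sub_mono Z) mf.
  have [W [iW memW]] := mono_sub mL.
  have eX : euler P th X = euler P th Y - euler P th (subm W).
    by rewrite -eZ (euler_ses th s) (euler_iso th iW) addrC addKr.
  have : 0 <= euler P th X.
    by rewrite eX (euler_ses th (sub_ses W)) addrC addKr (TYe _ _ (quo_epi W)).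
  rewrite le_eqVlt => /orP[/eqP X0|//]; case: nX.
  have eW : euler P th (subm W) = euler P th Y.
    by apply/eqP; rewrite eq_sym -subr_eq0 -eX -X0.
  have WZ : (W <= Z)%VS.
    by apply/subvP => y /memW[x <-]; rewrite comp_lfunE sub_inj_in.
  have /eqP WeZ : svs W == svs Z by rewrite eqEdim WZ minZ.
  apply/rzeroP => x; have [z <-] := epi_surj eqq x.
  have : sub_inj Z z \in svs W by rewrite WeZ sub_inj_in.
  move=> /memW[l]; rewrite comp_lfunE => /(mono_inj (sub_mono Z)) <-.
  by apply/(ses_eq0 _ s); exists l.
have YZ0 : euler P th (quom Z) = 0.
  by have := euler_ses th (sub_ses Z); rewrite eZ -[LHS]addr0 => /addrI.
have sT (W : submod Y) : Tcat P th (subm W) -> (W <= Z)%VS.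
  move=> TW; have [X [e [j [ee mj je]]]] :=
    ex_image (hom_comp (quo_epi Z).1 (sub_mono W).1).
  have X0 : rzero X.
    apply: contrapT => nX; have := (Tcat_epi th _).1 TW _ _ ee nX.
    have [C [c [ec s]]] := is_ses_mono mj.
    have := TYe _ _ (epi_comp ec (quo_epi Z)).
    by move: (euler_ses th s); rewrite YZ0; lra.
  apply/subvP => y /sub_lift[w <-]; apply/quo_eq0.
  by rewrite -comp_lfunE -je (hom_to0 e X0) comp_lfun0r zero_lfunE.
set B := trace_sub (Tbar P th) Y; set C := trace_sub (Tcat P th) Y.
have memC y : y \in svs C <-> y \in svs Z.
  split=> [|yZ]; last by apply: gensub_sub; exists Z.
  by apply/subvP/gensub_min => x [W /sT/subvP h /h].
have memB y : y \in svs B.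
  have [W [[i ii] memW]] := mono_sub (@mono_id _ _ Y).
  apply: gensub_sub; exists W; last by apply/memW; exists y; rewrite id_lfunE.
  have [j [ij _ _]] := iso_sym ii.
  by apply: (Tbar_quo _ TY); case/iso_mono_epi: ij => _; exact.
have [p [ep kp]] := subquo_prj B C.
have [|g hg jg] := factor_mono (sub_mono B) (@hom_id _ _ Y).
  by move=> y; rewrite id_lfunE; apply: sub_lift.
have eg : epi g.
  apply: epiI => // b; exists (sub_inj B b); apply: (mono_inj (sub_mono B)).
  by rewrite -comp_lfunE jg id_lfunE.
have epg := epi_comp ep eg.
have s : is_ses (sub_inj Z : 'Hom(subm Z, Y)) (p \o g)%VF.
  apply: is_sesP => //; first exact: sub_mono.
  move=> y; rewrite comp_lfunE kp -(comp_lfunE (sub_inj B)) jg id_lfunE memC.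
  by split=> [/sub_lift//|[x <-]]; exact: sub_inj_in.
exists (subm Z), (sub_inj Z), (p \o g)%VF; split=> //.
  by have := euler_ses th s; rewrite eZ -[LHS]addr0 => /addrI/esym.
move=> w0; apply: nTY; have ZY : epi (sub_inj Z : 'Hom(subm Z, Y)).
  apply: epiI => [|y]; first exact: (sub_mono Z).1.
  by apply/(ses_eq0 _ s); rewrite (hom_to0 (p \o g)%VF w0) zero_lfunE.
by apply/Tcat_epi => X q eqq; apply: ((Tcat_epi th _).1 TZ); exact: epi_comp eqq ZY.
Qed.

(** Dually, for X with all submodules of nonpositive value, [wmod] is the
    largest submodule of X of value zero. *)
Lemma wmod_Fbar th X : Fbar P th X -> ~ Fcat P th X ->
  exists (C : rmod A) (z : 'Hom(wmod P th X, X)) (c : 'Hom(X, C)),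
    [/\ mono z, is_ses z c, Fcat P th C, euler P th (wmod P th X) = 0
      & ~ rzero (wmod P th X)].
Proof.
move=> FX nFX; have FXm := (Fbar_mono th X).1 FX.
have [|Z eZ maxZ] := @ex_max_submod X (fun W => euler P th (subm W) = 0).
  exists (gensub set0); apply: euler_rzero; apply/rzeroP => x.
  apply: (mono_eq0 (sub_mono _)); apply/eqP; rewrite -memv0.
  have g0 : (gensub (set0 : set X) <= 0)%VS.
    by apply: vspan_min => y [a [v []]].
  exact: (subvP g0) _ (sub_inj_in x).
(* the preimage in X of a submodule of X / Z of nonnegative value has value zero
   and contains Z, so it is Z by maximality *)
have maxZ' Y (q : 'Hom(X, Y)) (I : rmod A) (j : 'Hom(I, Y)) : epi q ->
    (forall x, q x = 0 <-> x \in svs Z) -> mono j -> 0 <= euler P th I -> rzero I.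
  move=> eqq kq mj I0; pose J := SubMod (img_stable mj.1).
  pose W := SubMod (@preim_stable _ _ _ _ _ J eqq.1).
  have memW x : x \in svs W <-> exists y, j y = q x.
    rewrite /= -memv_preim; split=> [/memv_imgP[y _ ->]|[y <-]]; first by exists y.
    by rewrite memv_img ?memvf.
  have ZW : (Z <= W)%VS.
    by apply/subvP => x /kq qx; apply/memW; exists 0; rewrite qx linear0.
  have [|f hf jf] := factor_mono mj (hom_comp eqq.1 (sub_mono W).1).
    by move=> w; have /memW[y e] := sub_inj_in w; exists y; rewrite comp_lfunE.
  have ef : epi f.
    apply: epiI => // y; have [x qx] := epi_surj eqq (j y).
    have /sub_lift[w wx] : x \in svs W by apply/memW; exists y.
    by exists w; apply: (mono_inj mj); rewrite -comp_lfunE jf comp_lfunE wx.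
  have [|g hg wg] := factor_mono (sub_mono W) (sub_mono Z).1.
    by move=> z; apply/sub_lift/(subvP ZW)/sub_inj_in.
  have s : is_ses g f.
    apply: is_sesP => //.
      apply: monoI => // z gz; apply: (mono_eq0 (sub_mono Z)).
      by rewrite -wg comp_lfunE gz linear0.
    move=> w; split=> [fw|[z <-]].
      have /sub_lift[z zw] : sub_inj W w \in svs Z.
        by apply/kq; rewrite -comp_lfunE -jf comp_lfunE fw linear0.
      by exists z; apply: (mono_inj (sub_mono W)); rewrite -comp_lfunE wg.
    apply: (mono_eq0 mj); rewrite -comp_lfunE jf comp_lfunE -(comp_lfunE _ g) wg.
    by apply/kq/sub_inj_in.
  have W0 : euler P th (subm W) = 0.
    apply/eqP; rewrite eq_le (FXm _ _ (sub_mono W)).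
    by rewrite (euler_ses th s) eZ add0r.
  have /eqP ZeW : svs Z == svs W by rewrite eqEdim ZW maxZ.
  apply/rzeroP => y; have [w <-] := epi_surj ef y.
  apply: (mono_eq0 mj); rewrite -comp_lfunE jf comp_lfunE; apply/kq.
  by rewrite ZeW sub_inj_in.
have kZ x : quo_prj Z x = 0 <-> x \in svs Z by exact: quo_eq0.
have TZ : Tbar P th (subm Z).
  apply/Tbar_epi => Y q eqq; have [L [f [mf s]]] := is_ses_epi eqq.
  have := FXm _ _ (mono_comp (sub_mono Z) mf).
  by move: (euler_ses th s); rewrite eZ; lra.
have sT (W : submod X) : Tbar P th (subm W) -> (W <= Z)%VS.
  move=> TW; have [I [e [j [ee mj je]]]] :=
    ex_image (hom_comp (quo_epi Z).1 (sub_mono W).1).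
  have I0 : rzero I by apply: (maxZ' _ _ _ _ (quo_epi Z) kZ mj); apply: Tbar_ge0 (Tbar_quo ee TW).
  apply/subvP => y /sub_lift[w <-]; apply/quo_eq0.
  by rewrite -comp_lfunE -je (hom_to0 e I0) comp_lfun0r zero_lfunE.
set B := trace_sub (Tbar P th) X; set C := trace_sub (Tcat P th) X.
have memB y : y \in svs B <-> y \in svs Z.
  split=> [|yZ]; last by apply: gensub_sub; exists Z.
  by apply/subvP/gensub_min => x [W /sT/subvP h /h].
have memC y : y \in svs C -> y = 0.
  move=> yC; apply/eqP; rewrite -memv0.
  have T0 : (C <= (gensub (set0 : set X)))%VS.
    apply: gensub_min => x [W TW xW]; apply: contrapT => x0.
    have W0 : ~ rzero (subm W).
      by move=> /rzeroP W0; move: x0; have [w <-] := sub_lift xW; rewrite (W0 w) linear0 mem0v.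
    have := (Tcat_epi th _).1 TW _ _ (@epi_id _ _ _) W0.
    by rewrite ltNge (FXm _ _ (sub_mono W)).
  have g0 : (gensub (set0 : set X) <= 0)%VS.
    by apply: vspan_min => x [a [v []]].
  exact: (subvP (subv_trans T0 g0)).
have [p [ep kp]] := subquo_prj B C.
have mp : mono p.
  apply: monoI; first by case: ep.
  by move=> x /kp/memC; exact: (mono_eq0 (sub_mono B)).
have ip : is_iso p by apply/iso_mono_epi.
have [p' [ip' p'p pp']] := iso_sym ip.
have mz := mono_comp (sub_mono B) ((iso_mono_epi _).1 ip').1.
set z := (_ \o _)%VF in mz.
have s : is_ses z (quo_prj Z : 'Hom(X, quom Z)).
  apply: is_sesP => //; first exact: quo_epi.
  move=> x; rewrite kZ -memB; split=> [/sub_lift[b <-]|[w <-]].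
    by exists (p b); rewrite comp_lfunE -(comp_lfunE p') p'p id_lfunE.
  by rewrite comp_lfunE sub_inj_in.
have iZ : euler P th (wmod P th X) = 0.
  by have := euler_ses th s; rewrite (euler_ses th (sub_ses Z)) eZ => /addIr.
exists (quom Z), z, (quo_prj Z); split=> //.
  apply/Fcat_mono => I j mj nI; rewrite ltNge; apply/negP => I0; apply: nI.
  exact: maxZ' (quo_epi Z) kZ mj I0.
move=> w0; apply: nFX; apply/Fcat_mono => I j mj nI; rewrite ltNge; apply/negP => I0.
apply: nI; apply: (maxZ' _ _ _ j (@epi_id _ _ X) _ mj I0) => x.
rewrite id_lfunE; split=> [->|]; first exact: mem0v.
by move=> /kZ/(ses_eq0 _ s)[w <-]; rewrite ((rzeroP _).1 w0 w) linear0.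
Qed.

End Stability.
(** * Projective modules and the Nakayama functor *)

Section LinearForms.
Variable K : fieldType.
Implicit Types V W : vectType K.

(** Since Hom(X, nu Q) is dual to Hom(Q, X) for Q projective, this extension of
    linear forms makes nu Q injective and gives factorizations through nu d. *)
Lemma extend_form V W (d : 'Hom(V, W)) (S : {vspace V}) (l : 'Hom(V, K^o)) :
  (forall v, v \in S -> d v = 0 -> v = 0) ->
  exists l' : 'Hom(W, K^o), forall v, v \in S -> l' (d v) = l v.
Proof.
move=> inj; pose i : 'Hom(subvs_of S, V) := linfun vsval.
have iE x : i x = vsval x by rewrite lfunE.
have k0 : lker (d \o i)%VF == 0%VS.
  apply/lker0P => x y; rewrite !comp_lfunE !iE => dxy.
  apply/subvs_inj/eqP; rewrite -subr_eq0; apply/eqP/inj.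
    by rewrite rpredB ?subvsP.
  by rewrite linearB /= dxy subrr.
exists (l \o (i \o (d \o i)^-1))%VF => v vS.
have -> : v = i (vsproj S v) by rewrite iE vsprojK.
by rewrite !comp_lfunE -(comp_lfunE d i) lker0_lfunK.
Qed.

Lemma form_separates V (v : V) : (forall l : 'Hom(V, K^o), l v = 0) -> v = 0.
Proof.
move=> lv; rewrite (coord_vbasis (memvf v)) big1// => i _.
have cl : linear (coord (vbasis {: V}) i : V -> K^o) by move=> k x y; rewrite linearP.
by have := lv (linfun (coord (vbasis {: V}) i : V -> K^o)); rewrite linfunE// => ->; rewrite scale0r.
Qed.

Definition annih V (S : {vspace V}) : {vspace 'Hom(V, K^o)} :=
  lker (precomp K^o (linfun vsval : 'Hom(subvs_of S, V))).

Lemma annihP V (S : {vspace V}) l :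
  l \in annih S <-> forall v, v \in S -> l v = 0.
Proof.
rewrite memv_ker precompE; split=> [/eqP lS v vS|lS].
  by rewrite -[v](vsprojK vS) -(lfunE vsval) -comp_lfunE lS zero_lfunE.
by apply/eqP/lfunP => x; rewrite comp_lfunE lfunE zero_lfunE lS ?subvsP.
Qed.

Lemma dim_form V : \dim {: 'Hom(V, K^o)} = \dim {: V}.
Proof. by rewrite !dimvf /dim /= muln1. Qed.

Lemma dim_annih V (S : {vspace V}) : (\dim (annih S) + \dim S = \dim {: V})%N.
Proof.
set p := precomp K^o (linfun vsval : 'Hom(subvs_of S, V)).
have := limg_ker_dim p fullv; rewrite capfv dim_form => <-; congr addn.
have -> : limg p = fullv.
  apply/vspaceP => l; rewrite memvf; apply/memv_imgP.
  exists (l \o linfun (vsproj S))%VF; first exact: memvf.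
  by rewrite precompE; apply/lfunP => x; rewrite !comp_lfunE !lfunE /= vsvalK.
by rewrite dim_form dimvf.
Qed.

End LinearForms.

Section Projective.
Variables (K : fieldType) (A : falgType K).
Implicit Types (L M N Q X Y Z : rmod A).

Definition orbit_map M (x : M) : 'Hom(regular A, M) := linfun (fun a : A => ract M a x).

Lemma orbit_mapE M (x : M) a : orbit_map x a = ract M a x.
Proof.
by rewrite /orbit_map linfunE// => k b c; rewrite ract_linear add_lfunE scale_lfunE.
Qed.

Lemma orbit_map_hom M (x : M) : is_hom (orbit_map x).
Proof. by move=> a b; rewrite !orbit_mapE /= lfunE /= ractM comp_lfunE. Qed.

Lemma regular_projective : projective (regular A).
Proof.
move=> M N g f hg sg hf; have [x gx] := epi_surj (conj hg sg) (f (1 : A)).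
exists (orbit_map x); first exact: orbit_map_hom.
apply/lfunP => a; rewrite comp_lfunE orbit_mapE hg gx -hf /= lfunE /= mul1r //.
Qed.

Lemma projective_lift Q M N (g : 'Hom(M, N)) (f : 'Hom(Q, N)) :
  projective Q -> is_hom g -> is_hom f -> (forall x, exists y, g y = f x) ->
  exists2 h : 'Hom(Q, M), is_hom h & (g \o h)%VF = f.
Proof.
move=> pQ hg hf fg; have [I [e [j [ee mj je]]]] := ex_image hg.
have [|f' hf' jf'] := factor_mono mj hf.
  by move=> x; have [y <-] := fg x; exists (e y); rewrite -comp_lfunE je.
have [h hh eh] := pQ _ _ e f' ee.1 ee.2 hf'; exists h => //.
by rewrite -je -comp_lfunA eh.
Qed.

Lemma projective_summand Q Q' (s : 'Hom(Q', Q)) (r : 'Hom(Q, Q')) :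
  projective Q -> is_hom s -> is_hom r -> (r \o s)%VF = \1%VF -> projective Q'.
Proof.
move=> pQ hs hr rs M N g f hg sg hf.
have [h hh gh] := pQ _ _ g (f \o r)%VF hg sg (hom_comp hf hr).
exists (h \o s)%VF; first exact: hom_comp.
by rewrite comp_lfunA gh -comp_lfunA rs comp_lfun1r.
Qed.

(** The free module on the dual of V; linear maps are used instead of tuples so
    that A acts by composition. *)
Section Free.
Variable V : vectType K.

Definition free_act (a : A) : 'End('Hom(V, A)) := postcomp V (amulr a).

Lemma free_actE a (f : 'Hom(V, A)) v : free_act a f v = f v * a.
Proof. by rewrite /free_act postcompE comp_lfunE lfunE. Qed.

Fact free_act_linear : linear free_act.
Proof.
move=> k a b; apply/lfunP => f; apply/lfunP => v.
by rewrite !(add_lfunE, scale_lfunE, free_actE) mulrDr scalerAr.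
Qed.

Fact free_act1 : free_act 1 = \1%VF.
Proof. by apply/lfunP => f; apply/lfunP => v; rewrite free_actE id_lfunE mulr1. Qed.

Fact free_actM a b : free_act (a * b) = (free_act b \o free_act a)%VF.
Proof.
by apply/lfunP => f; apply/lfunP => v; rewrite comp_lfunE !free_actE mulrA.
Qed.

Definition freem : rmod A := RMod free_act_linear free_act1 free_actM.
End Free.

(** The dual basis lemma: a section of a free cover of Q has coordinates in
    Hom(Q, A). *)
Lemma dual_basis Q : projective Q ->
  exists k (e : 'I_k -> Q) (g : 'I_k -> 'Hom(Q, regular A)),
    (forall i, is_hom (g i)) /\ forall x, x = \sum_i ract Q (g i x) (e i).
Proof.
move=> pQ; pose k := \dim {: Q}; pose e := fun i : 'I_k => (vbasis {: Q})`_i.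
pose V := 'rV[K]_k; pose del i : V := delta_mx 0 i.
pose sg (f : freem V) : Q := \sum_i ract Q (f (del i)) (e i).
have sgl : linear sg.
  move=> c f g; rewrite scaler_sumr -big_split; apply: eq_bigr => i _ /=.
  by rewrite add_lfunE scale_lfunE ract_linear add_lfunE scale_lfunE.
pose s : 'Hom(freem V, Q) := linfun sg.
have sE f : s f = sg f by rewrite /s linfunE.
have es : epi s.
  apply: epiI => [a f|y].
    rewrite !sE linear_sum; apply: eq_bigr => i _ /=.
    by rewrite free_actE ractM comp_lfunE.
  pose c i := coord (vbasis {: Q}) i y.
  pose f0 (v : V) : A := (\sum_i v 0 i * c i)%:A.
  have f0l : linear f0.
    move=> b u v; rewrite /f0 scalerA -scalerDl mulr_sumr -big_split.
    by congr (_ *: _); apply: eq_bigr => i _; rewrite !mxE mulrDl mulrA.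
  exists (linfun f0); rewrite sE /sg [RHS](coord_vbasis (memvf y)).
  apply: eq_bigr => i _; rewrite linfunE// /f0 (bigD1 i)//= mxE !eqxx mul1r.
  rewrite big1 ?addr0 => [|j ji]; last by rewrite mxE eqxx (negbTE ji) mul0r.
  have -> : (c i)%:A = c i *: 1 + 0 :> A by rewrite addr0.
  rewrite (ract_linear Q) ract1 add_lfunE scale_lfunE id_lfunE.
  suff -> : ract Q 0 = 0 by rewrite zero_lfunE addr0.
  have := ract_linear Q 0 0 0; rewrite !scale0r !add0r => _.
  have := ract_linear Q (-1) 0 0; rewrite scaleN1r oppr0 addr0 => ->.
  by rewrite scaleN1r addNr.
have [h hh sh] := pQ _ _ s _ es.1 es.2 (@hom_id _ _ Q).
pose ev i : 'Hom(freem V, regular A) := linfun (fun f : 'Hom(V, A) => f (del i)).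
have evE i (f : freem V) : ev i f = f (del i).
  by rewrite /ev linfunE// => c x y; rewrite add_lfunE scale_lfunE.
exists k, e, (fun i => ev i \o h)%VF; split=> [i|x].
  apply: hom_comp => // a f; rewrite !evE /= free_actE lfunE //.
rewrite -[LHS](id_lfunE) -sh comp_lfunE sE; apply: eq_bigr => i _.
by rewrite comp_lfunE evE.
Qed.

(** The elementary tensor of x and g, under the map from the tensor product of X
    and Hom(Q, A) to Hom(Q, X) *)
Definition tens Q X (x : X) (g : 'Hom(Q, regular A)) : 'Hom(Q, X) := (orbit_map x \o g)%VF.

Lemma tensE Q X (x : X) (g : 'Hom(Q, regular A)) p : tens x g p = ract X (g p) x.
Proof. by rewrite comp_lfunE orbit_mapE. Qed.

Lemma tens_hom Q X (x : X) (g : 'Hom(Q, regular A)) : is_hom g -> is_hom (tens x g).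
Proof. by move=> hg; apply: hom_comp => //; exact: orbit_map_hom. Qed.

Lemma tens_linear_l Q X (g : 'Hom(Q, regular A)) : linear (fun x : X => tens x g).
Proof.
move=> k x y; apply/lfunP => p.
by rewrite add_lfunE scale_lfunE !tensE linearP.
Qed.

Lemma tens_linear_r Q X (x : X) : linear (fun g : 'Hom(Q, regular A) => tens x g).
Proof.
move=> k g h; apply/lfunP => p.
by rewrite add_lfunE scale_lfunE !tensE add_lfunE scale_lfunE ract_linear add_lfunE scale_lfunE.
Qed.

(** The natural transformation from the linear dual of Hom(Q, X) to
    Hom(X, nu Q), which is an isomorphism for Q projective. *)
Definition psi Q X (l : 'Hom('Hom(Q, X), K^o)) : 'Hom(X, nu Q) :=
  linfun (fun x : X => (linfun (fun g : dualA Q => l (tens x (dualA_inj Q g))) : nu Q)).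

Lemma psiE Q X (l : 'Hom('Hom(Q, X), K^o)) x g :
  psi l x g = l (tens x (dualA_inj Q g)).
Proof.
have lin x' : linear (fun g : dualA Q => l (tens x' (dualA_inj Q g))).
  by move=> k g1 g2; rewrite linearP tens_linear_r linearP.
rewrite /psi (@linfunE _ X (nu Q)); first by rewrite linfunE.
move=> k y z; apply/lfunP => h.
by rewrite add_lfunE scale_lfunE !linfunE// tens_linear_l linearP.
Qed.

Lemma psi_linear Q X : linear (@psi Q X).
Proof.
move=> k l l'; apply/lfunP => x; apply/lfunP => g.
by rewrite !(add_lfunE, scale_lfunE, psiE).
Qed.

Lemma psi_hom Q X (l : 'Hom('Hom(Q, X), K^o)) : is_hom (psi l).
Proof.
move=> a x; apply/lfunP => g; rewrite /= nu_actE !psiE dualA_actE.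
congr (l _); apply/lfunP => p; rewrite !tensE comp_lfunE.
by rewrite [(amull a : 'End(regular A)) _]lfunE /= ractM comp_lfunE.
Qed.

Lemma psi_surj Q X (v : 'Hom(X, nu Q)) : projective Q -> is_hom v ->
  exists l, psi l = v.
Proof.
move=> pQ hv; have [k [e [g [hg eg]]]] := dual_basis pQ.
pose l0 (u : 'Hom(Q, X)) : K^o := \sum_i v (u (e i)) (dualA_ret Q (g i)).
have l0l : linear l0.
  move=> c u w; rewrite /l0 scaler_sumr -big_split; apply: eq_bigr => i _ /=.
  by rewrite add_lfunE scale_lfunE linearP add_lfunE scale_lfunE.
exists (linfun l0); apply/lfunP => x; apply/lfunP => h; rewrite psiE linfunE//.
have hE : h = \sum_i dualA_act Q (dualA_inj Q h (e i)) (dualA_ret Q (g i)).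
  apply: (@dualA_inj_inj _ _ Q); apply/lfunP => p.
  rewrite linear_sum sum_lfunE {1}[p]eg linear_sum; apply: eq_bigr => i _ /=.
  by rewrite dualA_actE comp_lfunE dualA_retK// dualA_hom /= !lfunE.
rewrite [in RHS]hE linear_sum; apply: eq_bigr => i _ /=.
by rewrite tensE hv /= nu_actE.
Qed.

Lemma psi_eq0 Q X (l : 'Hom('Hom(Q, X), K^o)) : projective Q ->
  psi l = 0 <-> forall u : 'Hom(Q, X), is_hom u -> l u = 0.
Proof.
move=> pQ; split=> [l0 u hu|l0].
  have [k [e [g [hg eg]]]] := dual_basis pQ.
  have -> : u = \sum_i tens (u (e i)) (g i).
    apply/lfunP => x; rewrite sum_lfunE {1}[x]eg linear_sum.
    by apply: eq_bigr => i _; rewrite tensE /= hu.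
  rewrite linear_sum big1// => i _; have := psiE l (u (e i)) (dualA_ret Q (g i)).
  by rewrite l0 !zero_lfunE dualA_retK.
apply/lfunP => x; apply/lfunP => g; rewrite psiE !zero_lfunE.
by apply/l0/tens_hom/dualA_hom.
Qed.

Lemma psi_nat_l Q Q' X (d : 'Hom(Q', Q)) (l : 'Hom('Hom(Q', X), K^o)) : is_hom d ->
  (nu_map d \o psi l)%VF = psi (l \o precomp X d)%VF.
Proof.
move=> hd; apply/lfunP => x; apply/lfunP => g.
rewrite comp_lfunE nu_mapE !psiE [RHS]comp_lfunE precompE; congr (l _).
by rewrite dualA_mapE// /tens comp_lfunA.
Qed.

Lemma psi_nat_r Q X Y (f : 'Hom(X, Y)) (l : 'Hom('Hom(Q, Y), K^o)) : is_hom f ->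
  (psi l \o f)%VF = psi (l \o postcomp Q f)%VF.
Proof.
move=> hf; apply/lfunP => x; apply/lfunP => g.
rewrite comp_lfunE !psiE [RHS]comp_lfunE postcompE; congr (l _); apply/lfunP => p.
by rewrite [RHS]comp_lfunE !tensE hf.
Qed.

Lemma nu_injective Q X Y (j : 'Hom(X, Y)) (v : 'Hom(X, nu Q)) :
  projective Q -> mono j -> is_hom v ->
  exists2 w : 'Hom(Y, nu Q), is_hom w & (w \o j)%VF = v.
Proof.
move=> pQ mj hv; have [l <-] := psi_surj pQ hv.
have [|l' l'l] := @extend_form _ _ _ (postcomp Q j) (HomA Q X) l.
  move=> u _; rewrite postcompE => ju; apply: (mono_cancel mj).
  by rewrite ju comp_lfun0r.
exists (psi l'); first exact: psi_hom.
have hj := mj.1; rewrite psi_nat_r//; apply/eqP; rewrite -subr_eq0 -scaleN1r addrC -psi_linear.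
apply/eqP/(psi_eq0 _ pQ) => u /mem_HomA hu.
by rewrite add_lfunE scale_lfunE scaleN1r comp_lfunE l'l// addNr.
Qed.

Lemma dim_HomA_nu Q X : projective Q -> \dim (HomA X (nu Q)) = \dim (HomA Q X).
Proof.
move=> pQ; pose Ps := linfun (@psi Q X).
have PsE l : Ps l = psi l by rewrite /Ps linfunE//; exact: psi_linear.
have <- : limg Ps = HomA X (nu Q).
  apply/vspaceP => v; apply/memv_imgP/idP => [[l _ ->]|/mem_HomA hv].
    by rewrite PsE; apply/mem_HomA/psi_hom.
  by have [l <-] := psi_surj pQ hv; exists l; rewrite ?memvf ?PsE.
have kP : lker Ps = annih (HomA Q X).
  apply/vspaceP => l; rewrite memv_ker PsE; apply/eqP/idP => [/(psi_eq0 _ pQ) l0|].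
    by apply/annihP => u /mem_HomA; exact: l0.
  by move=> /annihP l0; apply/(psi_eq0 _ pQ) => u /mem_HomA; exact: l0.
have := limg_ker_dim Ps fullv; rewrite capfv kP dim_form.
by rewrite -(dim_annih (HomA Q X)) => /addnI.
Qed.

Lemma dualA_map_linear M N : linear (@dualA_map K A M N).
Proof.
move=> k f g; apply/lfunP => h; rewrite add_lfunE scale_lfunE !comp_lfunE.
rewrite !precompE -linearP; congr (dualA_ret M _); apply/lfunP => x.
by rewrite !(add_lfunE, scale_lfunE, comp_lfunE) linearP.
Qed.

Lemma nu_map_linear M N : linear (@nu_map K A M N).
Proof.
move=> k f g; apply/lfunP => h; apply/lfunP => x.
by rewrite !(add_lfunE, scale_lfunE, nu_mapE) dualA_map_linear add_lfunE scale_lfunE linearP.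
Qed.

Lemma nu_mapD M N (f g : 'Hom(M, N)) : nu_map (f + g) = nu_map f + nu_map g.
Proof. by rewrite -[f]scale1r nu_map_linear !scale1r. Qed.

Lemma nu_mapB M N (f g : 'Hom(M, N)) : nu_map (f - g) = nu_map f - nu_map g.
Proof. by rewrite addrC -scaleN1r nu_map_linear scaleN1r addrC. Qed.

Lemma nu_map_sum M N (I : finType) (f : I -> 'Hom(M, N)) :
  nu_map (\sum_i f i) = \sum_i nu_map (f i).
Proof. by apply: (big_morph (@nu_map K A M N) (@nu_mapD M N)); exact: nu_map0. Qed.

Lemma nu_map1 M : nu_map (\1%VF : 'Hom(M, M)) = \1%VF.
Proof.
apply/lfunP => f; apply/lfunP => g; rewrite nu_mapE id_lfunE; congr (f _).
by apply: (@dualA_inj_inj _ _ M); rewrite dualA_mapE ?comp_lfun1r//; exact: hom_id.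
Qed.

Lemma nu_rzero M : rzero M -> rzero (nu M).
Proof.
move=> M0; apply/rzeroP => x; rewrite -(id_lfunE x) -nu_map1.
by rewrite (hom_to0 \1%VF M0) nu_map0 zero_lfunE.
Qed.

Lemma nu_map_eq0 Q Q' (g : 'Hom(Q, Q')) : projective Q' -> is_hom g ->
  nu_map g = 0 -> g = 0.
Proof.
move=> pQ' hg g0; apply/lfunP => x; rewrite zero_lfunE.
have [k [e [h [hh eh]]]] := dual_basis pQ'.
rewrite [g x]eh big1// => i _.
suff -> : h i (g x) = 0 by have := orbit_mapE (e i) 0; rewrite linear0.
rewrite -[h i](dualA_retK (hh i)) -comp_lfunE -dualA_mapE//.
set y := dualA_map g _; suff -> : y = 0 by rewrite linear0 zero_lfunE.
by apply: form_separates => l; rewrite -nu_mapE g0 !zero_lfunE.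
Qed.

(** On projective modules the Nakayama functor is faithful by the dual basis
    lemma, hence full because the spaces of homomorphisms have the same
    dimension. *)
Lemma nu_map_full Q Q' (f : 'Hom(nu Q, nu Q')) : projective Q -> projective Q' ->
  is_hom f -> exists2 g : 'Hom(Q, Q'), is_hom g & nu_map g = f.
Proof.
move=> pQ pQ' hf; pose v := linfun (@nu_map K A Q Q').
have vE g : v g = nu_map g by rewrite /v linfunE//; exact: nu_map_linear.
have sub : (v @: HomA Q Q' <= HomA (nu Q) (nu Q'))%VS.
  apply/subvP => _ /memv_imgP[g /mem_HomA hg ->].
  by rewrite vE; apply/mem_HomA/nu_map_hom.
have : (v @: HomA Q Q' == HomA (nu Q) (nu Q'))%VS.
  rewrite eqEdim sub/= limg_dim_eq.
    apply: eq_leq; apply: etrans (@dim_HomA_nu Q' (nu Q) pQ') _.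
    exact: (@dim_HomA_nu Q Q' pQ).
  apply/eqP; rewrite -subv0; apply/subvP => g; rewrite memv_cap memv_ker memv0 vE.
  by move=> /andP[/mem_HomA hg /eqP g0]; apply/eqP; exact: (nu_map_eq0 pQ' hg g0).
move=> /eqP e; have /mem_HomA := hf; rewrite -e => /memv_imgP[g /mem_HomA hg ->].
by exists g => //; rewrite vE.
Qed.

End Projective.
(** * Two-term presentations *)

Section Classes.
Variables (R : realType) (K : fieldType) (A : falgType K).
Variables (n : nat) (P : 'I_n -> rmod A).
Hypothesis hP : indproj_list P.
Implicit Types (L M N Q X Y Z : rmod A).

Lemma projP j : projective (P j).
Proof. by have [h _ _] := hP; have [] := h j. Qed.

Lemma ses_dim L M N (f : 'Hom(L, M)) (g : 'Hom(M, N)) : is_ses f g ->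
  \dim {: M} = (\dim {: L} + \dim {: N})%N.
Proof.
move=> [hf hg kf fg sg]; have := limg_ker_dim g fullv.
rewrite capfv -fg sg => <-; congr addn.
by have := limg_ker_dim f fullv; rewrite kf capv0 dimv0 add0n.
Qed.

Lemma dim_HomA_dsum M X (M_ : bool -> rmod A) (inj : forall i, 'Hom(M_ i, M))
    (prj : forall i, 'Hom(M, M_ i)) :
  (forall i, is_hom (inj i) /\ is_hom (prj i)) ->
  (forall i, (prj i \o inj i)%VF = \1%VF) ->
  (forall i j, i != j -> (prj j \o inj i)%VF = 0) ->
  \sum_i (inj i \o prj i)%VF = \1%VF ->
  \dim (HomA M X) = (\dim (HomA (M_ true) X) + \dim (HomA (M_ false) X))%N.
Proof.
move=> h pi1 pi0; rewrite big_bool /= => s1.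
rewrite -(limg_ker_dim (precomp X (inj true)) (HomA M X)) addnC; congr addn.
  congr (\dim _); apply/vspaceP => u; apply/memv_imgP/idP.
    move=> [v /mem_HomA hv ->]; rewrite precompE; apply/mem_HomA.
    by apply: hom_comp => //; exact: (h true).1.
  move=> /mem_HomA hu; exists (u \o prj true)%VF.
    by apply/mem_HomA; apply: hom_comp => //; exact: (h true).2.
  by rewrite precompE -comp_lfunA pi1 comp_lfun1r.
rewrite -(@limg_dim_eq _ _ _ (precomp X (prj false)) (HomA (M_ false) X)); last first.
  apply/eqP; rewrite -subv0; apply/subvP => u; rewrite memv_cap memv_ker memv0.
  rewrite precompE => /andP[_ /eqP u0].
  by rewrite -(comp_lfun1r u) -(pi1 false) comp_lfunA u0 comp_lfun0l.
congr (\dim _); apply/vspaceP => u; rewrite memv_cap memv_ker precompE.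
apply/andP/memv_imgP => [[/mem_HomA hu /eqP u0]|[v /mem_HomA hv ->]].
  exists (u \o inj false)%VF.
    by apply/mem_HomA; apply: hom_comp => //; exact: (h false).1.
  rewrite precompE -{1}(comp_lfun1r u) -s1 comp_lfunDr.
  by rewrite !comp_lfunA u0 comp_lfun0l add0r.
rewrite precompE -comp_lfunA pi0// comp_lfun0r eqxx; split=> //.
by apply/mem_HomA; apply: hom_comp => //; exact: (h false).2.
Qed.

Lemma dim_HomA_isol Q Q' X : risom Q Q' -> \dim (HomA Q X) = \dim (HomA Q' X).
Proof.
suff le Z Y (f : 'Hom(Z, Y)) (g : 'Hom(Y, Z)) :
    is_hom g -> (g \o f)%VF = \1%VF -> (\dim (HomA Z X) <= \dim (HomA Y X))%N.
  move=> [f [hf [g [hg gf fg]]]]; apply/eqP.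
  by rewrite eqn_leq (le _ _ f g)// (le _ _ g f).
move=> hg gf; rewrite -(@limg_dim_eq _ _ _ (precomp X g) (HomA Z X)).
  apply/dimvS/subvP => _ /memv_imgP[h /mem_HomA hh ->].
  by rewrite precompE; apply/mem_HomA/hom_comp.
apply/eqP; rewrite -subv0; apply/subvP => h; rewrite memv_cap memv_ker memv0.
rewrite precompE => /andP[_ /eqP gh0]; apply/eqP.
by rewrite -(comp_lfun1r h) -gf comp_lfunA gh0 comp_lfun0l.
Qed.

(** The class of a projective module in K_0(proj A): splitting off summands as
    long as possible, every projective module is a sum of indecomposable ones. *)
Lemma projective_class Q : projective Q ->
  exists c : 'I_n -> nat, forall X,
    \dim (HomA Q X) = (\sum_j c j * \dim (HomA (P j) X))%N.
Proof.
have [k] := ubnP (\dim {: Q}); elim: k Q => // k IH Q; rewrite ltnS => dQ pQ.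
have [Q0|Q0] := pselect (rzero Q).
  exists (fun _ => 0%N) => X; rewrite big1 // (dim_HomA_eq0 _ _).2// => f _.
  exact: hom_from0.
have [iQ|] := pselect (indecomposable Q).
  have [_ _ h] := hP; have [j iso] := h Q pQ iQ.
  exists (fun i => (i == j) : nat) => X; rewrite (bigD1 j)//= eqxx mul1n big1.
    by rewrite addn0 (dim_HomA_isol X iso).
  by move=> i /negbTE->; rewrite mul0n.
move=> niQ; have [M_ [ds nz]] : exists M_ : bool -> rmod A,
    is_dsum Q M_ /\ forall b, ~ rzero (M_ b).
  apply: contrapT => no; apply: niQ; split=> // M_ ds; apply: contrapT => nz.
  by apply: no; exists M_; split=> // b zb; apply: nz; exists b.
have [inj [prj [h pi1 pi0 s1]]] := ds.
have ses : is_ses (inj true) (prj false).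
  apply: is_sesP.
  - apply: monoI; first exact: (h true).1.
    by move=> x ix; rewrite -(id_lfunE x) -pi1 comp_lfunE ix linear0.
  - apply: epiI; first exact: (h false).2.
    by move=> y; exists (inj false y); rewrite -comp_lfunE pi1 id_lfunE.
  - move=> y; split=> [py|[x <-]]; last by rewrite -comp_lfunE pi0 ?zero_lfunE.
    exists (prj true y); rewrite -[RHS](id_lfunE y) -s1 big_bool /=.
    by rewrite add_lfunE !comp_lfunE py linear0 addr0.
have dsum := ses_dim ses.
have pos b : (0 < \dim {: M_ b})%N by rewrite lt0n; apply/eqP; exact: nz.
have pM b : projective (M_ b).
  exact: projective_summand pQ (h b).1 (h b).2 (pi1 b).
have [|c1 hc1] := IH (M_ true) _ (pM true).
  by apply: leq_trans dQ; rewrite dsum -[X in (X < _)%N]addn0 ltn_add2l.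
have [|c2 hc2] := IH (M_ false) _ (pM false).
  by apply: leq_trans dQ; rewrite dsum -[X in (X < _)%N]add0n ltn_add2r.
exists (fun j => c1 j + c2 j)%N => X.
rewrite (dim_HomA_dsum X h pi1 pi0 s1) hc1 hc2 -big_split.
by apply: eq_bigr => j _; rewrite mulnDl.
Qed.

Lemma projective_form Q : projective Q ->
  exists th : 'rV[R]_n, forall X, dot (dimv R P X) th = (\dim (HomA Q X))%:R.
Proof.
move=> /projective_class[c hc]; exists (\row_j (c j)%:R) => X.
rewrite hc natr_sum; apply: eq_bigr => j _.
by rewrite !mxE natrM.
Qed.

Lemma dimv_eq0 X : dimv R P X = 0 -> rzero X.
Proof.
move=> X0; have [th hth] := projective_form (@regular_projective _ A).
have := hth X; rewrite X0 dot0l => /eqP; rewrite eq_sym pnatr_eq0 => /eqP d0.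
apply/rzeroP => x; have := (dim_HomA_eq0 _ _).1 d0 (orbit_map x) (@orbit_map_hom _ _ _ x).
by move=> r0; rewrite -(id_lfunE x) -ract1 -orbit_mapE r0 zero_lfunE.
Qed.

(** The properties of the modules H^0(U) and H^{-1}(nu U) of a 2-term presilting
    complex U on which the structure of D(U) rests; the linear form in the first
    one is the class of U. *)
Record rigid_pair M N : Prop := RigidPair {
  rp_form : exists th : 'rV[R]_n, forall X,
    euler P th X = (\dim (HomA M X))%:R - (\dim (HomA X N))%:R;
  rp_hom : forall f : 'Hom(M, N), is_hom f -> f = 0;
  rp_lift : forall L Y Z (k : 'Hom(L, Y)) (q : 'Hom(Y, Z)) (f : 'Hom(M, Z)),
    is_ses k q -> (forall g : 'Hom(L, N), is_hom g -> g = 0) -> is_hom f ->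
    exists2 g : 'Hom(M, Y), is_hom g & (q \o g)%VF = f;
  rp_extend : forall X Y Z (k : 'Hom(X, Y)) (q : 'Hom(Y, Z)) (f : 'Hom(X, N)),
    is_ses k q -> (forall g : 'Hom(M, Z), is_hom g -> g = 0) -> is_hom f ->
    exists2 g : 'Hom(Y, N), is_hom g & (g \o k)%VF = f }.

Section Presentation.
Variables (P1 P0 M N : rmod A) (d : 'Hom(P1, P0)).
Variables (p : 'Hom(P0, M)) (i : 'Hom(N, nu P1)).
Hypotheses (pP1 : projective P1) (pP0 : projective P0) (hd : is_hom d).
Hypotheses (ep : epi p) (kp : forall x, p x = 0 <-> exists y, d y = x).
Hypotheses (mi : mono i) (ki : forall v, nu_map d v = 0 <-> exists z, i z = v).

Let W0 X := HomA P0 X.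
Let W1 X := HomA P1 X.
Let dX X := precomp X d.

Lemma dim_Hom_coker X : \dim (HomA M X) = \dim (W0 X :&: lker (dX X))%VS.
Proof.
rewrite -(@limg_dim_eq _ _ _ (precomp X p) (HomA M X)); last first.
  apply/eqP; rewrite -subv0; apply/subvP => u; rewrite memv_cap memv_ker memv0.
  rewrite precompE => /andP[_ /eqP u0]; apply/eqP; apply: (epi_cancel ep).
  by rewrite u0 comp_lfun0l.
have pd0 : (p \o d)%VF = 0.
  by apply/lfunP => y; rewrite comp_lfunE zero_lfunE; apply/kp; exists y.
congr (\dim _); apply/vspaceP => u; rewrite memv_cap memv_ker precompE.
apply/memv_imgP/andP => [[v /mem_HomA hv ->]|[/mem_HomA hu /eqP u0]].
  rewrite precompE -comp_lfunA pd0 comp_lfun0r eqxx; split=> //.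
  by apply/mem_HomA/hom_comp => //; exact: ep.1.
have [|v hv vp] := factor_epi ep hu; last first.
  by exists v; [exact/mem_HomA | rewrite precompE].
by move=> _ /kp[y <-]; rewrite -comp_lfunE u0 zero_lfunE.
Qed.

(** The space Hom(X, N) is the annihilator of the image of Hom(P0, X) in
    Hom(P1, X), by the duality between Hom(P1, X) and Hom(X, nu P1). *)
Lemma dim_Hom_ker X :
  (\dim (HomA X N) + \dim (dX X @: W0 X)%VS = \dim (W1 X))%N.
Proof.
pose Ps := linfun (@psi _ _ P1 X).
have PsE l : Ps l = psi l by rewrite /Ps linfunE//; exact: psi_linear.
set S := (dX X @: W0 X)%VS.
have SW : (S <= W1 X)%VS.
  apply/subvP => _ /memv_imgP[u /mem_HomA hu ->]; rewrite precompE.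
  by apply/mem_HomA/hom_comp.
have nd0 l : (nu_map d \o psi l)%VF = 0 <-> l \in annih S.
  rewrite psi_nat_l//; split=> [/(psi_eq0 _ pP0) h|/annihP h].
    apply/annihP => _ /memv_imgP[u /mem_HomA hu ->].
    by rewrite -(h u hu) comp_lfunE.
  apply/(psi_eq0 _ pP0) => u /mem_HomA hu; rewrite comp_lfunE.
  by apply: h; rewrite memv_img.
have eH : (Ps @: annih S)%VS = (postcomp X i @: HomA X N)%VS.
  apply/vspaceP => v; apply/memv_imgP/memv_imgP => -[].
    move=> l /nd0 l0 ->; rewrite PsE.
    have [|w hw iw] := factor_mono mi (psi_hom l).
      by move=> x; apply/ki; rewrite -comp_lfunE l0 zero_lfunE.
    by exists w; [exact/mem_HomA | rewrite postcompE].
  move=> w /mem_HomA hw ->; rewrite postcompE.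
  have [l lw] := psi_surj pP1 (hom_comp mi.1 hw).
  exists l; last by rewrite PsE lw.
  apply/nd0; rewrite lw; apply/lfunP => x; rewrite !comp_lfunE zero_lfunE.
  by apply/ki; exists (w x).
have -> : \dim (HomA X N) = \dim (Ps @: annih S)%VS.
  rewrite eH limg_dim_eq//; apply/eqP; rewrite -subv0; apply/subvP => u.
  rewrite memv_cap memv_ker memv0 postcompE => /andP[_ /eqP u0].
  by apply/eqP; apply: (mono_cancel mi); rewrite u0 comp_lfun0r.
have := limg_ker_dim Ps (annih S).
have -> : (annih S :&: lker Ps)%VS = annih (W1 X).
  apply/vspaceP => l; rewrite memv_cap [l \in lker Ps]memv_ker PsE.
  apply/andP/idP => [[_ /eqP/(psi_eq0 _ pP1) h]|/annihP h].
    by apply/annihP => u /mem_HomA; exact: h.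
  split; first by apply/annihP => u /(subvP SW); exact: h.
  by apply/eqP/(psi_eq0 _ pP1) => u /mem_HomA; exact: h.
move=> eK; have eW := dim_annih (W1 X); have eS := dim_annih S.
apply/eqP; rewrite -(eqn_add2l (\dim (annih (W1 X)))) eW addnA eK eS.
by [].
Qed.

(** The class [P0] - [P1] represents the difference of the dimensions, since the
    common rank of the two maps induced by d cancels. *)
Lemma presentation_form : exists th : 'rV[R]_n, forall X,
  euler P th X = (\dim (HomA M X))%:R - (\dim (HomA X N))%:R.
Proof.
have [t0 h0] := projective_form pP0; have [t1 h1] := projective_form pP1.
exists (t0 - t1) => X; rewrite euler_dot dotBr h0 h1.
rewrite -/(W0 X) -/(W1 X) -(dim_Hom_ker X) -(limg_ker_dim (dX X) (W0 X)).
by rewrite -dim_Hom_coker !natrD; lra.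
Qed.

(** If Hom(X, N) = 0, the dimension count shows that composition with d maps
    Hom(P0, X) onto Hom(P1, X). *)
Lemma factor_d X (u : 'Hom(P1, X)) :
  (forall g : 'Hom(X, N), is_hom g -> g = 0) -> is_hom u ->
  exists2 v : 'Hom(P0, X), is_hom v & (v \o d)%VF = u.
Proof.
move=> XN hu; have XN0 := (dim_HomA_eq0 _ _).2 XN.
have := dim_Hom_ker X; rewrite XN0 add0n => dS.
have : (dX X @: W0 X == W1 X)%VS.
  rewrite eqEdim dS leqnn andbT; apply/subvP => _ /memv_imgP[v /mem_HomA hv ->].
  by rewrite precompE; apply/mem_HomA/hom_comp.
move=> /eqP e; have /mem_HomA := hu; rewrite -/(W1 X) -e.
by move=> /memv_imgP[v /mem_HomA hv ->]; exists v => //; rewrite precompE.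
Qed.

(** If Hom(M, X) = 0, composition with d is injective on Hom(P0, X), and so its
    transpose is onto. *)
Lemma factor_nud X (v : 'Hom(X, nu P0)) :
  (forall g : 'Hom(M, X), is_hom g -> g = 0) -> is_hom v ->
  exists2 w : 'Hom(X, nu P1), is_hom w & (nu_map d \o w)%VF = v.
Proof.
move=> MX hv; have [l0 <-] := psi_surj pP0 hv.
have [|l1 hl1] := @extend_form _ _ _ (dX X) (W0 X) l0.
  move=> u /mem_HomA hu; rewrite precompE => u0.
  have [|g hg <-] := factor_epi ep hu.
    by move=> _ /kp[y <-]; rewrite -comp_lfunE u0 zero_lfunE.
  by rewrite (MX g hg) comp_lfun0l.
exists (psi l1); first exact: psi_hom.
rewrite psi_nat_l//; apply/eqP; rewrite -subr_eq0 -scaleN1r addrC -psi_linear.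
apply/eqP/(psi_eq0 _ pP0) => u /mem_HomA hu.
by rewrite add_lfunE scale_lfunE scaleN1r comp_lfunE hl1// addNr.
Qed.

(** A lift P0 -> Y of P0 -> M -> Z maps the image of d to L; correcting it by the
    factorization through d of the resulting map P1 -> L makes it vanish there. *)
Lemma presentation_lift L Y Z (k : 'Hom(L, Y)) (q : 'Hom(Y, Z)) (f : 'Hom(M, Z)) :
  is_ses k q -> (forall g : 'Hom(L, N), is_hom g -> g = 0) -> is_hom f ->
  exists2 g : 'Hom(M, Y), is_hom g & (q \o g)%VF = f.
Proof.
move=> s LN hf; have [hk hq kk _ sq] := s.
have [g0 hg0 qg0] := pP0 hq sq (hom_comp hf ep.1).
have [|u hu ku] := factor_mono (conj hk kk) (hom_comp hg0 hd).
  move=> x; apply/(ses_eq0 _ s); rewrite comp_lfunE -(comp_lfunE q) qg0 comp_lfunE.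
  by rewrite ((kp _).2 (ex_intro _ x erefl)) linear0.
have [v hv vd] := factor_d LN hu.
have [|g hg gp] := factor_epi ep (hom_sub hg0 (hom_comp hk hv)).
  move=> _ /kp[y <-]; rewrite add_lfunE opp_lfunE -!comp_lfunE -comp_lfunA vd ku.
  by rewrite subrr.
exists g => //; apply: (epi_cancel ep); rewrite -comp_lfunA gp -qg0.
apply/lfunP => x; rewrite !comp_lfunE add_lfunE opp_lfunE linearB /=.
rewrite (comp_lfunE k) (_ : q (k _) = 0) ?subr0//.
by apply/(ses_eq0 _ s); exists (v x).
Qed.

(** The dual argument, with the injective modules nu P1 and nu P0. *)
Lemma presentation_extend X Y Z (k : 'Hom(X, Y)) (q : 'Hom(Y, Z)) (f : 'Hom(X, N)) :
  is_ses k q -> (forall g : 'Hom(M, Z), is_hom g -> g = 0) -> is_hom f ->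
  exists2 g : 'Hom(Y, N), is_hom g & (g \o k)%VF = f.
Proof.
move=> s MZ hf; have [hk hq kk _ sq] := s.
have [g0 hg0 g0k] := nu_injective pP1 (conj hk kk) (hom_comp mi.1 hf).
have hnd := nu_map_hom hd.
have [|u hu uq] := factor_epi (conj hq sq) (hom_comp hnd hg0).
  move=> _ /(ses_eq0 _ s)[x <-]; rewrite comp_lfunE -(comp_lfunE g0) g0k.
  by apply/ki; exists (f x); rewrite comp_lfunE.
have [v hv dv] := factor_nud MZ hu.
have [|g hg ig] := factor_mono mi (hom_sub hg0 (hom_comp hv hq)).
  move=> y; apply/ki; rewrite add_lfunE opp_lfunE linearB /= -!comp_lfunE.
  by rewrite comp_lfunA dv uq subrr.
exists g => //; apply: (mono_cancel mi); rewrite comp_lfunA ig -g0k.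
apply/lfunP => x; rewrite !comp_lfunE add_lfunE opp_lfunE (comp_lfunE v).
have -> : q (k x) = 0 by apply/(ses_eq0 _ s); exists x.
by rewrite linear0 subr0.
Qed.

(** By the dimension count it suffices that each map P1 -> M factors through d.
    It lifts to P1 -> P0, and the part of this lift with values in the image of d
    vanishes in M. *)
Lemma presentation_hom :
  (forall f : 'Hom(P1, P0), is_hom f -> exists (a : 'Hom(P1, P1)) (b : 'Hom(P0, P0)),
     [/\ is_hom a, is_hom b & f = ((d \o a) + (b \o d))%VF]) ->
  forall f : 'Hom(M, N), is_hom f -> f = 0.
Proof.
move=> rig; apply/dim_HomA_eq0; have := dim_Hom_ker M.
suff -> : (dX M @: W0 M)%VS = W1 M by move/eqP; rewrite -[X in _ == X]add0n eqn_add2r => /eqP.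
apply/vspaceP => u; apply/memv_imgP/idP => [[v /mem_HomA hv ->]|/mem_HomA hu].
  by rewrite precompE; apply/mem_HomA/hom_comp.
have [f hf pf] := pP1 ep.1 ep.2 hu; have [a [b [ha hb fE]]] := rig f hf.
exists (p \o b)%VF; first by apply/mem_HomA/hom_comp => //; exact: ep.1.
rewrite precompE -pf fE comp_lfunDr !comp_lfunA (_ : (p \o d)%VF = 0).
  by rewrite comp_lfun0l add0r.
by apply/lfunP => y; rewrite comp_lfunE zero_lfunE; apply/kp; exists y.
Qed.

Lemma lift_endo_coker (f : 'Hom(M, M)) : is_hom f ->
  exists (f1 : 'Hom(P1, P1)) (f0 : 'Hom(P0, P0)),
    [/\ is_hom f1, is_hom f0, (d \o f1)%VF = (f0 \o d)%VF & (p \o f0)%VF = (f \o p)%VF].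
Proof.
move=> hf; have [f0 hf0 pf0] := pP0 ep.1 ep.2 (hom_comp hf ep.1).
have [|f1 hf1 df1] := projective_lift pP1 hd (hom_comp hf0 hd).
  move=> x; apply/kp; rewrite comp_lfunE -(comp_lfunE p) pf0 comp_lfunE.
  by rewrite ((kp _).2 (ex_intro _ x erefl)) linear0.
by exists f1, f0.
Qed.

(** The extensions of an endomorphism of N to nu P1 and nu P0 come from maps of
    projective modules because nu is full on these. *)
Lemma lift_endo_ker (f : 'Hom(N, N)) : is_hom f ->
  exists (f1 : 'Hom(P1, P1)) (f0 : 'Hom(P0, P0)),
    [/\ is_hom f1, is_hom f0, (d \o f1)%VF = (f0 \o d)%VF
      & (nu_map f1 \o i)%VF = (i \o f)%VF].
Proof.
move=> hf; have hnd := nu_map_hom hd.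
have [g1 hg1 g1i] := nu_injective pP1 mi (hom_comp mi.1 hf).
have [I [e [j [ee mj je]]]] := ex_image hnd.
have [|h hh he] := factor_epi ee (hom_comp hnd hg1).
  move=> x ex; have [z <-] : exists z, i z = x.
    by apply/ki; rewrite -je comp_lfunE ex linear0.
  rewrite comp_lfunE -(comp_lfunE g1) g1i comp_lfunE.
  by apply/ki; exists (f z).
have [g0 hg0 g0j] := nu_injective pP0 mj hh.
have [f1 hf1 nf1] := nu_map_full pP1 pP1 hg1.
have [f0 hf0 nf0] := nu_map_full pP0 pP0 hg0.
exists f1, f0; split=> //; last by rewrite nf1.
apply/eqP; rewrite -subr_eq0; apply/eqP; apply: (nu_map_eq0 pP0).
  by apply: hom_sub; exact: hom_comp.
by rewrite nu_mapB !nu_map_comp// nf1 nf0 -{2}je comp_lfunA g0j he subrr.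
Qed.

End Presentation.
End Classes.
(** * Complexes up to homotopy *)

Lemma lfunB (K : fieldType) (V W : vectType K) (f : 'Hom(V, W)) x y :
  f (x - y) = f x - f y.
Proof. exact: linearB. Qed.

Lemma lfunD (K : fieldType) (V W : vectType K) (f : 'Hom(V, W)) x y :
  f (x + y) = f x + f y.
Proof. exact: linearD. Qed.

Section ChainMaps.
Variables (K : fieldType) (A : falgType K).
Implicit Types (C D E : cpx A).

Lemma cmap_id C : is_cmap (@cident K A C).
Proof.
by split=> [i|i j]; [exact: hom_id | rewrite comp_lfun1l comp_lfun1r].
Qed.

Lemma cmap_zero C D : is_cmap (@Defs.czero K A C D).
Proof.
by split=> [i|i j]; [exact: hom_0 | rewrite comp_lfun0l comp_lfun0r].
Qed.

Lemma cmap_comp C D E (f : forall i, 'Hom(D i, E i)) (g : forall i, 'Hom(C i, D i)) :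
  is_cmap f -> is_cmap g -> is_cmap (fun i => f i \o g i)%VF.
Proof.
move=> [hf cf] [hg cg]; split=> [i|i j]; first exact: hom_comp.
by rewrite comp_lfunA cf -!comp_lfunA cg.
Qed.

Lemma cmap_add C D (f g : forall i, 'Hom(C i, D i)) :
  is_cmap f -> is_cmap g -> is_cmap (fun i => f i + g i).
Proof.
move=> [hf cf] [hg cg]; split=> [i|i j]; first exact: hom_add.
by rewrite comp_lfunDr comp_lfunDl cf cg.
Qed.

Lemma cmap_opp C D (f : forall i, 'Hom(C i, D i)) :
  is_cmap f -> is_cmap (fun i => - f i).
Proof.
move=> [hf cf]; split=> [i|i j]; first exact: hom_opp.
by rewrite comp_lfunNl comp_lfunNr cf.
Qed.

Lemma cmap_sum C D (I : finType) (f : I -> forall i, 'Hom(C i, D i)) :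
  (forall k, is_cmap (f k)) -> is_cmap (fun i => \sum_k f k i).
Proof.
move=> cf; split=> [i|i j]; first by apply: hom_sum => k; case: (cf k).
apply/lfunP => x; rewrite !comp_lfunE !sum_lfunE linear_sum; apply: eq_bigr => k _ /=.
by rewrite -!comp_lfunE (cf k).2.
Qed.

Lemma homotopic_eq C D (f g : forall i, 'Hom(C i, D i)) :
  (forall i, f i = g i) -> homotopic f g.
Proof.
move=> fg; exists (fun i j => 0) => [i j|i]; first exact: hom_0.
by rewrite fg subrr comp_lfun0r comp_lfun0l addr0.
Qed.

Lemma nu_cmap C D (f : forall i, 'Hom(C i, D i)) :
  is_cmap f -> @is_cmap _ _ (nu_cpx C) (nu_cpx D) (fun i => nu_map (f i)).
Proof.
move=> [hf cf]; split=> [i|i j]; first exact: nu_map_hom.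
by rewrite /= -!nu_map_comp ?cf//; exact: cd_hom.
Qed.

Lemma nu_homotopic C D (f g : forall i, 'Hom(C i, D i)) : homotopic f g ->
  @homotopic _ _ (nu_cpx C) (nu_cpx D) (fun i => nu_map (f i)) (fun i => nu_map (g i)).
Proof.
move=> [h hh e]; exists (fun i j => nu_map (h i j)) => [i j|i].
  exact: nu_map_hom.
rewrite -nu_mapB e nu_mapD /= !nu_map_comp//; exact: cd_hom.
Qed.

(** ** Cohomology as a functor *)

Section Cohomology.
Variable i : int.

Definition cycles C : submod (C i) := gensub [set x : C i | cd C i (i + 1) x = 0].

Lemma mem_cycles C x : x \in svs (cycles C) <-> cd C i (i + 1) x = 0.
Proof.
rewrite mem_gensub //; first split=> [|k y z /= yC zC]; first exact: linear0.
- by rewrite linearP /= yC zC scaler0 addr0.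
- by move=> a y /=; rewrite cd_hom => ->; rewrite linear0.
Qed.

Lemma mem_boundaries C x :
  x \in svs (gensub [set cd C (i - 1) i y | y in [set: C (i - 1)]]) <->
  exists y, cd C (i - 1) i y = x.
Proof.
rewrite mem_gensub; first by split=> [[y _ <-]|[y <-]]; exists y.
  split=> [|k _ _ [y _ <-] [z _ <-]]; first by exists 0 => //; rewrite linear0.
  by exists (k *: y + z) => //; rewrite linearP.
by move=> a _ [y _ <-]; exists (ract _ a y) => //; rewrite cd_hom.
Qed.

(** The class map is extended linearly to all elements, and [crep] is a linear
    choice of representatives; this makes [hmap] additive by definition. *)
Definition boundaries C : submod (subm (cycles C)) :=
  gensub [set x : subm (cycles C) |
    vsval x \in svs (gensub [set cd C (i - 1) i y | y in [set: C (i - 1)]])].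
Definition zcls C : 'Hom(C i, cohomology C i) :=
  ((quo_prj (boundaries C) : 'Hom(subm (cycles C), cohomology C i)) \o
   (sub_ret (cycles C) : 'Hom(C i, subm (cycles C))))%VF.
Definition crep C : 'Hom(cohomology C i, C i) :=
  ((sub_inj (cycles C) : 'Hom(subm (cycles C), C i)) \o
   (quo_lift (boundaries C) : 'Hom(cohomology C i, subm (cycles C))))%VF.

Lemma crep_cycle C h : cd C i (i + 1) (crep C h) = 0.
Proof. by apply/mem_cycles; rewrite comp_lfunE sub_inj_in. Qed.

Lemma crepK C h : zcls C (crep C h) = h.
Proof.
rewrite (comp_lfunE _ (sub_ret _)) (comp_lfunE _ (quo_lift _)).
set z := quo_lift _ h; rewrite (_ : sub_ret _ _ = z); first exact: quo_liftK.
by apply: (@sub_inj_inj _ _ _ (cycles C)); rewrite sub_retK ?sub_inj_in.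
Qed.

Lemma zcls_eq0 C x : cd C i (i + 1) x = 0 ->
  zcls C x = 0 <-> exists y, cd C (i - 1) i y = x.
Proof.
move=> /mem_cycles xZ; rewrite comp_lfunE -mem_boundaries.
apply: iff_trans (quo_eq0 _ _) _; apply: iff_trans (mem_gensub _ _ _) _.
- by split=> /= [|k y z yC zC]; rewrite ?mem0v// rpredD ?rpredZ.
- move=> a y; rewrite /mkset -!sub_injE sub_actE => yC.
  exact: svs_stable.
by rewrite /mkset -sub_injE sub_retK.
Qed.

Lemma zcls_act C a x : cd C i (i + 1) x = 0 ->
  zcls C (ract _ a x) = ract _ a (zcls C x).
Proof.
move=> /mem_cycles xZ.
have zE z : zcls C z = quo_prj (boundaries C) (sub_ret (cycles C) z) by rewrite comp_lfunE.
rewrite !zE; pose y : subm (cycles C) := sub_ret (cycles C) x.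
transitivity (quo_prj (boundaries C) (ract (subm (cycles C)) a y)); last first.
  exact: (quo_epi (boundaries C)).1.
congr (fun_of_lfun _ _).
apply: (@sub_inj_inj _ _ _ (cycles C)).
by rewrite sub_actE !sub_retK//; exact: svs_stable.
Qed.

Lemma crep_zcls C x : cd C i (i + 1) x = 0 ->
  exists y, crep C (zcls C x) - x = cd C (i - 1) i y.
Proof.
move=> xZ; have [|+ _] := @zcls_eq0 C (crep C (zcls C x) - x).
  by rewrite lfunB crep_cycle xZ subrr.
rewrite lfunB crepK subrr => /(_ erefl)[y <-]; by exists y.
Qed.

Definition hmap C D (f : 'Hom(C i, D i)) : 'Hom(cohomology C i, cohomology D i) :=
  (zcls D \o (f \o crep C))%VF.

Lemma hmapE C D (f : forall k, 'Hom(C k, D k)) x : is_cmap f ->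
  cd C i (i + 1) x = 0 -> hmap (f i) (zcls C x) = zcls D (f i x).
Proof.
move=> [hf cf] xZ; rewrite (comp_lfunE (zcls D)) comp_lfunE.
have [y e] := crep_zcls xZ; apply/eqP; rewrite -subr_eq0 -!lfunB e.
apply/eqP/zcls_eq0; last by exists (f (i - 1) y); rewrite -!comp_lfunE cf.
by rewrite -!comp_lfunE cf -comp_lfunA cd_cd comp_lfun0r zero_lfunE.
Qed.

Lemma cls_ind C (Q : cohomology C i -> Prop) :
  (forall x, cd C i (i + 1) x = 0 -> Q (zcls C x)) -> forall h, Q h.
Proof. by move=> Qx h; rewrite -(crepK h); apply: Qx; exact: crep_cycle. Qed.

Lemma cmap_cycle C D (f : forall k, 'Hom(C k, D k)) x : is_cmap f ->
  cd C i (i + 1) x = 0 -> cd D i (i + 1) (f i x) = 0.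
Proof. by move=> [_ cf] xZ; rewrite -comp_lfunE cf comp_lfunE xZ linear0. Qed.

Lemma hmap_hom C D (f : forall k, 'Hom(C k, D k)) : is_cmap f -> is_hom (hmap (f i)).
Proof.
move=> cf a; apply: cls_ind => x xZ.
rewrite -zcls_act// hmapE//; last by rewrite cd_hom xZ linear0.
by rewrite hmapE// cf.1 zcls_act//; exact: cmap_cycle.
Qed.

Lemma hmap_id C : hmap (\1%VF : 'Hom(C i, C i)) = \1%VF.
Proof.
apply/lfunP => h; rewrite (comp_lfunE (zcls C)) (comp_lfunE \1%VF) !id_lfunE.
exact: crepK.
Qed.

Lemma hmap_comp C D E (f : forall k, 'Hom(D k, E k)) (g : forall k, 'Hom(C k, D k)) :
  is_cmap f -> is_cmap g -> hmap (f i \o g i)%VF = (hmap (f i) \o hmap (g i))%VF.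
Proof.
move=> cf cg; apply/lfunP; apply: cls_ind => x xZ; rewrite (comp_lfunE (hmap _)).
rewrite (hmapE (cmap_comp cf cg))// hmapE// hmapE ?comp_lfunE//.
exact: cmap_cycle.
Qed.

Lemma hmap_add C D (f g : 'Hom(C i, D i)) : hmap (f + g) = hmap f + hmap g.
Proof. by rewrite /hmap comp_lfunDl comp_lfunDr. Qed.

Lemma hmap0 C D : hmap (0 : 'Hom(C i, D i)) = 0.
Proof. by rewrite /hmap comp_lfun0l comp_lfun0r. Qed.

Lemma hmap_sum C D (I : finType) (f : I -> 'Hom(C i, D i)) :
  hmap (\sum_k f k) = \sum_k hmap (f k).
Proof. by apply: (big_morph (@hmap C D) (@hmap_add C D)); exact: hmap0. Qed.

Lemma hmap_homotopic C D (f g : forall k, 'Hom(C k, D k)) :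
  is_cmap f -> is_cmap g -> homotopic f g -> hmap (f i) = hmap (g i).
Proof.
move=> cf cg [h hh e]; apply/lfunP; apply: cls_ind => x xZ; rewrite !hmapE//.
apply/eqP; rewrite -subr_eq0 -lfunB.
have -> : f i x - g i x = cd D (i - 1) i (h i (i - 1) x).
  rewrite -[LHS](_ : (f i - g i) x = _); last by rewrite add_lfunE opp_lfunE.
  by rewrite e add_lfunE !comp_lfunE xZ linear0 addr0.
apply/eqP/zcls_eq0; last by eexists.
rewrite -comp_lfunE.
have := cd_cd D (i - 1) i (i + 1) => ->.
by rewrite zero_lfunE.
Qed.

End Cohomology.

(** ** Additive homotopy invariants *)

(** What H^0 and H^{-1} after the Nakayama functor have in common *)
Record hfunctor := HFunctor {
  ho : cpx A -> rmod A;
  hm : forall C D, (forall i, 'Hom(C i, D i)) -> 'Hom(ho C, ho D);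
  hm_hom : forall C D (f : forall i, 'Hom(C i, D i)), is_cmap f -> is_hom (hm f);
  hm_id : forall C, hm (@cident K A C) = \1%VF;
  hm_comp : forall C D E (f : forall i, 'Hom(D i, E i)) (g : forall i, 'Hom(C i, D i)),
    is_cmap f -> is_cmap g -> hm (fun i => f i \o g i)%VF = (hm f \o hm g)%VF;
  hm_sum : forall C D (I : finType) (f : I -> forall i, 'Hom(C i, D i)),
    hm (fun i => \sum_k f k i) = \sum_k hm (f k);
  hm_add : forall C D (f g : forall i, 'Hom(C i, D i)),
    hm (fun i => f i + g i) = hm f + hm g;
  hm0 : forall C D, hm (@Defs.czero K A C D) = 0;
  hm_homotopic : forall C D (f g : forall i, 'Hom(C i, D i)),
    is_cmap f -> is_cmap g -> homotopic f g -> hm f = hm g }.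

Definition H0 : hfunctor.
Proof.
refine (@HFunctor (fun C => cohomology C 0) (fun C D f => hmap (f 0)) _ _ _ _ _ _ _).
- by move=> C D f; exact: hmap_hom.
- by move=> C; exact: hmap_id.
- by move=> C D E f g; exact: hmap_comp.
- by move=> C D I f; exact: hmap_sum.
- by move=> C D f g; exact: hmap_add.
- by move=> C D; exact: hmap0.
- by move=> C D f g; exact: hmap_homotopic.
Defined.

Definition Hnu : hfunctor.
Proof.
refine (@HFunctor (fun C => cohomology (nu_cpx C) (-1))
  (fun C D f => @hmap _ (nu_cpx C) (nu_cpx D) (nu_map (f (-1)))) _ _ _ _ _ _ _).
- by move=> C D f cf; exact: (@hmap_hom (-1) _ _ _ (nu_cmap cf)).
- by move=> C; rewrite /cident nu_map1; exact: hmap_id.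
- move=> C D E f g cf cg; rewrite (nu_map_comp (cf.1 (-1)) (cg.1 (-1))).
  exact: (@hmap_comp (-1) _ _ _ _ _ (nu_cmap cf) (nu_cmap cg)).
- by move=> C D I f; rewrite nu_map_sum; exact: hmap_sum.
- by move=> C D f g; rewrite nu_mapD; exact: hmap_add.
- by move=> C D; rewrite /czero nu_map0; exact: hmap0.
- move=> C D f g cf cg h.
  exact: (@hmap_homotopic (-1) _ _ _ _ (nu_cmap cf) (nu_cmap cg) (nu_homotopic h)).
Defined.

Section Functor.
Variable T : hfunctor.

Lemma functor_dsum (I : finType) C (C_ : I -> cpx A) :
  is_kdsum C C_ -> is_dsum (ho T C) (fun i => ho T (C_ i)).
Proof.
move=> [inj [prj [c pi1 pi0 s1]]].
have ci i := (c i).1; have cp i := (c i).2.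
exists (fun i => hm T (inj i)), (fun i => hm T (prj i)); split.
- by move=> i; split; exact: hm_hom.
- move=> i; rewrite -hm_comp// -hm_id; apply: hm_homotopic => //.
    exact: cmap_comp.
  exact: cmap_id.
- move=> i j ij; rewrite -hm_comp// -hm0; apply: hm_homotopic; last exact: pi0.
    exact: cmap_comp.
  exact: cmap_zero.
- transitivity (hm T (fun k => \sum_i (inj i k \o prj i k)%VF)).
    by rewrite hm_sum; apply: eq_bigr => i _; rewrite hm_comp.
  rewrite -hm_id; apply: hm_homotopic => //; last exact: cmap_id.
  by apply: cmap_sum => k; exact: cmap_comp.
Qed.

Definition full_on C : Prop := forall f : 'Hom(ho T C, ho T C), is_hom f ->
  exists2 g : forall i, 'Hom(C i, C i), is_cmap g & hm T g = f.

(** Conjugating an endomorphism by a retraction turns it into one of the larger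
    complex. *)
Lemma full_on_retract C D (a : forall i, 'Hom(C i, D i)) (b : forall i, 'Hom(D i, C i)) :
  is_cmap a -> is_cmap b -> (hm T b \o hm T a)%VF = \1%VF ->
  full_on D -> full_on C.
Proof.
move=> ca cb ba fD f hf.
have [|g cg ge] := fD (hm T a \o (f \o hm T b))%VF.
  by apply: hom_comp; [exact: hm_hom | apply: hom_comp => //; exact: hm_hom].
exists (fun i => b i \o (g i \o a i))%VF.
  by apply: cmap_comp => //; exact: cmap_comp.
rewrite (hm_comp _ cb (cmap_comp cg ca)) (hm_comp _ cg ca) ge.
by rewrite -!comp_lfunA ba comp_lfun1r comp_lfunA ba comp_lfun1l.
Qed.

(** The complex of the images of an idempotent chain map; it serves to test
    indecomposability against such maps. *)
Section Splitting.
Variables (C : cpx A) (e : forall i, 'Hom(C i, C i)).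
Hypotheses (ce : is_cmap e) (ee : forall i, (e i \o e i)%VF = e i).

Let Im i : submod (C i) := SubMod (img_stable (ce.1 i)).

Lemma mem_Im i x : x \in svs (Im i) <-> e i x = x.
Proof.
split=> [/memv_imgP[y _ ->]|<-]; first by rewrite -comp_lfunE ee.
by rewrite memv_img ?memvf.
Qed.

Definition spl_d i j : 'Hom(subm (Im i), subm (Im j)) :=
  (sub_ret (Im j) \o (cd C i j \o sub_inj (Im i)))%VF.

Lemma spl_dE i j x : sub_inj (Im j) (spl_d i j x) = cd C i j (sub_inj (Im i) x).
Proof.
rewrite !comp_lfunE sub_retK//; apply/mem_Im.
rewrite -(comp_lfunE (e j)) -ce.2 comp_lfunE; congr (cd C i j _).
exact/mem_Im/sub_inj_in.
Qed.

Fact spl_hom i j : is_hom (spl_d i j).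
Proof.
move=> a x; apply: (@sub_inj_inj _ _ _ (Im j)).
rewrite spl_dE ((sub_mono (Im i)).1 a x) cd_hom -spl_dE.
exact/esym/(sub_mono (Im j)).1.
Qed.

Fact spl_shape i j : j != i + 1 -> spl_d i j = 0.
Proof. by move=> ij; rewrite /spl_d cd_shape// comp_lfun0l comp_lfun0r. Qed.

Fact spl_dd i j k : (spl_d j k \o spl_d i j)%VF = 0.
Proof.
apply/lfunP => x; apply: (@sub_inj_inj _ _ _ (Im k)).
by rewrite comp_lfunE !spl_dE -comp_lfunE cd_cd !zero_lfunE linear0.
Qed.

Definition spl : cpx A := Cpx spl_hom spl_shape spl_dd.

Definition spl_inj i : 'Hom(spl i, C i) := sub_inj (Im i).
Definition spl_prj i : 'Hom(C i, spl i) := (sub_ret (Im i) \o e i)%VF.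

Lemma spl_prjE i x : spl_inj i (spl_prj i x) = e i x.
Proof. by rewrite comp_lfunE sub_retK//= memv_img ?memvf. Qed.

Lemma spl_injK i : (spl_prj i \o spl_inj i)%VF = \1%VF.
Proof.
apply/lfunP => x; apply: (@sub_inj_inj _ _ _ (Im i)).
rewrite comp_lfunE [LHS]spl_prjE id_lfunE.
exact/mem_Im/sub_inj_in.
Qed.

Lemma spl_e i : (spl_inj i \o spl_prj i)%VF = e i.
Proof. by apply/lfunP => x; rewrite comp_lfunE spl_prjE. Qed.

Lemma spl_inj_cmap : is_cmap spl_inj.
Proof.
split=> [i|i j]; first exact: (sub_mono (Im i)).1.
apply/lfunP => x; rewrite [LHS]comp_lfunE [RHS]comp_lfunE.
exact/esym/spl_dE.
Qed.

Lemma spl_prj_cmap : is_cmap spl_prj.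
Proof.
split=> [i a x|i j]; last apply/lfunP => x; apply: (@sub_inj_inj _ _ _ (Im _)).
  rewrite [LHS]spl_prjE ce.1 -spl_prjE.
  exact/esym/(sub_mono (Im i)).1.
transitivity (cd C i j (e i x)).
  transitivity (sub_inj (Im j) (spl_d i j (spl_prj i x))).
    by congr (fun_of_lfun _ _); exact: comp_lfunE.
  refine (etrans (@spl_dE i j (spl_prj i x)) _); congr (cd C i j _).
  exact: spl_prjE.
rewrite -comp_lfunE ce.2 comp_lfunE.
transitivity (spl_inj j (spl_prj j (cd C i j x))); first by rewrite spl_prjE.
by congr (fun_of_lfun _ _); exact/esym/comp_lfunE.
Qed.

Lemma spl_Kbproj : in_Kbproj C -> in_Kbproj spl.
Proof.
move=> [pC [N zC]]; split=> [i|].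
  exact: projective_summand (pC i) (spl_inj_cmap.1 i) (spl_prj_cmap.1 i) (spl_injK i).
by exists N => i /zC; apply: rzero_mono; exact: sub_mono.
Qed.

Lemma spl_zero : Defs.kzero spl -> hm T e = 0.
Proof.
move=> z0; have e0 : hm T (@cident _ _ spl) = 0.
  by rewrite -(hm0 T); apply: hm_homotopic => //; [exact: cmap_id | exact: cmap_zero].
have -> : hm T e = (hm T spl_inj \o hm T spl_prj)%VF.
  rewrite -(hm_comp _ spl_inj_cmap spl_prj_cmap).
  apply: hm_homotopic => //; first exact: cmap_comp spl_inj_cmap spl_prj_cmap.
  by apply: homotopic_eq => i; rewrite spl_e.
by rewrite -(comp_lfun1r (hm T spl_inj)) -hm_id e0 comp_lfun0r comp_lfun0l.
Qed.

End Splitting.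

Lemma indecomposable_idempotent C (e : forall i, 'Hom(C i, C i)) :
  in_Kbproj C -> kindecomposable C -> is_cmap e ->
  (forall i, (e i \o e i)%VF = e i) ->
  hm T e = 0 \/ hm T (fun i => \1%VF - e i) = 0.
Proof.
move=> kC [_ iC] ce ee; pose e' i : 'Hom(C i, C i) := \1%VF - e i.
have ce' : is_cmap e' by apply: cmap_add; [exact: cmap_id | exact: cmap_opp].
have ee' i : (e' i \o e' i)%VF = e' i.
  rewrite /e' comp_lfunDl comp_lfun1l comp_lfunNl comp_lfunDr comp_lfun1r.
  by rewrite comp_lfunNr ee subrr subr0.
have e0 i : (e' i \o e i)%VF = 0.
  by rewrite /e' comp_lfunDl comp_lfun1l comp_lfunNl ee subrr.
have e0' i : (e i \o e' i)%VF = 0.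
  by rewrite /e' comp_lfunDr comp_lfun1r comp_lfunNr ee subrr.
pose E b := if b then e else e'.
have cE b : is_cmap (E b) by case: b.
have EE b i : (E b i \o E b i)%VF = E b i by case: b.
have EN b b' i : b != b' -> (E b' i \o E b i)%VF = 0 by case: b; case: b'.
have [||b zb] := iC (fun b => spl (cE b) (EE b)).
- by move=> b; exact: spl_Kbproj.
- exists (fun b => spl_inj (cE b) (EE b)), (fun b => spl_prj (cE b) (EE b)); split.
  + by move=> b; split; [exact: spl_inj_cmap | exact: spl_prj_cmap].
  + by move=> b; apply: homotopic_eq => i; exact: spl_injK.
  + move=> b b' bb'; apply: homotopic_eq => i; apply/lfunP => x.
    apply: (@sub_inj_inj _ _ _ (SubMod (img_stable ((cE b').1 i)))).
    rewrite zero_lfunE linear0 comp_lfunE [LHS]spl_prjE.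
    have [+ _] := mem_Im (cE b) (EE b) (spl_inj (cE b) (EE b) i x).
    by move=> <-; rewrite ?sub_inj_in// -comp_lfunE EN// zero_lfunE.
  + by apply: homotopic_eq => i; rewrite big_bool /= !spl_e /e' addrC subrK.
by case: b zb => /spl_zero; [left | right].
Qed.

Lemma iter_ker_stable (V : vectType K) (f : nat -> 'End(V)) :
  (forall k, f k.+1 = (f 0%N \o f k)%VF) ->
  exists k0, forall k, (k0 <= k)%N -> lker (f k) = lker (f k0).
Proof.
move=> fS; have mono k : (lker (f k) <= lker (f k.+1))%VS.
  apply/subvP => x; rewrite !memv_ker fS comp_lfunE => /eqP->.
  by rewrite linear0.
pose good d := `[< exists k, \dim (lker (f k)) = d >].
have ex : exists d, good d by exists (\dim (lker (f 0%N))); apply/asboolP; exists 0%N.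
have ub d : good d -> (d <= \dim {: V})%N.
  by move=> /asboolP[k <-]; rewrite dimvS ?subvf.
case: (ex_maxnP ex ub) => d /asboolP[k0 dk0] dmax; exists k0 => k kk0.
apply/esym/eqP; rewrite eqEdim; apply/andP; split; last first.
  by rewrite dk0; apply: dmax; apply/asboolP; exists k.
rewrite -(subnK kk0); elim: (k - k0)%N => [|m IH]; first exact: subvv.
exact: subv_trans IH (mono _).
Qed.

(** Fitting's lemma at the level of complexes: for a high power g of f the
    projection e onto the image of g along the kernel of g is a chain map, and
    g + (1 - e) is an isomorphism of complexes.  Indecomposability forces the
    invariant of e or of 1 - e to vanish, so that f becomes nilpotent or
    invertible. *)
Lemma indecomposable_endo C (f : forall i, 'Hom(C i, C i)) :
  in_Kbproj C -> kindecomposable C -> is_cmap f ->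
  is_iso (hm T f) \/ is_iso (\1%VF - hm T f).
Proof.
move=> kC iC cf.
pose F := fix F k i : 'Hom(C i, C i) := if k is k'.+1 then (f i \o F k' i)%VF else f i.
have cF k : is_cmap (F k) by elim: k => //= k IH; exact: cmap_comp.
have FD k l i : (F k i \o F l i)%VF = F (k + l).+1 i.
  by elim: k => [//|k IH]; rewrite /= -comp_lfunA IH.
have Fc k i : (F k i \o f i)%VF = F k.+1 i.
  by have := FD k 0%N i; rewrite addn0.
have [kk hkk] := choice (fun i => @iter_ker_stable (C i) (fun k => F k i) (fun k => erefl)).
have [_ [B zC]] := kC.
pose N := (\sum_(j < B.+1) (kk j + kk (- j%:Z)))%N.
pose g := F N; have cg : is_cmap g by exact: cF.
have kerg i x : g i (g i x) = 0 -> g i x = 0.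
  have [iB|iB] := ltnP B `|i|%N.
    by move=> _; rewrite (hom_from0 (g i) (zC i iB)) zero_lfunE.
  have kN : (kk i <= N)%N.
    pose j := Ordinal (iB : `|i| < B.+1)%N.
    rewrite /N (bigD1 j)//= (leq_trans _ (leq_addr _ _))//.
    by case: (i) => [k|k] /=; rewrite ?leq_addr// NegzE leq_addl.
  rewrite -comp_lfunE /g FD => gx.
  have : x \in lker (F (N + N).+1 i) by rewrite memv_ker gx.
  rewrite hkk; last by rewrite (leq_trans kN)// -addnS leq_addr.
  by rewrite -(hkk i N)// memv_ker => /eqP.
have cap0 i : (limg (g i) :&: lker (g i) = 0)%VS.
  apply/eqP; rewrite -subv0; apply/subvP => x; rewrite memv_cap memv0 memv_ker.
  by move=> /andP[/memv_imgP[y _ ->] /eqP/kerg->].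
have full i : (limg (g i) + lker (g i) = fullv)%VS.
  apply/eqP; rewrite eqEdim subvf dimv_disjoint_sum ?cap0//.
  by rewrite -(limg_ker_dim (g i) fullv) capfv addnC leqnn.
pose e i : 'Hom(C i, C i) := daddv_pi (limg (g i)) (lker (g i)).
have eimg i x : e i x \in limg (g i) by exact: memv_pi.
have eker i x : g i (x - e i x) = 0.
  have xin : x \in (limg (g i) + lker (g i))%VS by rewrite full memvf.
  have := daddv_pi_add (cap0 i) xin; rewrite -[daddv_pi _ _ x]/(e i x) => {1}<-.
  by rewrite addrC addKr; apply/eqP; rewrite -memv_ker memv_pi.
have euniq i x y : y \in limg (g i) -> g i (x - y) = 0 -> e i x = y.
  move=> yI gxy; apply/eqP; rewrite -subr_eq0 -memv0 -(cap0 i) memv_cap rpredB ?eimg//.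
  rewrite memv_ker (_ : e i x - y = (x - y) - (x - e i x)); last first.
    by rewrite opprB [RHS]addrC addrA subrK.
  by rewrite lfunB gxy eker subrr eqxx.
have ecomm i j (u : 'Hom(C i, C j)) :
    (u \o g i)%VF = (g j \o u)%VF -> forall x, e j (u x) = u (e i x).
  move=> ug x; apply: euniq.
    have /memv_imgP[y _ ->] := eimg i x.
    by rewrite -comp_lfunE ug comp_lfunE memv_img ?memvf.
  by rewrite -lfunB -comp_lfunE -ug comp_lfunE eker linear0.
have ce : is_cmap e.
  split=> [i a x|i j]; last by apply/lfunP => x; rewrite !comp_lfunE ecomm// cg.2.
  by rewrite ecomm//; apply/lfunP => y; rewrite !comp_lfunE cg.1.
have ee i : (e i \o e i)%VF = e i.
  by apply/lfunP => x; rewrite comp_lfunE; apply: euniq; rewrite ?eimg// subrr linear0.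
have hgf k y : hm T f y = y -> hm T (F k) y = y.
  by move=> fy; elim: k => // k IH; rewrite /= hm_comp// comp_lfunE IH.
have hgf0 y : hm T f y = 0 -> hm T g y = 0.
  move=> fy; have [k|] : N = 0%N \/ exists k, N = k.+1 by case: (N) => [|k]; [left|right; exists k].
    by rewrite /g k.
  move=> [k Nk]; have -> : hm T g = hm T (fun i => F k i \o f i)%VF.
    apply: hm_homotopic => //; first exact: cmap_comp.
    by apply: homotopic_eq => i; rewrite Fc /g Nk.
  by rewrite hm_comp// comp_lfunE fy linear0.
have [he|he] := indecomposable_idempotent kC iC ce ee.
  have hg0 : hm T g = 0.
    have -> : hm T g = (hm T e \o hm T g)%VF.
      rewrite -hm_comp//; apply: hm_homotopic => //; first exact: cmap_comp.
      apply: homotopic_eq => i; apply/lfunP => x; rewrite comp_lfunE; apply/esym.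
      by apply: euniq; rewrite ?memv_img ?memvf// subrr linear0.
    by rewrite he comp_lfun0l.
  right; apply: mono_endo_iso; apply: monoI.
    by apply: hom_sub; [exact: hom_id | exact: hm_hom].
  move=> y; rewrite add_lfunE opp_lfunE id_lfunE => /eqP; rewrite subr_eq0 => /eqP fy.
  by rewrite -[y](hgf N) -/g ?hg0 ?zero_lfunE.
left; pose v i : 'Hom(C i, C i) := g i + (\1%VF - e i).
have cv : is_cmap v.
  by apply: cmap_add => //; apply: cmap_add; [exact: cmap_id | exact: cmap_opp].
have vinj i : mono (v i).
  apply: monoI => [|x]; first exact: cv.1.
  rewrite !add_lfunE opp_lfunE id_lfunE => vx.
  have gx : g i x = 0.
    apply: kerg; have : g i (g i x + (x - e i x)) = 0 by rewrite vx linear0.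
    by rewrite lfunD eker addr0.
  move: vx; rewrite gx add0r => /eqP; rewrite subr_eq0 => /eqP xe.
  apply/eqP; rewrite -memv0 -(cap0 i) memv_cap memv_ker gx eqxx andbT.
  by rewrite xe eimg.
have viso i := mono_endo_iso (vinj i).
pose w i := sval (cid (iso_sym (viso i))).
have hw i : [/\ is_iso (w i), (w i \o v i)%VF = \1%VF & (v i \o w i)%VF = \1%VF].
  exact: (svalP (cid (iso_sym (viso i)))).
have cw : is_cmap w.
  split=> [i|i j]; first by have [[]] := hw i.
  have [_ wv _] := hw j; have [_ _ vw] := hw i.
  rewrite -(comp_lfun1l (_ \o _)%VF) -wv -!comp_lfunA (comp_lfunA (v j)) -cv.2.
  by rewrite -!comp_lfunA vw comp_lfun1r.
have hvg : hm T v = hm T g by rewrite hm_add he addr0.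
apply: mono_endo_iso; apply: monoI => [|y fy]; first exact: hm_hom.
have <- : (hm T w \o hm T v)%VF y = y.
  rewrite -hm_comp// -[RHS](id_lfunE y) -hm_id; congr (fun_of_lfun _ y).
  apply: hm_homotopic => //; [exact: cmap_comp | exact: cmap_id|].
  by apply: homotopic_eq => i; have [] := hw i.
by rewrite comp_lfunE hvg hgf0// linear0.
Qed.

End Functor.
End ChainMaps.
(** * Two-term presilting complexes *)

Section TwoTerm.
Variables (K : fieldType) (A : falgType K).
Implicit Types (C D : cpx A).

Lemma kisom_functor (T : hfunctor A) C D : kisom C D ->
  exists (f : forall i, 'Hom(C i, D i)) (g : forall i, 'Hom(D i, C i)),
    [/\ is_cmap f, is_cmap g, (hm T g \o hm T f)%VF = \1%VF
      & (hm T f \o hm T g)%VF = \1%VF].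
Proof.
move=> [f [g [cf cg gf fg]]]; exists f, g; split=> //.
  rewrite -hm_comp// -hm_id; apply: hm_homotopic => //; last exact: cmap_id.
  exact: cmap_comp.
rewrite -hm_comp// -hm_id; apply: hm_homotopic => //; last exact: cmap_id.
exact: cmap_comp.
Qed.

Lemma comp_lfun_ext (V W W' X : vectType K) (f : 'Hom(W, X)) (g : 'Hom(V, W))
    (f' : 'Hom(W', X)) (g' : 'Hom(V, W')) :
  (f \o g)%VF = (f' \o g')%VF -> forall x, f (g x) = f' (g' x).
Proof. by move=> e x; rewrite -!comp_lfunE e. Qed.

Section Concentrated.
Variable D : cpx A.
Hypothesis pD : forall i, projective (D i).
Hypothesis zD : forall i : int, i != -1 -> i != 0 -> rzero (D i).

Let d : 'Hom(D (-1), D 0) := cd D (-1) 0.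

Lemma top_cycle x : cd D 0 (0 + 1) x = 0.
Proof. by rewrite (hom_to0 (cd D 0 (0 + 1))) ?zero_lfunE//; exact: zD. Qed.

Definition top_class : 'Hom(D 0, cohomology D 0) := zcls 0 D.

Lemma top_class_epi : epi top_class.
Proof.
apply: epiI => [a x|h]; first exact: zcls_act (top_cycle x).
by exists (crep 0 D h); exact: crepK.
Qed.

Lemma top_class_ker x : top_class x = 0 <-> exists y, d y = x.
Proof. exact: zcls_eq0 (top_cycle x). Qed.

Definition bottom_cycle : 'Hom(cohomology (nu_cpx D) (-1), nu (D (-1))) :=
  @crep _ _ (-1) (nu_cpx D).

(** The term in degree -2 vanishes, so that the lowest cohomology consists of
    cycles. *)
Lemma bottom_boundary (y : nu_cpx D (-1 - 1)) : cd (nu_cpx D) (-1 - 1) (-1) y = 0.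
Proof.
by rewrite (hom_from0 (cd (nu_cpx D) (-1 - 1) (-1))) ?zero_lfunE//; exact/nu_rzero/zD.
Qed.

Lemma bottom_repr (x : nu_cpx D (-1)) : cd (nu_cpx D) (-1) (-1 + 1) x = 0 ->
  bottom_cycle (zcls (-1) (nu_cpx D) x) = x.
Proof.
move=> xZ; have [y e] := crep_zcls xZ.
by apply/eqP; rewrite -subr_eq0; apply/eqP; apply: etrans e _; exact: bottom_boundary.
Qed.

Lemma bottom_cycle_mono : mono bottom_cycle.
Proof.
apply: monoI => [a h|h h0]; last first.
  by rewrite -(crepK h) -/bottom_cycle h0 linear0.
have hZ := crep_cycle h.
rewrite -{1}(crepK h) -zcls_act// bottom_repr//.
by rewrite cd_hom hZ linear0.
Qed.

Lemma bottom_cycle_img v : nu_map d v = 0 <-> exists h, bottom_cycle h = v.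
Proof.
split=> [v0|[h <-]]; last exact: (crep_cycle h).
by exists (zcls (-1) (nu_cpx D) v); exact: bottom_repr.
Qed.

(** Matching on the constructors of the degree gives the components f1 and f0 the
    types End(D^{-1}) and End(D^0) without a transport. *)
Definition two_term_map (f1 : 'Hom(D (-1), D (-1))) (f0 : 'Hom(D 0, D 0)) (i : int) :
    'Hom(D i, D i) :=
  match i with Posz 0 => f0 | Negz 0 => f1 | _ => 0 end.

Lemma two_term_cmap f1 f0 : is_hom f1 -> is_hom f0 ->
  (d \o f1)%VF = (f0 \o d)%VF -> is_cmap (two_term_map f1 f0).
Proof.
move=> h1 h0 c; split=> [[[|i]|[|i]]|i j] //=; try exact: hom_0.
have [->|ji] := eqVneq j (i + 1); last by rewrite cd_shape// comp_lfun0l comp_lfun0r.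
have [->|i1] := eqVneq i (-1); first exact: c.
have [i0|i0] := eqVneq i 0; last first.
  by rewrite (hom_from0 (_ \o _)%VF (zD i1 i0)) (hom_from0 (_ \o _)%VF (zD i1 i0)).
have z1 : rzero (D (i + 1)) by rewrite i0; exact: zD.
by rewrite (hom_to0 (_ \o _)%VF z1) (hom_to0 (_ \o _)%VF z1).
Qed.

Lemma full_on_H0 : full_on (H0 A) D.
Proof.
move=> f hf; have [f1 [f0 [h1 h0 c e]]] :=
  lift_endo_coker (@pD (-1)) (@pD 0) (@cd_hom _ _ D (-1) 0) top_class_epi top_class_ker hf.
have cF := two_term_cmap h1 h0 c.
exists (two_term_map f1 f0) => //; apply/lfunP; apply: cls_ind => x xZ.
refine (etrans (hmapE cF xZ) _); exact: comp_lfun_ext e x.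
Qed.

Lemma full_on_Hnu : full_on (Hnu A) D.
Proof.
move=> f hf; have [f1 [f0 [h1 h0 c e]]] :=
  lift_endo_ker (@pD (-1)) (@pD 0) (@cd_hom _ _ D (-1) 0)
    bottom_cycle_mono bottom_cycle_img hf.
have cF := two_term_cmap h1 h0 c.
exists (two_term_map f1 f0) => //; apply/lfunP; apply: cls_ind => x xZ.
refine (etrans (hmapE (nu_cmap cF) xZ) _).
apply: (mono_inj bottom_cycle_mono).
refine (etrans (bottom_repr (cmap_cycle (nu_cmap cF) xZ)) _).
refine (etrans _ (comp_lfun_ext e (zcls (-1) (nu_cpx D) x))).
by congr (fun_of_lfun _ _); exact/esym/bottom_repr.
Qed.

Definition shift_map (f : 'Hom(D (-1), D 0)) (i : int) : 'Hom(D i, Defs.shift D 1 i) :=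
  match i with Negz 0 => f | _ => 0 end.

Lemma shift_cmap f : is_hom f -> is_cmap (shift_map f).
Proof.
move=> hf; split=> [[[|i]|[|i]]|i j] //=; try exact: hom_0.
have [->|ji] := eqVneq j (i + 1); last first.
  by rewrite (@shift_shape _ _ D 1 i j ji) cd_shape// comp_lfun0l comp_lfun0r.
have [i1|i1] := eqVneq i (-1).
  have z1 : rzero (D (i + 1 + 1)) by rewrite i1; exact: zD.
  by rewrite (hom_to0 (_ \o _)%VF z1) (hom_to0 (_ \o _)%VF z1).
have [i0|i0] := eqVneq i 0; last first.
  by rewrite (hom_from0 (_ \o _)%VF (zD i1 i0)) (hom_from0 (_ \o _)%VF (zD i1 i0)).
have z1 : rzero (D (i + 1 + 1)) by rewrite i0; exact: zD.
by rewrite (hom_to0 (_ \o _)%VF z1) (hom_to0 (_ \o _)%VF z1).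
Qed.

(** Presilting is used for U, which is only homotopy equivalent to D: the map
    D -> D[1] given by f is conjugated to a map U -> U[1], and the resulting null
    homotopy is carried back. *)
Lemma presilting_rigid U (f : 'Hom(D (-1), D 0)) :
  presilting U -> kisom U D -> is_hom f ->
  exists (a : 'Hom(D (-1), D (-1))) (b : 'Hom(D 0, D 0)),
    [/\ is_hom a, is_hom b & f = ((d \o a) + (b \o d))%VF].
Proof.
move=> ps [F [G [cF cG _ [k hk ek]]]] hf.
pose S i : 'Hom(U i, Defs.shift U 1 i) := (G (i + 1) \o (shift_map f i \o F i))%VF.
have cS : is_cmap S.
  have [hS eS] := shift_cmap hf.
  split=> [i|i j]; first by apply: hom_comp; [exact: cG.1|apply: hom_comp; [exact: hS|exact: cF.1]].
  have eG : (cd (Defs.shift U 1) i j \o G (i + 1))%VF = (G (j + 1) \o cd (Defs.shift D 1) i j)%VF.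
    by rewrite /= /shift_d -comp_lfunZl -comp_lfunZr cG.2.
  rewrite /S comp_lfunA eG -!comp_lfunA; congr (_ \o _)%VF.
  by rewrite [LHS]comp_lfunA eS -comp_lfunA cF.2.
have [h hh eh] := ps 1%N isT S cS.
pose a0 : 'Hom(U (-1), U (-1)) := - h (-1) (-1 - 1).
pose b0 : 'Hom(U 0, U 0) := h 0 (-1).
have eU x : G 0 (f (F (-1) x)) = cd U (-1) 0 (a0 x) + b0 (cd U (-1) 0 x).
  have := eh (-1); rewrite subr0 => /(congr1 (fun u : 'Hom(U (-1), U 0) => u x)).
  rewrite /S !comp_lfunE => ->.
  rewrite [LHS]add_lfunE; congr (_ + _); last by rewrite comp_lfunE.
  have es : cd (Defs.shift U 1) (-1 - 1) (-1) = - cd U (-1) 0 :> 'Hom(U (-1), U 0).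
    by rewrite /= /shift_d expr1 scaleN1r.
  refine (etrans (comp_lfunE _ _ _) _).
  refine (etrans (congr1 (fun u : 'Hom(U (-1), U 0) => u (h (-1) (-1 - 1) x)) es) _).
  by rewrite opp_lfunE /a0 opp_lfunE linearN.
pose k0 : 'Hom(D 0, D (-1)) := k 0 (-1).
have hk0 : is_hom k0 by exact: hk.
have e0 y : F 0 (G 0 y) = y + d (k0 y).
  have := ek 0; rewrite (hom_to0 (cd D 0 (0 + 1))); last exact: zD.
  rewrite comp_lfun0r addr0 => /(congr1 (fun u : 'Hom(D 0, D 0) => u y)).
  rewrite !(add_lfunE, opp_lfunE, comp_lfunE, id_lfunE) => e.
  by rewrite -[LHS](subrK y) e addrC.
have e1 x : F (-1) (G (-1) x) = x + k0 (d x).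
  have := ek (-1); rewrite (hom_from0 (cd D (-1 - 1) (-1))); last exact: zD.
  rewrite comp_lfun0l add0r => /(congr1 (fun u : 'Hom(D (-1), D (-1)) => u x)).
  rewrite !(add_lfunE, opp_lfunE, comp_lfunE, id_lfunE) => e.
  by rewrite -[LHS](subrK x) e addrC.
have cFd y : F 0 (cd U (-1) 0 y) = d (F (-1) y) by rewrite -!comp_lfunE cF.2.
have cGd y : cd U (-1) 0 (G (-1) y) = G 0 (d y) by rewrite -!comp_lfunE cG.2.
pose a1 : 'Hom(D (-1), D (-1)) := (F (-1) \o (a0 \o G (-1)))%VF.
pose a2 : 'Hom(D (-1), D (-1)) := (k0 \o (f \o (F (-1) \o G (-1))))%VF.
pose b1 : 'Hom(D 0, D 0) := (F 0 \o (b0 \o G 0))%VF.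
pose b2 : 'Hom(D 0, D 0) := (f \o k0)%VF.
have hd : is_hom d by exact: cd_hom.
have hF1 := cF.1 (-1); have hG1 := cG.1 (-1); have hF0 := cF.1 0; have hG0 := cG.1 0.
have ha0 : is_hom a0 by apply: hom_opp; exact: (hh (-1) (-1 - 1)).
have hb0 : is_hom b0 by exact: (hh 0 (-1)).
exists (a1 - a2), (b1 - b2); split.
- by apply: hom_sub; do !apply: hom_comp => //.
- by apply: hom_sub; do !apply: hom_comp => //.
apply/lfunP => x; have := eU (G (-1) x).
move=> /(congr1 (F 0)); rewrite lfunD cFd cGd e0 e1 lfunD => e.
rewrite add_lfunE !(comp_lfunE d) !(comp_lfunE (_ - _)) !add_lfunE !opp_lfunE.
rewrite !comp_lfunE e1 lfunB !lfunD.
move: e; rewrite !lfunD.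
set t1 := f x; set t2 := f (k0 _); set t3 := d (k0 t1); set t4 := d (k0 t2).
set t5 := d _; set t6 := F 0 _ => e.
have -> : t1 = (t1 + t2 + (t3 + t4)) - (t3 + t4) - t2 by rewrite addrK addrK.
rewrite e -!addrA; congr (_ + _).
by rewrite addrCA; congr (_ + _).
Qed.

End Concentrated.

Variables (R : realType) (n : nat) (P : 'I_n -> rmod A).
Hypothesis hP : indproj_list P.

Theorem presilting_pair U : two_term U -> presilting U ->
  [/\ rigid_pair R P (cohomology U 0) (cohomology (nu_cpx U) (-1)),
      full_on (H0 A) U & full_on (Hnu A) U].
Proof.
move=> [D [[pD _] zD iso]] ps.
have [f [g [cf cg gf fg]]] := kisom_functor (H0 A) iso.
have [f' [g' [cf' cg' gf' fg']]] := kisom_functor (Hnu A) iso.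
split; last first.
- exact: full_on_retract cf' cg' gf' (full_on_Hnu pD zD).
- exact: full_on_retract cf cg gf (full_on_H0 pD zD).
pose pr : 'Hom(D 0, cohomology U 0) := (hm (H0 A) g \o top_class D)%VF.
pose io : 'Hom(cohomology (nu_cpx U) (-1), nu (D (-1))) :=
  (bottom_cycle D \o hm (Hnu A) f')%VF.
have hg := @hm_hom _ _ (H0 A) _ _ _ cg; have hf' := @hm_hom _ _ (Hnu A) _ _ _ cf'.
have mg : mono (hm (H0 A) g).
  apply: monoI => // x gx; rewrite -(id_lfunE x) -[\1%VF]fg comp_lfunE gx.
  by rewrite linear0.
have eg : epi (hm (H0 A) g).
  apply: epiI => // y; exists (hm (H0 A) f y).
  by rewrite -comp_lfunE gf id_lfunE.
have mf' : mono (hm (Hnu A) f').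
  apply: monoI => // x gx; rewrite -(id_lfunE x) -[\1%VF]gf' comp_lfunE gx.
  by rewrite linear0.
have epr : epi pr by exact: epi_comp eg (top_class_epi zD).
have kpr x : pr x = 0 <-> exists y, cd D (-1) 0 y = x.
  rewrite -(top_class_ker zD) comp_lfunE.
  by split=> [/(mono_eq0 mg)//|->]; rewrite linear0.
have mio : mono io by exact: mono_comp (bottom_cycle_mono zD) mf'.
have kio v : nu_map (cd D (-1) 0) v = 0 <-> exists z, io z = v.
  rewrite (bottom_cycle_img zD); split=> [[h <-]|[z <-]]; last first.
    by exists (hm (Hnu A) f' z); exact/esym/comp_lfunE.
  exists (hm (Hnu A) g' h); refine (etrans (comp_lfunE _ _ _) _).
  by congr (fun_of_lfun _ _); rewrite -comp_lfunE fg' id_lfunE.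
have hd := @cd_hom _ _ D (-1) 0.
split.
- exact: (presentation_form R hP (@pD (-1)) (@pD 0) hd epr kpr mio kio).
- apply: (presentation_hom (@pD (-1)) (@pD 0) hd epr kpr mio kio) => u hu.
  refine (presilting_rigid zD ps iso hu).
- move=> L Y Z k q u.
  exact: (presentation_lift (@pD (-1)) (@pD 0) hd epr kpr mio kio).
- move=> X Y Z k q u.
  exact: (presentation_extend (@pD (-1)) (@pD 0) hd epr kpr mio kio).
Qed.

End TwoTerm.
(** * The modules attached to the facets *)

Section RigidPair.
Variables (R : realType) (K : fieldType) (A : falgType K).
Variables (n : nat) (P : 'I_n -> rmod A).
Hypothesis hP : indproj_list P.
Variables (M N : rmod A) (m : nat) (M_ N_ : 'I_m -> rmod A).
Hypothesis rp : rigid_pair R P M N.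
Hypotheses (dsM : is_dsum M M_) (dsN : is_dsum N N_).
Hypothesis locM : forall i (f : 'Hom(M_ i, M_ i)), is_hom f ->
  is_iso f \/ is_iso (\1%VF - f).
Hypothesis locN : forall i (f : 'Hom(N_ i, N_ i)), is_hom f ->
  is_iso f \/ is_iso (\1%VF - f).
Implicit Types (L Q X Y Z : rmod A) (th : 'rV[R]_n).

Let pP j : projective (P j) := projP hP (j := j).

(** f maps the fixed vectors of g f injectively to those of f g. *)
Lemma iso_sub_swap X Y (f : 'Hom(X, Y)) (g : 'Hom(Y, X)) : is_hom f -> is_hom g ->
  is_iso (\1%VF - (f \o g)%VF) -> is_iso (\1%VF - (g \o f)%VF).
Proof.
move=> hf hg /iso_mono_epi[mi _]; apply: mono_endo_iso; apply: monoI => [|x].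
  by apply: hom_sub; [exact: hom_id | exact: hom_comp].
rewrite add_lfunE opp_lfunE id_lfunE comp_lfunE => /eqP; rewrite subr_eq0 => /eqP xg.
have fx : f x = 0.
  apply: (mono_eq0 mi); rewrite add_lfunE opp_lfunE id_lfunE comp_lfunE -xg.
  by rewrite subrr.
by rewrite xg fx linear0.
Qed.

Definition radY i : submod (M_ i) :=
  gensub [set y | exists2 f : 'Hom(M, M_ i), in_rad f & y \in limg f].
Definition topY i : rmod A := quom (radY i).

Definition socX i : submod (N_ i) :=
  gensub [set x | forall f : 'Hom(N_ i, N), in_rad f -> f x = 0].
Definition botX i : rmod A := subm (socX i).

Lemma mem_socX i x : x \in svs (socX i) <->
  forall f : 'Hom(N_ i, N), in_rad f -> f x = 0.
Proof.
rewrite mem_gensub //; first split=> [f _|k y z yC zC f rf]; first exact: linear0.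
- by rewrite linearP /= yC ?zC// scaler0 addr0.
- by move=> a y yC f rf; rewrite rf.1 yC// linear0.
Qed.

Lemma radY_in i (f : 'Hom(M, M_ i)) x : in_rad f -> f x \in svs (radY i).
Proof. by move=> rf; apply: gensub_sub; exists f => //; rewrite memv_img ?memvf. Qed.

(** The submodule [radY i] is a sum of images of M, and Hom(M, N) = 0. *)
Lemma hom_radY_N i (g : 'Hom(subm (radY i), N)) : is_hom g -> g = 0.
Proof.
move=> hg; have [X [k [mk ek]]] := ex_kernel hg.
pose W := SubMod (img_stable (hom_comp (sub_mono (radY i)).1 mk.1)).
have sub : (radY i <= W)%VS.
  apply: gensub_min => _ [f rf /memv_imgP[z _ ->]].
  have [|f' hf' ff'] := factor_mono (sub_mono (radY i)) rf.1.
    by move=> x; apply: sub_lift; exact: radY_in.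
  have /(ek _)[y yz] : g (f' z) = 0.
    by rewrite -comp_lfunE (rp_hom rp (hom_comp hg hf')) zero_lfunE.
  by rewrite -ff' comp_lfunE -yz -comp_lfunE memv_img ?memvf.
apply/lfunP => x; rewrite zero_lfunE.
have /(subvP sub)/memv_imgP[y _] := sub_inj_in x.
rewrite comp_lfunE => /(mono_inj (sub_mono (radY i))) ->.
by apply/ek; exists y.
Qed.

(** A homomorphism M -> Y_i lifts to M -> M_i; if the lift is radical its image
    is divided out in Y_i, and otherwise it splits because End(M_i) is local. *)
Lemma hom_M_Y i (g : 'Hom(M, topY i)) : is_hom g -> g = 0 \/ epi g.
Proof.
move=> hg; have [g' hg' qg'] := rp_lift rp (sub_ses (radY i)) (@hom_radY_N i) hg.
have [rg|nrg] := pselect (in_rad g').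
  left; rewrite -qg'; apply/lfunP => x; rewrite comp_lfunE zero_lfunE.
  exact/quo_eq0/radY_in.
right; suff eg' : epi g' by rewrite -qg'; apply: epi_comp => //; exact: quo_epi.
have [h hh nh] : exists2 h : 'Hom(M_ i, M), is_hom h & ~ is_iso (\1%VF - (h \o g')%VF).
  apply: contrapT => no; apply: nrg; split=> // h hh; apply: contrapT => nh.
  by apply: no; exists h.
have [/iso_mono_epi[_ e]|] := locM (hom_comp hg' hh).
  apply: epiI => // y; have [x <-] := epi_surj e y.
  by exists (h x); rewrite comp_lfunE.
by move=> /(iso_sub_swap hg' hh).
Qed.

(** The module N_i / X_i embeds into a power of N, and Hom(M, N) = 0. *)
Lemma hom_M_quo_socX i (f : 'Hom(M, quom (socX i))) : is_hom f -> f = 0.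
Proof.
move=> hf; apply/lfunP => x; rewrite zero_lfunE.
have [y yx] := epi_surj (quo_epi (socX i)) (f x); rewrite -yx.
apply/quo_eq0/mem_socX => r rr.
have [|r' hr' r'q] := factor_epi (quo_epi (socX i)) rr.1.
  by move=> z /quo_eq0/mem_socX; exact.
rewrite -r'q comp_lfunE yx -comp_lfunE (rp_hom rp (hom_comp hr' hf)).
exact: zero_lfunE.
Qed.

(** Dually, a homomorphism X_i -> N extends to N_i -> N. *)
Lemma hom_X_N i (g : 'Hom(botX i, N)) : is_hom g -> g = 0 \/ mono g.
Proof.
move=> hg; have [g' hg' g'k] := rp_extend rp (sub_ses (socX i)) (@hom_M_quo_socX i) hg.
have [rg|nrg] := pselect (in_rad g').
  left; rewrite -g'k; apply/lfunP => x; rewrite comp_lfunE zero_lfunE.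
  by have /mem_socX := sub_inj_in x; apply.
right; suff mg' : mono g' by rewrite -g'k; apply: mono_comp => //; exact: sub_mono.
have [h hh nh] : exists2 h : 'Hom(N, N_ i), is_hom h & ~ is_iso (\1%VF - (h \o g')%VF).
  apply: contrapT => no; apply: nrg; split=> // h hh; apply: contrapT => nh.
  by apply: no; exists h.
have [/iso_mono_epi[e _]|//] := locN (hom_comp hh hg').
apply: monoI => // x gx; apply: (mono_eq0 e).
by rewrite comp_lfunE gx linear0.
Qed.

Lemma epi_M_Y i : exists q : 'Hom(M, topY i), epi q.
Proof.
have [inj [prj [h pi1 _ _]]] := dsM.
exists (quo_prj (radY i) \o prj i)%VF; apply: (epi_comp (quo_epi (radY i))).
apply: epiI; first exact: (h i).2.
by move=> y; exists (inj i y); rewrite -comp_lfunE pi1 id_lfunE.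
Qed.

Lemma mono_X_N i : exists j : 'Hom(botX i, N), mono j.
Proof.
have [inj [prj [h pi1 _ _]]] := dsN.
exists (inj i \o sub_inj (socX i))%VF; apply: (fun mi => mono_comp mi (sub_mono (socX i))).
apply: monoI; first exact: (h i).1.
by move=> y y0; rewrite -(id_lfunE y) -pi1 comp_lfunE y0 linear0.
Qed.

Lemma Tbar_Fbar th L : Tbar P th L -> euler P th L = 0 -> Fbar P th L.
Proof.
move=> /Tbar_epi T L0; apply/Fbar_mono => X j mj.
have [C [c [ec s]]] := is_ses_mono mj.
by have := T _ _ ec; have := euler_ses pP th s; rewrite L0; lra.
Qed.

Lemma Fbar_Tbar th L : Fbar P th L -> euler P th L = 0 -> Tbar P th L.
Proof.
move=> /Fbar_mono F L0; apply/Tbar_epi => X q eqq.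
have [C [k [mk s]]] := is_ses_epi eqq.
by have := F _ _ mk; have := euler_ses pP th s; rewrite L0; lra.
Qed.

(** Some Y_i maps to the factor module Q of M of value zero: a
    nonzero f : M -> Q generating a minimal right End(M)-submodule of Hom(M, Q)
    is annihilated by the radical of End(M). *)
Lemma Y_not_Tcat th : Tbar P th M -> ~ Tcat P th M ->
  exists i, ~ Tcat P th (topY i).
Proof.
move=> TM nTM.
have [Q [q [eqq FQ nQ]]] : exists Q (q : 'Hom(M, Q)),
    [/\ epi q, Fbar P th Q & ~ rzero Q].
  have [Z [k [q [eqq _ _ Q0 nQ]]]] := wmod_Tbar pP TM nTM.
  exists (wmod P th M), q; split=> //.
  by apply: Tbar_Fbar => //; exact: Tbar_quo eqq TM.
have q0 : q <> 0.
  move=> q0; apply: nQ; apply/rzeroP => y; have [x <-] := epi_surj eqq y.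
  by rewrite q0 zero_lfunE.
pose orb (f : 'Hom(M, Q)) := (postcomp M f @: HomA M M)%VS.
pose good d := `[< exists f : 'Hom(M, Q), [/\ is_hom f, f <> 0 & \dim (orb f) = d] >].
have ex : exists d, good d.
  by exists (\dim (orb q)); apply/asboolP; exists q; split=> //; case: eqq.
case: (ex_minnP ex) => d /asboolP[f [hf f0 df]] dmin.
have frad r : in_rad r -> (f \o r)%VF = 0 :> 'Hom(M, Q).
  move=> rr; apply: contrapT => fr0.
  have sub : (orb (f \o r)%VF <= orb f)%VS.
    apply/subvP => _ /memv_imgP[u /mem_HomA hu ->]; rewrite postcompE -comp_lfunA.
    by rewrite -postcompE memv_img//; apply/mem_HomA/hom_comp => //; exact: rr.1.
  have /eqP e : orb (f \o r)%VF == orb f.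
    rewrite eqEdim sub df; apply: dmin; apply/asboolP; exists (f \o r)%VF; split=> //.
    by apply: hom_comp => //; exact: rr.1.
  have : f \in orb f.
    rewrite -{1}(comp_lfun1r f) -postcompE memv_img//.
    by apply/mem_HomA; exact: hom_id.
  rewrite -e => /memv_imgP[u /mem_HomA hu]; rewrite postcompE -comp_lfunA => fu.
  have iso := iso_sub_swap hu rr.1 (rr.2 _ hu).
  apply: f0; apply: (epi_cancel ((iso_mono_epi _).1 iso).2).
  by rewrite comp_lfun0l comp_lfunDr comp_lfun1r comp_lfunNr -fu subrr.
have [inj [prj [h _ _ s1]]] := dsM.
have [i fi] : exists i, (f \o inj i)%VF <> 0.
  apply: contrapT => no; apply: f0; rewrite -(comp_lfun1r f) -s1.
  apply/lfunP => x; rewrite zero_lfunE comp_lfunE sum_lfunE linear_sum big1// => i _ /=.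
  rewrite comp_lfunE -(comp_lfunE f).
  have -> : (f \o inj i)%VF = 0 by apply: contrapT => fi; apply: no; exists i.
  exact: zero_lfunE.
exists i => TY; have hfi := hom_comp hf (h i).1.
pose W := SubMod (ker_stable hfi).
have sub : (radY i <= W)%VS.
  apply: gensub_min => _ [r rr /memv_imgP[x _ ->]]; rewrite /= memv_ker.
  rewrite comp_lfunE -(comp_lfunE (inj i)) -(comp_lfunE f) frad ?zero_lfunE//.
  split=> [|g hg]; first by apply: hom_comp; [exact: (h i).1 | exact: rr.1].
  by rewrite comp_lfunA; apply: rr.2; apply: hom_comp => //; exact: (h i).1.
have [|g hg gq] := factor_epi (quo_epi (radY i)) hfi.
  by move=> x /quo_eq0/(subvP sub); rewrite /= memv_ker => /eqP.
by apply: fi; rewrite -gq (hom_Tcat_Fbar hg TY FQ) comp_lfun0l.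
Qed.

(** Dually, some X_i receives a map from the submodule of N of value zero. *)
Lemma X_not_Fcat th : Fbar P th N -> ~ Fcat P th N ->
  exists i, ~ Fcat P th (botX i).
Proof.
move=> FN nFN.
have [Q [z [mz TQ nQ]]] : exists Q (z : 'Hom(Q, N)),
    [/\ mono z, Tbar P th Q & ~ rzero Q].
  have [Z [z [c [mz _ _ Q0 nQ]]]] := wmod_Fbar pP FN nFN.
  exists (wmod P th N), z; split=> //.
  by apply: Fbar_Tbar => //; exact: Fbar_sub mz FN.
have z0 : z <> 0.
  move=> z0; apply: nQ; apply/rzeroP => y; apply: (mono_eq0 mz).
  by rewrite z0 zero_lfunE.
pose orb (f : 'Hom(Q, N)) := (precomp N f @: HomA N N)%VS.
pose good d := `[< exists f : 'Hom(Q, N), [/\ is_hom f, f <> 0 & \dim (orb f) = d] >].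
have ex : exists d, good d.
  by exists (\dim (orb z)); apply/asboolP; exists z; split=> //; case: mz.
case: (ex_minnP ex) => d /asboolP[f [hf f0 df]] dmin.
have frad r : in_rad r -> (r \o f)%VF = 0 :> 'Hom(Q, N).
  move=> rr; apply: contrapT => fr0.
  have sub : (orb (r \o f)%VF <= orb f)%VS.
    apply/subvP => _ /memv_imgP[u /mem_HomA hu ->]; rewrite precompE comp_lfunA.
    by rewrite -precompE memv_img//; apply/mem_HomA/hom_comp => //; exact: rr.1.
  have /eqP e : orb (r \o f)%VF == orb f.
    rewrite eqEdim sub df; apply: dmin; apply/asboolP; exists (r \o f)%VF; split=> //.
    by apply: hom_comp => //; exact: rr.1.
  have : f \in orb f.
    rewrite -{1}(comp_lfun1l f) -precompE memv_img//.
    by apply/mem_HomA; exact: hom_id.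
  rewrite -e => /memv_imgP[u /mem_HomA hu]; rewrite precompE comp_lfunA => fu.
  apply: f0; apply: (mono_cancel ((iso_mono_epi _).1 (rr.2 _ hu)).1).
  by rewrite comp_lfun0r comp_lfunDl comp_lfun1l comp_lfunNl -fu subrr.
have [inj [prj [h _ _ s1]]] := dsN.
have [i fi] : exists i, (prj i \o f)%VF <> 0.
  apply: contrapT => no; apply: f0; rewrite -(comp_lfun1l f) -s1.
  apply/lfunP => x; rewrite zero_lfunE comp_lfunE sum_lfunE big1// => i _ /=.
  rewrite comp_lfunE -(comp_lfunE _ f).
  have -> : (prj i \o f)%VF = 0 by apply: contrapT => fi; apply: no; exists i.
  by rewrite zero_lfunE linear0.
exists i => FX; have hfi := hom_comp (h i).2 hf.
have [|g hg kg] := factor_mono (sub_mono (socX i)) hfi.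
  move=> x; apply: sub_lift; apply/mem_socX => r rr.
  rewrite comp_lfunE -(comp_lfunE r) -comp_lfunE frad ?zero_lfunE//.
  split=> [|g hg]; first by apply: hom_comp; [exact: rr.1 | exact: (h i).2].
  rewrite comp_lfunA; apply: iso_sub_swap (h i).2 _ _.
    by apply: hom_comp => //; exact: rr.1.
  by rewrite comp_lfunA; apply: rr.2; apply: hom_comp => //; exact: (h i).2.
by apply: fi; rewrite -kg (hom_Tbar_Fcat hg TQ FX) comp_lfun0r.
Qed.

(** ** The cone *)

Definition pair_cone : set 'rV[R]_n := [set th | Tbar P th M /\ Fbar P th N].

Definition ineq (c : 'rV[R]_n) : Prop :=
  (exists W : submod M, ~ rzero (quom W) /\ c = dimv R P (quom W)) \/
  (exists W : submod N, ~ rzero (subm W) /\ c = - dimv R P (subm W)).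

(** The entries of the dimension vectors of the factor modules of M and of the
    submodules of N are bounded by those of M and N. *)
Lemma ineq_finite : exists s : seq 'rV[R]_n, forall c, c \in s <-> ineq c.
Proof.
pose B := (\sum_j (\dim (HomA (P j) M) + \dim (HomA (P j) N)))%N.
pose T : finType := (bool * {ffun 'I_n -> 'I_B.+1})%type.
pose v (x : T) : 'rV[R]_n := (-1) ^+ x.1 *: \row_j (x.2 j)%:R.
exists [seq v x | x <- enum T & `[< ineq (v x) >]] => c; split.
  by move=> /mapP[x]; rewrite mem_filter => /andP[/asboolP vx _] ->.
move=> ic; suff [x xc] : exists x : T, v x = c.
  by apply/mapP; exists x; rewrite // mem_filter mem_enum andbT; apply/asboolP; rewrite xc.
have le_B X : (forall j, (\dim (HomA (P j) X) <= B)%N) ->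
    forall b : bool, exists x : T, v x = (-1) ^+ b *: dimv R P X.
  move=> XB b; exists (b, [ffun j => inord (\dim (HomA (P j) X))]).
  by congr (_ *: _); apply/rowP => j; rewrite !mxE ffunE inordK// ltnS.
have jB j : (\dim (HomA (P j) M) + \dim (HomA (P j) N) <= B)%N.
  by rewrite /B (bigD1 j)//= leq_addr.
case: ic => [[W [_ ->]]|[W [_ ->]]].
  have [|x xE] := le_B (quom W) _ false; last by exists x; rewrite xE expr0 scale1r.
  move=> j; apply: leq_trans (jB j); apply: leq_trans (leq_addr _ _).
  by rewrite (dim_HomA_ses (@pP j) (sub_ses W)) leq_addl.
have [|x xE] := le_B (subm W) _ true; last by exists x; rewrite xE expr1 scaleN1r.
move=> j; apply: leq_trans (jB j); apply: leq_trans (leq_addl _ _).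
by rewrite (dim_HomA_ses (@pP j) (sub_ses W)) leq_addr.
Qed.

Lemma euler_pos_M th Q : (forall X, euler P th X =
    (\dim (HomA M X))%:R - (\dim (HomA X N))%:R) ->
  ~ rzero Q -> (exists q : 'Hom(M, Q), epi q) -> 0 < euler P th Q.
Proof.
move=> hth nQ [q eqq]; rewrite hth (dim_HomA_eq0 Q N).2.
  rewrite subr0 ltr0n lt0n; apply/eqP => /(dim_HomA_eq0 _ _).1 M0.
  apply: nQ; apply/rzeroP => y; have [x <-] := epi_surj eqq y.
  by rewrite (M0 q eqq.1) zero_lfunE.
move=> f hf; apply: (epi_cancel eqq).
by rewrite comp_lfun0l; exact: (rp_hom rp (hom_comp hf eqq.1)).
Qed.

Lemma euler_neg_N th Q : (forall X, euler P th X =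
    (\dim (HomA M X))%:R - (\dim (HomA X N))%:R) ->
  ~ rzero Q -> (exists j : 'Hom(Q, N), mono j) -> euler P th Q < 0.
Proof.
move=> hth nQ [q mq]; rewrite hth (dim_HomA_eq0 M Q).2.
  rewrite sub0r oppr_lt0 ltr0n lt0n; apply/eqP => /(dim_HomA_eq0 _ _).1 M0.
  apply: nQ; apply/rzeroP => y; apply: (mono_eq0 mq).
  by rewrite (M0 q mq.1) zero_lfunE.
move=> f hf; apply: (mono_cancel mq).
by rewrite comp_lfun0r; exact: (rp_hom rp (hom_comp mq.1 hf)).
Qed.

(** The class of U satisfies all inequalities strictly: its value on a factor module
    X of M is dim Hom(M, X), because Hom(X, N) = 0, and its value on a submodule X of
    N is - dim Hom(X, N). *)
Lemma cone_polyhedral : exists s p, [/\ pair_cone = hcone s, strict s p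
  & forall th, Tcat P th M -> Fcat P th N -> strict s th].
Proof.
have [s hs] := ineq_finite; have [p hp] := rp_form rp.
have st th : Tcat P th M -> Fcat P th N -> strict s th.
  move=> T F c /hs[[W [nW ->]]|[W [nW ->]]].
    by rewrite -euler_dot; exact: T.
  by rewrite dotNl oppr_gt0 -euler_dot; exact: F.
exists s, p; split=> //.
  apply/seteqP; split=> th.
    move=> [T F] c /hs[[W [nW ->]]|[W [nW ->]]].
      by rewrite -euler_dot; exact: T.
    by rewrite dotNl oppr_ge0 -euler_dot; exact: F.
  move=> hth; split=> W nW; rewrite euler_dot.
    by apply/hth/hs; left; exists W.
  by rewrite -oppr_ge0 -dotNl; apply/hth/hs; right; exists W.
apply: st.
  by move=> W nW; apply: euler_pos_M => //; exists (quo_prj W); exact: quo_epi.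
by move=> W nW; apply: euler_neg_N => //; exists (sub_inj W); exact: sub_mono.
Qed.

(** Monomorphisms of W_theta are injective, since W_theta is closed under
    kernels. *)
Lemma Wcat_mono th X L (f : 'Hom(X, L)) : Wcat P th X -> Wcat P th L -> is_hom f ->
  (forall Z (g h : 'Hom(Z, X)), Wcat P th Z -> is_hom g -> is_hom h ->
     (f \o g)%VF = (f \o h)%VF -> g = h) -> mono f.
Proof.
move=> [TX FX] [TL FL] hf canc.
have [Z [k [mk ek]]] := ex_kernel hf.
have [I [e [j [ee mj je]]]] := ex_image hf.
have I0 : euler P th I = 0.
  by apply/eqP; rewrite eq_le (Fbar_le0 (Fbar_sub mj FL)) (Tbar_ge0 (Tbar_quo ee TX)).
have X0 : euler P th X = 0.
  by apply/eqP; rewrite eq_le (Fbar_le0 FX) (Tbar_ge0 TX).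
have s : is_ses k e.
  apply: is_sesP => // y; rewrite -ek -je comp_lfunE.
  by split=> [->|/(mono_eq0 mj)//]; rewrite linear0.
have Z0 : euler P th Z = 0.
  by have := euler_ses pP th s; rewrite X0 I0 addr0.
have FZ := Fbar_sub mk FX.
have fk : (f \o k)%VF = 0.
  by apply/lfunP => x; rewrite comp_lfunE zero_lfunE; apply/ek; exists x.
have k0 : k = 0.
  apply: (canc Z) => //; [by split=> //; exact: Fbar_Tbar | by case: mk | exact: hom_0 |].
  by rewrite fk comp_lfun0r.
by apply: monoI => // x /ek[z <-]; rewrite k0 zero_lfunE.
Qed.

Lemma dimv_ge0 X j : 0 <= dimv R P X 0 j.
Proof. by rewrite mxE ler0n. Qed.

(** Dimension vectors have nonnegative entries, and a nonzero module has a nonzero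
    one. *)
Lemma dimv_factor_gt0 X L k : ~ rzero X -> dimv R P X = k *: dimv R P L -> 0 < k.
Proof.
move=> nX e; rewrite ltNge; apply/negP => k0; apply: nX.
apply: (dimv_eq0 (R := R) hP); apply/rowP => j.
rewrite [RHS]mxE; apply/eqP; rewrite eq_le dimv_ge0 andbT e mxE.
by rewrite mulr_le0_ge0// dimv_ge0.
Qed.

Section Facet.
Variables (F : set 'rV[R]_n) (th0 : 'rV[R]_n).
Hypotheses (dF : (\dim (vspan F)).+1 = n) (FD : forall th, F th -> pair_cone th).
Hypothesis Fth0 : F th0.

Lemma pair_cone_quo_ge0 th Q (q : 'Hom(M, Q)) : epi q -> pair_cone th -> 0 <= dot (dimv R P Q) th.
Proof. by move=> eqq [T _]; rewrite -euler_dot (Tbar_ge0 (Tbar_quo eqq T)). Qed.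

Lemma pair_cone_sub_ge0 th Q (j : 'Hom(Q, N)) : mono j -> pair_cone th -> 0 <= dot (- dimv R P Q) th.
Proof.
move=> mj [_ T]; rewrite dotNl oppr_ge0 -euler_dot.
exact: (Fbar_le0 (Fbar_sub mj T)).
Qed.

Lemma quo_vanish th Q (q : 'Hom(M, Q)) : epi q -> relint F th -> euler P th Q = 0 ->
  forall x, F x -> euler P x Q = 0.
Proof.
move=> eqq rth; rewrite euler_dot => Q0 x Fx; rewrite euler_dot.
apply: (relint_vanish rth) => // y /FD; exact: pair_cone_quo_ge0 eqq.
Qed.

Lemma sub_vanish th Q (j : 'Hom(Q, N)) : mono j -> relint F th -> euler P th Q = 0 ->
  forall x, F x -> euler P x Q = 0.
Proof.
move=> mj rth; rewrite euler_dot => Q0 x Fx; apply/eqP; rewrite euler_dot -oppr_eq0 -dotNl.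
apply/eqP; apply: (relint_vanish rth) => //; last by rewrite dotNl Q0 oppr0.
by move=> y /FD; exact: pair_cone_sub_ge0 mj.
Qed.

(** A nonzero submodule X of L in W_theta has class proportional to the one of L,
    because both [L] and [L/X] define the hyperplane of F; so the class of U is
    positive on X and M maps nontrivially to X.  Such a map lifts to M -> Y_i, which
    has to be surjective. *)
Lemma simple_plus i th : ~ Tcat P th0 (topY i) -> relint F th ->
  euler P th (wmod P th0 (topY i)) = 0 ->
  simple_in (Wcat P th) (wmod P th0 (topY i)).
Proof.
move=> nT rth; set L := wmod _ _ _ => L0.
have [qM eqM] := epi_M_Y i; have [TM FN] := FD Fth0.
have [Z [k [q [eqq s TZ _ nL]]]] := wmod_Tbar pP (Tbar_quo eqM TM) nT.
have eML := epi_comp eqq eqM.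
have [TMth _] := FD rth.1.
have TL : Tbar P th L := Tbar_quo eML TMth.
have WL : Wcat P th L by split=> //; exact: Tbar_Fbar.
split=> // X f WX hf canc; have [X0|nX] := pselect (rzero X); [by left | right].
have mf := Wcat_mono WX WL hf canc.
apply/iso_mono_epi; split=> //.
have [C [c [ec sc]]] := is_ses_mono mf.
have X0 : euler P th X = 0.
  by apply/eqP; rewrite eq_le (Fbar_le0 WX.2) (Tbar_ge0 WX.1).
have C0 : euler P th C = 0 by have := euler_ses pP th sc; rewrite L0 X0 add0r.
have L0F := quo_vanish eML rth L0; have C0F := quo_vanish (epi_comp ec eML) rth C0.
have [a Ca] : exists a, dimv R P C = a *: dimv R P L.
  apply: (proportional dF); last by apply/eqP => /(dimv_eq0 hP).
  - by move=> x /L0F; rewrite euler_dot.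
  - by move=> x /C0F; rewrite euler_dot.
have Xa : dimv R P X = (1 - a) *: dimv R P L.
  by rewrite scalerBl scale1r -Ca (dimv_ses R pP sc) addrK.
have a1 := dimv_factor_gt0 nX Xa.
have [p hp] := rp_form rp.
have pX : 0 < euler P p X.
  rewrite euler_dot Xa dotZl mulr_gt0// -euler_dot.
  by apply: euler_pos_M => //; exists (q \o qM)%VF.
have [g [hg g0]] : exists g : 'Hom(M, X), is_hom g /\ g <> 0.
  apply: contrapT => no; move: pX; rewrite hp (dim_HomA_eq0 M X).2.
    by rewrite sub0r oppr_gt0 ltNge ler0n.
  by move=> g hg; apply: contrapT => g0; apply: no; exists g.
have ZN (u : 'Hom(Z, N)) : is_hom u -> u = 0.
  by move=> hu; exact: (hom_Tcat_Fbar hu TZ FN).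
have [g' hg' qg'] := rp_lift rp s ZN (hom_comp hf hg).
have [g'0|eg'] := hom_M_Y hg'.
  by case: g0; apply: (mono_cancel mf); rewrite -qg' g'0 !comp_lfun0r.
have := epi_comp eqq eg'; rewrite qg' => efg.
apply: epiI => // y; have [x <-] := epi_surj efg y.
by exists (g x); rewrite comp_lfunE.
Qed.

(** Dually: if L/X is nonzero, then the class of U is negative on it, and a nonzero
    map L/X -> N gives a map L -> N that extends to X_i -> N.  This extension has to
    be injective although it vanishes on X. *)
Lemma simple_minus i th : ~ Fcat P th0 (botX i) -> relint F th ->
  euler P th (wmod P th0 (botX i)) = 0 ->
  simple_in (Wcat P th) (wmod P th0 (botX i)).
Proof.
move=> nT rth; set L := wmod _ _ _ => L0.
have [jN mjN] := mono_X_N i; have [TM FN] := FD Fth0.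
have [Z [z [q [mz s FZ _ nL]]]] := wmod_Fbar pP (Fbar_sub mjN FN) nT.
have mLN := mono_comp mjN mz.
have [_ FNth] := FD rth.1.
have FL : Fbar P th L := Fbar_sub mLN FNth.
have WL : Wcat P th L by split=> //; exact: Fbar_Tbar.
split=> // X f WX hf canc; have [X0|nX] := pselect (rzero X); [by left | right].
have mf := Wcat_mono WX WL hf canc.
apply/iso_mono_epi; split=> //.
have [C [c [ec sc]]] := is_ses_mono mf.
have [zC|nC] := pselect (rzero C).
  apply: epiI => // y; apply/(ses_eq0 _ sc).
  by rewrite (hom_to0 c zC) zero_lfunE.
exfalso; have X0 : euler P th X = 0.
  by apply/eqP; rewrite eq_le (Fbar_le0 WX.2) (Tbar_ge0 WX.1).
have L0F := sub_vanish mLN rth L0; have X0F := sub_vanish (mono_comp mLN mf) rth X0.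
have [a Xa] : exists a, dimv R P X = a *: dimv R P L.
  apply: (proportional dF); last by apply/eqP => /(dimv_eq0 hP).
  - by move=> x /L0F; rewrite euler_dot.
  - by move=> x /X0F; rewrite euler_dot.
have Ca : dimv R P C = (1 - a) *: dimv R P L.
  by rewrite scalerBl scale1r -Xa (dimv_ses R pP sc) addrC addKr.
have a1 := dimv_factor_gt0 nC Ca.
have [p hp] := rp_form rp.
have pC : euler P p C < 0.
  rewrite euler_dot Ca dotZl pmulr_rlt0// -euler_dot.
  by apply: euler_neg_N => //; exists (jN \o z)%VF.
have [g [hg g0]] : exists g : 'Hom(C, N), is_hom g /\ g <> 0.
  apply: contrapT => no; move: pC; rewrite hp (dim_HomA_eq0 C N).2.
    by rewrite subr0 ltNge ler0n.
  by move=> g hg; apply: contrapT => g0; apply: no; exists g.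
have MZ (u : 'Hom(M, Z)) : is_hom u -> u = 0.
  by move=> hu; exact: (hom_Tbar_Fcat hu TM FZ).
have [g' hg' g'z] := rp_extend rp s MZ (hom_comp hg ec.1).
have [g'0|mg'] := hom_X_N hg'.
  by case: g0; apply: (epi_cancel ec); rewrite -g'z g'0 !comp_lfun0l.
have := mono_comp mg' mz; rewrite g'z => mgc.
apply: nX; apply/rzeroP => x; apply: (mono_eq0 mf); apply: (mono_eq0 mgc).
rewrite comp_lfunE (_ : c (f x) = 0) ?linear0//.
by apply/(ses_eq0 _ sc); exists x.
Qed.

End Facet.
End RigidPair.
(** * The facets of D(U) *)

Section Facets.
Variables (R : realType) (K : fieldType) (A : falgType K).
Variables (n : nat) (P : 'I_n -> rmod A).
Hypothesis hP : indproj_list P.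
Variables (m : nat) (U : cpx A) (U_ : 'I_m -> cpx A).
Hypothesis hU : basic_2psilt U U_.

Let M : rmod A := cohomology U 0.
Let N : rmod A := cohomology (nu_cpx U) (-1).
Let M_ i : rmod A := cohomology (U_ i) 0.
Let N_ i : rmod A := cohomology (nu_cpx (U_ i)) (-1).

Implicit Types (F : set 'rV[R]_n) (th : 'rV[R]_n) (L : rmod A).

Let pP j : projective (P j) := projP hP (j := j).

Lemma summand_endo (T : hfunctor A) i (f : 'Hom(ho T (U_ i), ho T (U_ i))) :
  full_on T U -> is_hom f -> is_iso f \/ is_iso (\1%VF - f).
Proof.
have [_ [indec ds _]] := hU; move=> fU hf.
have [inj [prj [c pi1 _ _]]] := ds.
have pi : (hm T (prj i) \o hm T (inj i))%VF = \1%VF.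
  rewrite -(hm_comp T (c i).2 (c i).1) -hm_id.
  apply: hm_homotopic (pi1 i); last exact: cmap_id.
  exact: cmap_comp (c i).2 (c i).1.
have [g cg <-] := full_on_retract (c i).1 (c i).2 pi fU hf.
exact: indecomposable_endo (indec i).1 (indec i).2 cg.
Qed.

Lemma presilt_rigid : rigid_pair R P M N.
Proof. by have [[_ tU ps] _] := hU; have [] := presilting_pair R hP tU ps. Qed.

Lemma presilt_dsumM : is_dsum M M_.
Proof. by have [_ [_ ds _]] := hU; exact: (functor_dsum (H0 A) ds). Qed.

Lemma presilt_dsumN : is_dsum N N_.
Proof. by have [_ [_ ds _]] := hU; exact: (functor_dsum (Hnu A) ds). Qed.

Lemma presilt_locM i (f : 'Hom(M_ i, M_ i)) : is_hom f ->
  is_iso f \/ is_iso (\1%VF - f).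
Proof.
have [[_ tU ps] _] := hU; have [_ fM _] := presilting_pair R hP tU ps.
exact: (@summand_endo (H0 A) i f fM).
Qed.

Lemma presilt_locN i (f : 'Hom(N_ i, N_ i)) : is_hom f ->
  is_iso f \/ is_iso (\1%VF - f).
Proof.
have [[_ tU ps] _] := hU; have [_ _ fN] := presilting_pair R hP tU ps.
exact: (@summand_endo (Hnu A) i f fN).
Qed.

Let rp := presilt_rigid.
Let dsM := presilt_dsumM.
Let dsN := presilt_dsumN.

Lemma facet_sub (D F : set 'rV[R]_n) : is_facet D F -> forall th, F th -> D th.
Proof. by move=> [[l _ ->] _] th []. Qed.

(** The factor module [wmod] of Y_i has a value that is nonnegative on D(U) and zero
    at a relative interior point of F, hence zero on F. *)
Lemma boundary_plus F th i : is_facet (coneD P U) F -> relint F th ->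
  ~ Tcat P th (Yplus U U_ i) -> F `<=` boundary P U U_ i true.
Proof.
move=> fF rth nT x Fx; have FD := facet_sub fF.
have [qM eqM] := epi_M_Y dsM i; have [TM _] := FD _ rth.1.
have [Z [k [q [eqq _ _ L0 nL]]]] := wmod_Tbar pP (Tbar_quo eqM TM) nT.
split; first exact: FD.
move=> /Tcat_epi T; have := T _ _ eqq nL.
by rewrite (quo_vanish FD (epi_comp eqq eqM) rth L0 Fx) ltxx.
Qed.

Lemma boundary_minus F th i : is_facet (coneD P U) F -> relint F th ->
  ~ Fcat P th (Xminus U U_ i) -> F `<=` boundary P U U_ i false.
Proof.
move=> fF rth nT x Fx; have FD := facet_sub fF.
have [jN mjN] := mono_X_N dsN i; have [_ FN] := FD _ rth.1.
have [Z [z [c [mz _ _ L0 nL]]]] := wmod_Fbar pP (Fbar_sub mjN FN) nT.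
split; first exact: FD.
move=> /Fcat_mono T; have := T _ _ mz nL.
by rewrite (sub_vanish FD (mono_comp mjN mz) rth L0 Fx) ltxx.
Qed.

(** A relative interior point of a facet is not an interior point of D(U), so that
    one of the strict conditions on M and N fails there. *)
Lemma facet_labelled F th : is_facet (coneD P U) F -> relint F th ->
  exists i e, facet_label P U U_ F = Some (i, e) /\ F `<=` boundary P U U_ i e.
Proof.
move=> fF rth; suff [i [e Fb]] : exists i e, F `<=` boundary P U U_ i e.
  rewrite /facet_label; case: pickP => [[i' e'] /asboolP h|/(_ (i, e))].
    by exists i', e'.
  by move=> /negP no; exfalso; apply: no; exact/asboolP.
have [TM FN] := facet_sub fF rth.1.
have [s [p [eD _ st]]] := cone_polyhedral hP rp.
have [T|nT] := pselect (Tcat P th M); last first.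
  by have [i ni] := Y_not_Tcat hP dsM TM nT; exists i, true; exact: boundary_plus ni.
have [T'|nT'] := pselect (Fcat P th N); last first.
  by have [i ni] := X_not_Fcat hP dsN FN nT'; exists i, false; exact: boundary_minus ni.
have eD' : coneD P U = hcone s := eD.
by have := facet_not_strict _ rth.1 (st th T T'); rewrite -eD' => /(_ fF).
Qed.

Lemma facet_module_props F th0 (L := facet_module P U U_ F th0)
    (eps := facet_sign P U U_ F) : is_facet (coneD P U) F -> relint F th0 ->
  [/\ forall th, relint F th -> simple_in (Wcat P th) L,
      ~ rzero L,
      forall th, F th -> euler P th L = 0,
      forall th, coneD P U th -> 0 <= eps%:~R * euler P th L
    & eps = 1 \/ eps = -1].
Proof.
move=> fF r0; have FD := facet_sub fF.
have [i [e [lab Fb]]] := facet_labelled fF r0.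
rewrite /L /eps /facet_module /facet_sign lab; case: e Fb {lab} => Fb.
  have [_ nT] := Fb _ r0.1.
  have [qM eqM] := epi_M_Y dsM i; have [TM _] := FD _ r0.1.
  have [Z [k [q [eqq _ _ L0 nL]]]] := wmod_Tbar pP (Tbar_quo eqM TM) nT.
  have L0F := quo_vanish FD (epi_comp eqq eqM) r0 L0.
  split=> //; last by left.
    move=> th rth; apply: (simple_plus hP rp dsM presilt_locM fF.2 FD r0.1 nT rth).
    exact: L0F rth.1.
  move=> th Dth; rewrite mul1r euler_dot.
  exact: pair_cone_quo_ge0 (epi_comp eqq eqM) Dth.
have [_ nT] := Fb _ r0.1.
have [jN mjN] := mono_X_N dsN i; have [_ FN] := FD _ r0.1.
have [Z [z [c [mz _ _ L0 nL]]]] := wmod_Fbar pP (Fbar_sub mjN FN) nT.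
have L0F := sub_vanish FD (mono_comp mjN mz) r0 L0.
split=> //; last by right.
  move=> th rth; apply: (simple_minus hP rp dsN presilt_locN fF.2 FD r0.1 nT rth).
  exact: L0F rth.1.
move=> th Dth; rewrite mulrN1z mulN1r euler_dot -dotNl.
exact: pair_cone_sub_ge0 (mono_comp mjN mz) Dth.
Qed.

Lemma euler_K0_sign (th : 'rV[R]_n) L (e : int) : e = 1 \/ e = -1 ->
  euler_K0 P th (K0_class L *~ e) = e%:~R * euler P th L.
Proof.
have e00 : euler_K0 P th (0 : K0mod A) = 0.
  have := euler_K0D th 0 0 pP; rewrite addr0 -{1}[euler_K0 P th 0]addr0.
  by move=> /addrI.
case=> ->; first by rewrite mulr1z mul1r euler_K0_class.
rewrite mulrN1z mulrN1z mulN1r -(euler_K0_class th L pP).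
apply/eqP; rewrite -addr_eq0 -euler_K0D// addNr e00 //.
Qed.

End Facets.

(* [th] is an arbitrary choice of a point in the relative interior of every
   facet. *)
Theorem theorem1p5 (R : realType) (K : fieldType) (A : falgType K)
    (n : nat) (P : 'I_n -> rmod A) (hP : indproj_list P)
    (m : nat) (U : cpx A) (U_ : 'I_m -> cpx A) (hU : basic_2psilt U U_)
    (th : set 'rV[R]_n -> 'rV[R]_n)
    (hth : forall F, is_facet (coneD P U) F -> relint F (th F)) :
  let D : set 'rV[R]_n := coneD P U in
  let eps := facet_sign P U U_ in
  let L := fun F => facet_module P U U_ F (th F) in
  (forall F, is_facet D F ->
    [/\ forall theta, relint F theta -> simple_in (Wcat P theta) (L F),
        is_inner_normal P D F (K0_class (L F) *~ eps F)
      & F = [set theta | D theta /\ euler P theta (L F) = 0]]) /\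
  D = [set theta | forall F, is_facet D F -> 0 <= (eps F)%:~R * euler P theta (L F)].
Proof.
move=> D eps L.
have [s [p [eD st _]]] := cone_polyhedral hP (presilt_rigid R hP hU).
have eD' : D = hcone s := eD.
have props F := facet_module_props hP hU (th0 := th F) (F := F).
have dL0 F : is_facet D F -> dimv R P (L F) != 0.
  move=> fF; have [_ nL _ _ _] := props F fF (hth F fF).
  by apply/eqP => /(dimv_eq0 hP).
have eps0 F : is_facet D F -> (eps F)%:~R != 0 :> R.
  move=> fF; have [_ _ _ _ []] := props F fF (hth F fF); rewrite -/(eps F) => ->.
    exact: oner_neq0.
  by rewrite mulrN1z oppr_eq0 oner_neq0.
have sF F : is_facet D F -> forall x, F x -> dot (dimv R P (L F)) x = 0.
  move=> fF x Fx; have [_ _ L0 _ _] := props F fF (hth F fF).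
  by rewrite -euler_dot L0.
have posD F : is_facet D F -> forall x, D x -> 0 <= dot ((eps F)%:~R *: dimv R P (L F)) x.
  move=> fF x Dx; have [_ _ _ h _] := props F fF (hth F fF).
  by rewrite dotZl -euler_dot h.
split=> [F fF|].
  have [simp nL L0 pos epsE] := props F fF (hth F fF); split=> //.
    split=> [|x Fx|x Dx]; rewrite ?euler_K0_sign//; last exact: pos.
      exists (dimv R P (L F)); rewrite euler_K0_sign// euler_dot => /eqP.
      rewrite mulf_eq0 (negbTE (eps0 F fF)) => /eqP/dot_eq0/eqP.
      by rewrite (negbTE (dL0 F fF)).
    by rewrite L0// mulr0.
  have fF' := fF; rewrite eD' in fF'.
  rewrite {1}(facet_eq st fF' (dL0 F fF) (sF F fF)) -eD'.
  by apply/seteqP; split=> x [Dx e]; split=> //; move: e; rewrite euler_dot.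
apply/seteqP; split=> x.
  by move=> Dx F fF; have := posD F fF x Dx; rewrite dotZl -euler_dot.
move=> hx; rewrite eD'.
apply: (hcone_facets (b := fun F => (eps F)%:~R *: dimv R P (L F)) st).
  move=> F; rewrite -eD' => fF; split.
  - by rewrite scaler_eq0 negb_or eps0// dL0.
  - by move=> y Fy; rewrite dotZl sF// mulr0.
  - exact: posD.
by move=> F; rewrite -eD' => /hx; rewrite dotZl -euler_dot.
Qed.
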